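(* Let $(A(n))_{n\ge1}$ be an i.i.d. sequence of random topical operators on $\mathbb R^d$ with the memory loss property, let $X^0$ be an $\mathbb R^d$-valued random variable independent of $(A(n))$, and let $\phi:\mathbb R^d\to\mathbb R$ be topical. Let $\sigma^2\ge0$ denote the constant such that $\frac{x(n,X^0)-n\gamma\mathbf 1}{\sqrt n}$ converges weakly to a random vector with all coordinates equal of law $\mathcal N(0,\sigma^2)$. Assume one of the following: (i) $\sup_x|\phi(A(1)x)-\phi(x)|$ has a finite second moment, $\sigma>0$, and the system is non arithmetic; (ii) $\|A(1)0\|_\infty$ has a finite $(4+\epsilon)$-th moment for some $\epsilon>0$, $X^0\in L^\infty$, and the sequence $(A(n))$ is algebraically non arithmetic. Then $\sigma>0$ and there exists a $\sigma$-finite measure $\alpha$ on $\mathbb R^d$ such that for every continuous function $h$ with compact support on $\mathbb R^d$, $$\lim_n\sup_{u\in\mathbb R}\Big|\sigma\sqrt{2\pi n}\,\mathbb E\big[h(x(n,X^0)-n\gamma\mathbf 1-u\mathbf 1)\big]-\mathbb E\Big[e^{-\frac{(u+\phi(X^0))^2}{2n\sigma^2}}\Big]\alpha(h)\Big|=0.$$ Moreover the image of $\alpha$ by $x\mapsto(\bar x,\phi(x))$ is the product of $\nu_0$ by the Lebesgue measure on $\mathbb R$.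
   Context: A map $A:\mathbb R^d\to\mathbb R^d$ is topical if it is isotone ($x\le y$ coordinatewise implies $Ax\le Ay$) and additively homogeneous ($A(x+a\mathbf 1)=Ax+a\mathbf 1$, $\mathbf 1=(1,\dots,1)'$). A map $\phi:\mathbb R^d\to\mathbb R$ is topical if isotone and $\phi(x+a\mathbf 1)=\phi(x)+a$. $Top_d$ is the set of topical operators, with the topology of uniform convergence on compact sets. $\mathbb{PR}^d_{\max}$ is the quotient of $\mathbb R^d$ by $x\sim y\iff x-y\in\mathbb R\mathbf 1$, $\bar x$ the class of $x$. $A$ has rank 1 if $\overline{Ax}$ does not depend on $x$. The sequence has the memory loss property if some $A(N)\cdots A(1)$ has rank 1 with positive probability. $x(0,X^0)=X^0$, $x(n,X^0)=A(n)x(n-1,X^0)$; $\gamma$ is the Lyapunov exponent ($x(n,X^0)/n\to\gamma\mathbf 1$ a.s.). $\nu_0$ is the unique invariant probability measure on $\mathbb{PR}^d_{\max}$ of the Markov chain $\bar x(n,\cdot)$. $S_A$ is the support of the law $\mu$ of $A(1)$ and $T_A$ the semigroup generated by $S_A$. Algebraic non arithmeticity: the sequence is algebraically arithmetic if there are $a,b\in\mathbb R$ and $\theta\in Top_d$ of rank 1 such that for all $A\in S_A$ and all $\theta'\in T_A$ of rank 1, $(\theta A\theta'-\theta\theta')(\mathbb R^d)\subset(a+b\mathbb Z)\mathbf 1$; otherwise it is algebraically non arithmetic. Non arithmeticity of the system: let $E=Top_d\times\mathbb{PR}^d_{\max}$, $Q((A,\bar x),D)=\mathbb P((A(1),\overline{Ax})\in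 D)$, $\xi(A,\bar x)=\phi(Ax)-\phi(x)$, $j(A,\bar x)=\overline{Ax}$, and $\mathcal B^\infty=\{f\circ j: f$ bounded continuous complex function on $\mathbb{PR}^d_{\max}\}$ with sup norm. For $t\in\mathbb R$, $Q_t(z,dy)=e^{it\xi(y)}Q(z,dy)$. The system $((A(n)),\phi)$ is non arithmetic if $t\mapsto Q_t$ is continuous from $\mathbb R$ to the bounded operators on $\mathcal B^\infty$ and for every $t\ne0$ the spectral radius of $Q_t$ is $<1$. *)

(* Defs.v *)
From HB Require Import structures.
From mathcomp Require Import all_boot all_order all_algebra.
From mathcomp Require Import all_classical all_reals all_analysis.
From mathcomp Require Import complex.
From Stdlib Require List.
Set Implicit Arguments. Unset Strict Implicit. Unset Printing Implicit Defensive.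
Import Order.TTheory GRing.Theory Num.Theory.
Import numFieldTopology.Exports numFieldNormedType.Exports.
Local Open Scope classical_set_scope.
Local Open Scope ring_scope.

(* Vectors of R^d are row vectors 'rV[R]_d; the library norm `|x| on them is
   the sup norm ||x||_oo and their topology is the usual ones. *)

Definition VB (R : realType) (d : nat) :=
  g_sigma_algebraType (@open 'rV[R]_d).

(* Sigma-algebra on maps R^d -> R^d generated by the evaluations
   F |-> F x (x in R^d); on Top_d (a Polish space for the topology of uniform
   convergence on compact sets) it induces the Borel sigma-algebra. *)
Definition eval_cylinders (R : realType) (d : nat) : set (set ('rV[R]_d -> 'rV[R]_d)) :=
  [set E | exists (x : 'rV[R]_d) (U : set 'rV[R]_d), open U /\ E = [set F | U (F x)]].
Definition OpB (R : realType) (d : nat) :=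
  g_sigma_algebraType (@eval_cylinders R d).

Section Topical.
Context {R : realType} {d : nat}.
Local Notation V := 'rV[R]_d.

Definition ones : V := const_mx 1.

Definition vle (x y : V) := forall i, x ord0 i <= y ord0 i.

Definition topical_op (A : V -> V) :=
  (forall x y, vle x y -> vle (A x) (A y)) /\
  (forall x a, A (x + a *: ones) = A x + a *: ones).

Definition topical_fun (phi : V -> R) :=
  (forall x y, vle x y -> phi x <= phi y) /\
  (forall x a, phi (x + a *: ones) = phi x + a).

Definition peq (x y : V) := exists c : R, x = y + c *: ones.

Definition rank1 (A : V -> V) := forall x y, peq (A x) (A y).

(* canonical representative of the class of x in PR^d_max: x - (max_i x_i) 1.
   (the -sum|x_i| is only a neutral starting value for the iterated max) *)
Definition vmax (x : V) : R :=
  \big[Num.max/(- \sum_(i < d) `|x ord0 i|)]_(i < d) x ord0 i.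
Definition pr (x : V) : V := x - vmax x *: ones.
(* PR^d_max is identified (homeomorphically) with the closed set of
   representatives {x | pr x = x} = {x | max_i x_i = 0}. *)
Definition PRset : set V := [set x | pr x = x].

End Topical.

Section Model.
Context {R : realType} {d : nat} {dO : measure_display} {Omega : measurableType dO}.
Local Notation V := 'rV[R]_d.
Variable P : probability Omega R.
(* A n is A(n) for n >= 1 (A 0 is unused) *)
Variable A : nat -> Omega -> V -> V.

Fixpoint prodA (N : nat) (w : Omega) : V -> V :=
  match N with 0 => id | N'.+1 => A N'.+1 w \o prodA N' w end.

Definition xn (X0 : Omega -> V) (n : nat) (w : Omega) : V := prodA n w (X0 w).

Definition Ex (g : Omega -> R) : R := fine (\int[P]_w (g w)%:E)%E.

Definition cEx (g : Omega -> R[i]) : R[i] :=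
  Complex (Ex (fun w => complex.Re (g w))) (Ex (fun w => complex.Im (g w))).

Definition memory_loss :=
  exists N : nat, (0 < N)%N /\ (0 < P [set w | rank1 (prodA N w)])%E.

(* S_A : support of the law of A(1) in Top_d (topology of uniform convergence
   on compact sets; balls {||x||_oo <= k} exhaust R^d) *)
Definition in_support (B : V -> V) :=
  topical_op B /\
  forall (k e : R), 0 < k -> 0 < e ->
    (0 < P [set w | forall x : V, (`|x| <= k -> `|A 1 w x - B x| < e)%R])%E.

Definition in_semigroup (th : V -> V) :=
  exists2 s : seq (V -> V), s <> [::] &
    (forall B, Stdlib.Lists.List.In B s -> in_support B) /\
    th = foldr (fun B acc => B \o acc) id s.

Definition alg_arithmetic :=
  exists (a b : R) (th : V -> V), topical_op th /\ rank1 th /\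
    forall B, in_support B -> forall th', in_semigroup th' -> rank1 th' ->
      forall x : V, exists z : int,
        th (B (th' x)) - th (th' x) = (a + b * z%:~R) *: ones.

Definition alg_non_arithmetic := ~ alg_arithmetic.

(* E = Top_d x PR^d_max; a point (B, class of x) is represented by (B, x). *)
Definition Edom : set ((V -> V) * V) := [set z | topical_op z.1].

Definition cnorm (z : R[i]) : R := Normc.normc z.

(* B^oo = { f o j | f bounded continuous on PR^d_max }, j(B, x) = class of B x.
   Functions on PR^d_max are the functions on R^d constant on classes;
   continuity for the quotient topology = continuity of the lift. *)
Definition Binf : set ((V -> V) * V -> R[i]) :=
  [set g | exists f : V -> R[i],
     continuous (fun x => complex.Re (f x)) /\
     continuous (fun x => complex.Im (f x)) /\
     (exists M : R, forall x, cnorm (f x) <= M) /\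
     (forall x c, f (x + c *: ones) = f x) /\
     g = (fun z => f (z.1 z.2))].

Definition supnorm (g : (V -> V) * V -> R[i]) : \bar R :=
  ereal_sup [set (cnorm (g z))%:E | z in Edom].

Definition expi (th : R) : R[i] := Complex (cos th) (sin th).

(* Q_t g (z) = int e^{i t xi(y)} g(y) Q(z, dy), with
   Q((B, x), .) = law of (A(1), class of B x),  xi(C, y) = phi(C y) - phi(y) *)
Definition Qt (phi : V -> R) (t : R) (g : (V -> V) * V -> R[i]) :
    (V -> V) * V -> R[i] :=
  fun z => cEx (fun w =>
    expi (t * (phi (A 1 w (z.1 z.2)) - phi (z.1 z.2))) * g (A 1 w, z.1 z.2)).

Definition opnorm (T : ((V -> V) * V -> R[i]) -> ((V -> V) * V -> R[i])) : \bar R :=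
  ereal_sup [set supnorm (T g) | g in [set g | Binf g /\ (supnorm g <= 1)%E]].

(* spectral radius, via Gelfand's formula  rho(T) = inf_n ||T^n||^(1/n) *)
Definition specrad (T : ((V -> V) * V -> R[i]) -> ((V -> V) * V -> R[i])) : R :=
  inf [set powR (fine (opnorm (iter n T))) (n%:R^-1) | n in [set n : nat | (0 < n)%N]].

Definition system_non_arithmetic (phi : V -> R) :=
  (forall (t e : R), 0 < e -> exists2 del : R, 0 < del &
     forall s : R, `|s - t| < del ->
       (opnorm (fun g z => (Qt phi s g z - Qt phi t g z)%R) <= e%:E)%E) /\
  (forall t : R, t != 0 -> specrad (Qt phi t) < 1).

Definition chain_invariant (nu : probability (VB R d) R) :=
  nu (~` PRset) = 0%E /\
  forall B : set (VB R d), measurable B ->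
    nu B = (\int[nu]_y P [set w | B (pr (A 1 w y))])%E.

Definition gauss_exp (s : R) (f : R -> R) : R :=
  if s == 0 then f 0
  else fine (\int[@lebesgue_measure R]_z (f z * normal_pdf 0 s z)%:E)%E.

End Model.

(* Main.v *)
(* Write a trajectory as its class in PR^d_max together with its height [vmax], and let P be the
   transition operator.  If [F (x + a 1) = exp (- i t a) F x], then P^n F is [O (exp (- c n t^2))]: in
   a product of a rank-one block, m factors and a rank-one block, the m middle factors act on F,
   given the outer blocks, through a phase exp (i t W) only, so the product contracts F by
   [1 - g_m (t) / 2], where g_m (t) is the mean of [1 - |E exp (i t W)|^2].  If all the g_m (t)
   vanished for some t > 0, the phases would be almost surely constant, which each of the two
   non-arithmeticity hypotheses excludes; and g_m (t) is at least of order t^2 near 0, because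
   [1 - cos (n z) <= n^2 (1 - cos z)].

   Approximating h by its Fejer means along the lines x + R 1, one deduces that
   [sqrt n E h (x (n) + a 1)] is equicontinuous in [a / sqrt n].  It may thus be averaged over a window
   of width [eta sqrt n], which replaces h by its integral over fibres, a function on PR^d_max.
   Since the projective chain mixes in boundedly many steps, while the height moves by
   [o (sqrt n)] in these steps, the central limit theorem then yields nu_0 of this function times
   the Gaussian density.  The measure alpha is the image of nu_0 x Leb under the inverse of
   x |-> (class of x, phi x).  In case (ii), the decay gives
   [|E cos (vmax (x (n) - n gamma) / sqrt n)| <= exp (- c)], which rules out sigma = 0. *)
Require Import Defs.
From HB Require Import structures.
From mathcomp Require Import all_boot all_order all_algebra.
From mathcomp Require Import all_classical all_reals all_analysis.
From mathcomp Require Import measurable_realfun.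
From mathcomp Require Import complex.
From mathcomp Require Import ring lra.
Import Order.TTheory GRing.Theory Num.Theory.
Import numFieldTopology.Exports numFieldNormedType.Exports.
Local Open Scope classical_set_scope.
Local Open Scope ring_scope.
Set Implicit Arguments.
Unset Strict Implicit.
Unset Printing Implicit Defensive.

(** * Expectations of bounded measurable functions *)

(** The central limit theorem only sees windows of width of order [sqrt n]; equicontinuity at that
    scale is what turns it into a local statement. Two rank-one blocks are needed around the middle
    one: the first makes the incoming state known up to a multiple of [ones], the last makes the
    outgoing class independent of everything before it, so that only a real random variable is left
    between them. The number m of middle factors that makes this variable non-degenerate depends on
    the frequency t, hence the decay constant is uniform only for bounded t, by compactness. This is
    why h is replaced by Fejer means, whose transform along a line has compact support. The error of
    this replacement has to be small even after multiplication by [sqrt n]: it is measured against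
    the weight 1 / (1 + y^2) of the height y, whose mean is O (1 / sqrt n), uniformly over
    translations, by the same decay. In the difference of two translates the transform gains a
    factor t, and the integral of t exp (- c n t^2) is of order 1 / n rather than 1 / sqrt n; the
    factor gained is the equicontinuity. *)

Section BoundedMeasurable.
Context {R : realType} {d1 d2 : measure_display}.
Context {T1 : measurableType d1} {T2 : measurableType d2}.

(** [Ex] is the finite part of an integral, so its linearity and monotonicity rest on integrability.
    Boundedness supplies it under any probability, and is stable under the operations used below. *)
Definition bm {d} {T : measurableType d} (f : T -> R) :=
  measurable_fun setT f /\ exists M, forall x, `|f x| <= M.

Lemma bm_cst (c : R) : bm (fun _ : T1 => c).
Proof. by split; [exact: measurable_cst|exists `|c|]. Qed.

Lemma bmN (f : T1 -> R) : bm f -> bm (fun x => - f x).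
Proof.
move=> [mf [M fM]]; split; first exact: measurableT_comp.
by exists M => x; rewrite normrN.
Qed.

Lemma bmD (f g : T1 -> R) : bm f -> bm g -> bm (fun x => f x + g x).
Proof.
move=> [mf [M fM]] [mg [N gN]]; split; first exact: measurable_funD.
by exists (M + N) => x; rewrite (le_trans (ler_normD _ _))// lerD.
Qed.

Lemma bmB (f g : T1 -> R) : bm f -> bm g -> bm (fun x => f x - g x).
Proof. by move=> bf bg; apply: bmD => //; exact: bmN. Qed.

Lemma bmM (f g : T1 -> R) : bm f -> bm g -> bm (fun x => f x * g x).
Proof.
move=> [mf [M fM]] [mg [N gN]]; split; first exact: measurable_funM.
by exists (M * N) => x; rewrite normrM ler_pM.
Qed.

Lemma bmZ (c : R) (f : T1 -> R) : bm f -> bm (fun x => c * f x).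
Proof. by move=> bf; apply: bmM => //; exact: bm_cst. Qed.

Lemma bm_norm (f : T1 -> R) : bm f -> bm (fun x => `|f x|).
Proof.
move=> [mf [M fM]]; split; first exact: measurableT_comp.
by exists M => x; rewrite normr_id.
Qed.

Lemma bm_comp (f : T2 -> R) (g : T1 -> T2) :
  bm f -> measurable_fun setT g -> bm (fun x => f (g x)).
Proof.
move=> [mf [M fM]] mg; split; first exact: measurableT_comp.
by exists M => x.
Qed.

Lemma bm_cos (f : T1 -> R) : measurable_fun setT f -> bm (fun x => cos (f x)).
Proof.
move=> mf; split; last by exists 1 => x; exact: cos_max.
by apply: measurableT_comp => //; apply: continuous_measurable_fun; exact: continuous_cos.
Qed.

Lemma bm_sin (f : T1 -> R) : measurable_fun setT f -> bm (fun x => sin (f x)).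
Proof.
move=> mf; split; last by exists 1 => x; exact: sin_max.
by apply: measurableT_comp => //; apply: continuous_measurable_fun; exact: continuous_sin.
Qed.

Lemma bm_indic (D : set T1) : measurable D -> bm (fun x => \1_D x : R).
Proof.
move=> mD; split; first exact: measurable_indic.
by exists 1 => x; rewrite indicE; case: (_ \in _); rewrite ?normr1 ?normr0.
Qed.

Lemma bm_min1 (f : T1 -> R) : measurable_fun setT f -> (forall x, 0 <= f x) ->
  bm (fun x => Num.min 1 (f x)).
Proof.
move=> mf f0; split.
  by apply: measurable_minr => //; exact: measurable_cst.
exists 1 => x; rewrite ger0_norm ?ge_min ?lexx//.
by rewrite le_min ler01 f0.
Qed.

End BoundedMeasurable.

Section Expectation.
Context {R : realType} {d : measure_display} {T : measurableType d}.
Variable P : probability T R.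

Lemma bm_integrable (f : T -> R) : bm f -> P.-integrable setT (EFin \o f).
Proof.
move=> [mf [M fM]]; apply: measurable_bounded_integrable => //.
  by rewrite ltey_eq fin_num_measure.
exists M; split; first by rewrite num_real.
by move=> N MN x _ /=; rewrite (le_trans (fM x))// ltW.
Qed.

Lemma ExE (f : T -> R) : Ex P f = \int[P]_w f w. Proof. by []. Qed.

Lemma Ex_cst (c : R) : Ex P (fun=> c) = c.
Proof. by rewrite ExE Rintegral_cst//= probability_setT mulr1. Qed.

Lemma ExD (f g : T -> R) : bm f -> bm g ->
  Ex P (fun x => f x + g x) = Ex P f + Ex P g.
Proof. by move=> bf bg; rewrite !ExE RintegralD//; exact: bm_integrable. Qed.

Lemma ExB (f g : T -> R) : bm f -> bm g ->
  Ex P (fun x => f x - g x) = Ex P f - Ex P g.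
Proof. by move=> bf bg; rewrite !ExE RintegralB//; exact: bm_integrable. Qed.

Lemma ExZ (c : R) (f : T -> R) : bm f -> Ex P (fun x => c * f x) = c * Ex P f.
Proof. by move=> bf; rewrite !ExE RintegralZl//; exact: bm_integrable. Qed.

Lemma Ex_ge0 (f : T -> R) : (forall x, 0 <= f x) -> 0 <= Ex P f.
Proof. by move=> f0; rewrite ExE; apply: Rintegral_ge0 => x _; exact: f0. Qed.

Lemma Ex_le (f g : T -> R) : bm f -> bm g -> (forall x, f x <= g x) ->
  Ex P f <= Ex P g.
Proof.
by move=> bf bg fg; rewrite !ExE; apply: le_Rintegral => //; exact: bm_integrable.
Qed.

Lemma Ex_norm (f : T -> R) : bm f -> `|Ex P f| <= Ex P (fun x => `|f x|).
Proof.
by move=> bf; rewrite !ExE; apply: le_normr_Rintegral => //; exact: bm_integrable.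
Qed.

Lemma Ex_norm_le (f g : T -> R) : bm f -> bm g -> (forall x, `|f x| <= g x) ->
  `|Ex P f| <= Ex P g.
Proof.
move=> bf bg fg; apply: (le_trans (Ex_norm bf)); apply: Ex_le => //.
exact: bm_norm.
Qed.

Lemma Ex_bound (M : R) (f : T -> R) : bm f -> (forall x, `|f x| <= M) -> `|Ex P f| <= M.
Proof.
by move=> bf fM; rewrite -[leRHS](Ex_cst M); apply: Ex_norm_le => //; exact: bm_cst.
Qed.

Lemma Ex_indic (D : set T) : measurable D -> (Ex P (\1_D))%:E = P D.
Proof.
move=> mD; rewrite /Ex integral_indic// setIT fineK// fin_num_measure//.
Qed.

Lemma Ex_eq0_ae (f : T -> R) : bm f -> (forall x, 0 <= f x) -> Ex P f = 0 ->
  {ae P, forall x, f x = 0}.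
Proof.
move=> bf f0 Ef.
have h : (\int[P]_w `|(EFin \o f) w| = 0)%E.
  under eq_integral do rewrite /= ger0_norm//.
  apply/eqP; rewrite -fine_eq0; first by apply/eqP; exact: Ef.
  exact: (integrable_fin_num measurableT (bm_integrable bf)).
have mf : measurable_fun setT (EFin \o f) by apply/measurable_EFinP; case: bf.
have /(ae_eq_integral_abs _ measurableT mf) := h.
apply: filterS => x /(_ I) /=.
by case.
Qed.

Lemma Ex_cvg (f_ : nat -> T -> R) (f : T -> R) (M : R) :
  (forall n, measurable_fun setT (f_ n)) -> measurable_fun setT f ->
  (forall n x, `|f_ n x| <= M) ->
  (forall x, f_ ^~ x @ \oo --> f x) -> (fun n => Ex P (f_ n)) @ \oo --> Ex P f.
Proof.
move=> mf_ mf fM cf.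
have mE n : measurable_fun setT (EFin \o f_ n) by apply/measurable_EFinP; exact: mf_.
have mEf : measurable_fun setT (EFin \o f) by exact/measurable_EFinP.
have cE : {ae P, forall x, setT x -> (fun n => (EFin \o f_ n) x) @ \oo --> (EFin \o f) x}.
  by apply: aeW => x _ /=; apply: cvg_EFin; [exact: nearW|exact: cf].
have ic : P.-integrable setT (cst M%:E) by exact: finite_measure_integrable_cst.
have bE : {ae P, forall x n, setT x -> (`|(EFin \o f_ n) x| <= cst M%:E x)%E}.
  by apply: aeW => x n _ /=; rewrite lee_fin.
have [intf _ cv] := dominated_convergence measurableT mE mEf cE ic bE.
apply: fine_cvg; rewrite fineK; last exact: (integrable_fin_num measurableT intf).
exact: cv.
Qed.

End Expectation.

(** * Fubini for integrands dominated by a product *)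

Section Fubini.
Context {R : realType} {d1 d2 : measure_display}.
Context {T1 : measurableType d1} {T2 : measurableType d2}.
Variables (m1 : {sigma_finite_measure set T1 -> \bar R}).
Variables (m2 : {sigma_finite_measure set T2 -> \bar R}).

(** The integral is by definition the difference of the integrals of the positive and negative
    parts, and each of them is measurable by Tonelli. *)
Lemma measurable_Rint2 (f : T1 * T2 -> R) : measurable_fun setT f ->
  measurable_fun setT (fun x => \int[m2]_y f (x, y)).
Proof.
move=> mf; apply: measurableT_comp => //.
have mE : measurable_fun setT (EFin \o f) by exact/measurable_EFinP.
rewrite (_ : (fun x => _) = (fun x => fubini_F m2 ((EFin \o f)^\+)%E x
   - fubini_F m2 ((EFin \o f)^\-)%E x)%E).
  apply: emeasurable_funB; apply: measurable_fun_fubini_tonelli_F => //.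
  - exact: measurable_funepos.
  - exact: measurable_funeneg.
apply/funext => x; rewrite integralE /fubini_F.
by congr (_ - _)%E; apply: eq_integral => y _; rewrite !unlock.
Qed.

Variables (f : T1 * T2 -> R) (g1 : T1 -> R) (g2 : T2 -> R).
Hypothesis mf : measurable_fun setT f.
Hypothesis ig1 : m1.-integrable setT (EFin \o g1).
Hypothesis ig2 : m2.-integrable setT (EFin \o g2).
Hypothesis g10 : forall x, 0 <= g1 x.
Hypothesis g20 : forall x, 0 <= g2 x.
Hypothesis fg : forall x y, `|f (x, y)| <= g1 x * g2 y.

Lemma dom_integrable_prod : ((m1 \x m2)%E).-integrable setT (EFin \o f).
Proof.
have mE : measurable_fun setT (EFin \o f) by exact/measurable_EFinP.
apply/(integrable12ltyP _ _ mE).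
have mg1 : measurable_fun setT g1.
  by apply/measurable_EFinP; case/integrableP: ig1.
have mg2 : measurable_fun setT g2.
  by apply/measurable_EFinP; case/integrableP: ig2.
have I2 : (\int[m2]_y (g2 y)%:E)%E \is a fin_num.
  exact: (integrable_fin_num measurableT ig2).
apply: (@le_lt_trans _ _ (\int[m1]_x ((g1 x)%:E * \int[m2]_y (g2 y)%:E))%E).
  apply: ge0_le_integral => //=.
  - by move=> x _; exact: integral_ge0.
  - have mn : measurable_fun setT (EFin \o (fun z => `|f z|)).
      by apply/measurable_EFinP; exact: measurableT_comp.
    by apply: (measurable_fun_fubini_tonelli_F (m2 := m2) _ mn) => z; rewrite lee_fin.
  - by apply: emeasurable_funM; [exact/measurable_EFinP|exact: measurable_cst].
  - move=> x _; rewrite -integralZl//.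
    apply: ge0_le_integral => //=.
    + apply/measurable_EFinP; apply: measurableT_comp => //.
      exact: (measurableT_comp mf (measurable_pair1 _)).
    + by apply: measurable_funeM; exact/measurable_EFinP.
    + by move=> y _; rewrite -EFinM lee_fin.
rewrite -(fineK I2).
under eq_integral do rewrite -EFinM mulrC EFinM.
rewrite integralZl// lte_mul_pinfty//.
  by rewrite lee_fin fine_ge0// integral_ge0// => x _; rewrite lee_fin.
case/integrableP : ig1 => _; apply: le_lt_trans.
rewrite le_eqVlt; apply/orP; left; apply/eqP; apply: eq_integral => x _ /=.
by rewrite ger0_norm.
Qed.

Lemma dom_integrable1 x : m2.-integrable setT (EFin \o (fun y => f (x, y))).
Proof.
apply: (@le_integrable _ _ _ _ _ measurableT _ (fun y => (g1 x)%:E * (g2 y)%:E)%E).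
- apply/measurable_EFinP; exact: (measurableT_comp mf (measurable_pair1 _)).
- move=> y _ /=; rewrite lee_fin (le_trans (fg _ _))//.
  by rewrite ger0_norm// mulr_ge0.
- exact: (integrableZl measurableT _ ig2).
Qed.

Lemma dom_integrable2 y : m1.-integrable setT (EFin \o (fun x => f (x, y))).
Proof.
apply: (@le_integrable _ _ _ _ _ measurableT _ (fun x => (g2 y)%:E * (g1 x)%:E)%E).
- apply/measurable_EFinP; exact: (measurableT_comp mf (measurable_pair2 _)).
- move=> x _ /=; rewrite lee_fin (le_trans (fg _ _))//.
  by rewrite ger0_norm ?mulr_ge0// mulrC.
- exact: (integrableZl measurableT _ ig1).
Qed.

Lemma RFubini : \int[m1]_x \int[m2]_y f (x, y) = \int[m2]_y \int[m1]_x f (x, y).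
Proof.
rewrite /Rintegral; congr fine.
have := Fubini dom_integrable_prod; rewrite /= => E.
under eq_integral do rewrite fineK ?(integrable_fin_num measurableT (dom_integrable1 _))//.
rewrite E; apply: eq_integral => y _.
by rewrite fineK// (integrable_fin_num measurableT (dom_integrable2 _)).
Qed.

Lemma RFubini_prod : \int[(m1 \x m2)%E]_z f z = \int[m1]_x \int[m2]_y f (x, y).
Proof.
rewrite /Rintegral; congr fine.
rewrite -(integral12_prod_meas1 dom_integrable_prod).
apply: eq_integral => x _; rewrite /fubini_F /= fineK//.
exact: (integrable_fin_num measurableT (dom_integrable1 _)).
Qed.

End Fubini.

Section FubiniProb.
Context {R : realType} {d1 d2 : measure_display}.
Context {T1 : measurableType d1} {T2 : measurableType d2}.
Variables (P1 : probability T1 R) (P2 : probability T2 R).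

Lemma bm_Ex2 (f : T1 * T2 -> R) : bm f -> bm (fun x => Ex P2 (fun y => f (x, y))).
Proof.
move=> [mf [M fM]]; split; first exact: measurable_Rint2.
exists M => x; apply: Ex_bound => [|y]; last exact: fM.
split; last by exists M => y; exact: fM.
exact: (measurableT_comp mf (measurable_pair1 _)).
Qed.

Lemma Ex_Fubini (f : T1 * T2 -> R) : bm f ->
  Ex P1 (fun x => Ex P2 (fun y => f (x, y))) = Ex P2 (fun y => Ex P1 (fun x => f (x, y))).
Proof.
move=> [mf [M fM]]; apply: (@RFubini _ _ _ _ _ P1 P2 f (cst `|M|) (cst 1)) => //.
- exact: finite_measure_integrable_cst.
- exact: finite_measure_integrable_cst.
- by move=> x y; rewrite mulr1 (le_trans (fM _))// ler_norm.
Qed.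

End FubiniProb.

(** * Topical maps *)

Lemma bigcup_countType_measurable {disp} {T : measurableType disp} (I : countType)
  (S : I -> set T) : (forall i, measurable (S i)) -> measurable (\bigcup_i S i).
Proof.
move=> mS.
have -> : \bigcup_i S i = \bigcup_n (if unpickle n is Some i then S i else set0).
  apply/seteqP; split => x.
    by move=> [i _ Six]; exists (pickle i) => //; rewrite pickleK.
  by move=> [n _]; case: (unpickle n) => // i Six; exists i.
by apply: bigcupT_measurable => n; case: (unpickle n).
Qed.

Lemma bigcap_countType_measurable {disp} {T : measurableType disp} (I : countType)
  (S : I -> set T) : (forall i, measurable (S i)) -> measurable (\bigcap_i S i).
Proof.
move=> mS; rewrite -[X in measurable X]setCK; apply: measurableC; rewrite setC_bigcap.
by apply: bigcup_countType_measurable => i; exact: measurableC.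
Qed.

Lemma nbhs_dist_lt {R : realType} {W : normedModType R} (x : W) (r : R) (Q : set W) :
  0 < r -> (forall y, `|x - y| < r -> Q y) -> nbhs x Q.
Proof.
by move=> r0 h; apply/nbhs_ballP; exists r => //= y; rewrite -ball_normE; exact: h.
Qed.

Lemma lip_continuous {R : realType} (U W : normedModType R) (c : R) (f : U -> W) :
  (forall x y, `|f x - f y| <= c * `|x - y|) -> continuous f.
Proof.
move=> lf x; apply/cvgrPdist_lt => e e0.
have c0 : 0 < `|c| + 1 by rewrite ltr_wpDl.
apply: (nbhs_dist_lt (r := e / (`|c| + 1))) => [|y]; first by rewrite divr_gt0.
rewrite ltr_pdivlMr// mulrC; apply: le_lt_trans.
apply: (le_trans (lf _ _)); rewrite ler_wpM2r//.
by rewrite (le_trans (ler_norm _))// lerDl.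
Qed.

Section Vectors.
Context {R : realType} {d : nat}.
Local Notation V := 'rV[R]_d.
Local Notation one := (@ones R d).
Implicit Types (x y : V) (A : V -> V) (phi : V -> R).

Lemma coord_le_norm x i : `|x ord0 i| <= `|x|.
Proof.
rewrite /Num.norm/= mx_normrE.
exact: (le_bigmax 0 (fun ij : 'I_1 * 'I_d => `|x ij.1 ij.2|) (ord0, i)).
Qed.

Lemma norm_le_coord x (c : R) : 0 <= c -> (forall i, `|x ord0 i| <= c) -> `|x| <= c.
Proof.
move=> c0 xc; rewrite /Num.norm/= mx_normrE; apply: bigmax_le => // -[i j] _ /=.
by rewrite ord1.
Qed.

Lemma coordDones x (c : R) i : (x + c *: one) ord0 i = x ord0 i + c.
Proof. by rewrite !mxE mulr1. Qed.

Lemma onesDN x (c : R) : x + c *: one + (- c) *: one = x.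
Proof. by rewrite scaleNr addrK. Qed.

Lemma onesD x (a b : R) : x + a *: one + b *: one = x + (a + b) *: one.
Proof. by rewrite -addrA scalerDl. Qed.

Lemma vle_norm x y : vle x (y + `|x - y| *: one).
Proof.
move=> i; rewrite coordDones addrC -lerBlDr.
by have := coord_le_norm (x - y) i; rewrite !mxE; apply: le_trans; exact: ler_norm.
Qed.

(** Isotony and homogeneity applied to [x <= y + |x - y| 1]. All the continuity used below comes
    from this and its analogue for operators. *)
Lemma topical_fun_lip phi x y : topical_fun phi -> `|phi x - phi y| <= `|x - y|.
Proof.
move=> [mo ho].
have h a b : phi a - phi b <= `|a - b|.
  by rewrite lerBlDl -ho; apply: mo; exact: vle_norm.
by rewrite ler_norml h lerNl opprB distrC h.
Qed.

Lemma topical_op_lip A x y : topical_op A -> `|A x - A y| <= `|x - y|.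
Proof.
move=> [mo ho].
have h a b i : A a ord0 i - A b ord0 i <= `|a - b|.
  by rewrite lerBlDl -coordDones -ho; apply: mo; exact: vle_norm.
apply: norm_le_coord => // i; rewrite !mxE.
by rewrite ler_norml h lerNl opprB distrC h.
Qed.

Lemma topical_fun_cont phi : topical_fun phi -> continuous phi.
Proof. by move=> tp; apply: (@lip_continuous R V R^o 1) => x y; rewrite mul1r; exact: topical_fun_lip. Qed.

Lemma topical_op_cont A : topical_op A -> continuous A.
Proof. by move=> tA; apply: (@lip_continuous R V V 1) => x y; rewrite mul1r; exact: topical_op_lip. Qed.

Lemma topical_comp A B : topical_op A -> topical_op B -> topical_op (A \o B).
Proof.
move=> [mA hA] [mB hB]; split => [x y xy|x a] /=; first by apply: mA; exact: mB.
by rewrite hB hA.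
Qed.

Lemma topical_id : topical_op (id : V -> V). Proof. by []. Qed.

Lemma topical_fun_comp phi A : topical_fun phi -> topical_op A -> topical_fun (phi \o A).
Proof.
move=> [mp hp] [mA hA]; split => [x y xy|x a] /=; first by apply: mp; exact: mA.
by rewrite hA hp.
Qed.

(** In dimension 0 the vector [ones] is 0, and homogeneity would read [phi 0 = phi 0 + 1]. *)
Lemma topical_fun_dim phi : topical_fun phi -> (0 < d)%N.
Proof.
case: d phi => // phi [_ hp].
have := hp 0 1; rewrite (_ : 0 + 1 *: ones = 0); last by apply/rowP => -[].
by move=> h; exfalso; lra.
Qed.

Hypothesis d0 : (0 < d)%N.

Lemma vmax_ge x i : x ord0 i <= vmax x.
Proof. exact: (le_bigmax _ (fun i => x ord0 i) i). Qed.

Lemma vmax_le x (c : R) : (forall i, x ord0 i <= c) -> vmax x <= c.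
Proof.
move=> xc; apply: bigmax_le => //; apply: (le_trans _ (xc (Ordinal d0))).
rewrite lerNl (bigD1 (Ordinal d0)) //=.
apply: (@le_trans _ _ `|x ord0 (Ordinal d0)|); first by rewrite -normrN ler_norm.
by rewrite lerDl sumr_ge0.
Qed.

Lemma topical_vmax : topical_fun (@vmax R d).
Proof.
have hD x a : vmax (x + a *: one) <= vmax x + a.
  by apply: vmax_le => i; rewrite coordDones lerD2r vmax_ge.
split => [x y xy|x a].
  by apply: vmax_le => i; apply: (le_trans (xy i)); exact: vmax_ge.
apply/eqP; rewrite eq_le hD/= -lerBrDr.
by have := hD (x + a *: one) (- a); rewrite onesDN.
Qed.

Lemma vmaxD x (c : R) : vmax (x + c *: one) = vmax x + c.
Proof. exact: topical_vmax.2. Qed.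

Lemma vmax_lip x y : `|vmax x - vmax y| <= `|x - y|.
Proof. exact/topical_fun_lip/topical_vmax. Qed.

Lemma vmax0 : vmax (0 : V) = 0.
Proof.
apply/eqP; rewrite eq_le vmax_le /=; last by move=> i; rewrite mxE.
by have := vmax_ge 0 (Ordinal d0); rewrite mxE.
Qed.

Lemma vmaxN_ge0 x : 0 <= vmax x + vmax (- x).
Proof.
have := vmax_ge x (Ordinal d0); have := vmax_ge (- x) (Ordinal d0).
by rewrite mxE => h1 h2; lra.
Qed.

Lemma vmaxZ x (c : R) : 0 <= c -> vmax (c *: x) = c * vmax x.
Proof.
move=> c0.
have h (a : R) y : 0 <= a -> vmax (a *: y) <= a * vmax y.
  by move=> a0; apply: vmax_le => i; rewrite mxE ler_wpM2l// vmax_ge.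
have [->|cn0] := eqVneq c 0; first by rewrite scale0r mul0r vmax0.
apply/eqP; rewrite eq_le h//=.
have ci : 0 <= c^-1 by rewrite invr_ge0.
have := h c^-1 (c *: x) ci; rewrite scalerA mulVf// scale1r => k.
by rewrite -(ler_pM2l (x := c^-1)) ?invr_gt0 ?lt_def ?cn0// mulrA mulVf// mul1r.
Qed.

(* [vmax x + vmax (- x)] is the oscillation [max x - min x]. *)
Lemma topical_fun_osc phi x : topical_fun phi ->
  `|phi x - phi 0 - vmax x| <= vmax x + vmax (- x).
Proof.
move=> [mp hp].
have : phi x <= phi (0 + vmax x *: one).
  by apply: mp => i; rewrite coordDones mxE add0r; exact: vmax_ge.
have : phi (0 + (- vmax (- x)) *: one) <= phi x.
  apply: mp => i; rewrite coordDones mxE add0r lerNl.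
  by have := vmax_ge (- x) i; rewrite mxE.
rewrite !hp => h1 h2; rewrite ler_norml.
by have := vmaxN_ge0 x; move=> h3; apply/andP; split; lra.
Qed.

Lemma prD x (c : R) : pr (x + c *: one) = pr x.
Proof. by rewrite /pr vmaxD scalerDl opprD addrACA subrr addr0. Qed.

Lemma prE x : x = pr x + vmax x *: one. Proof. by rewrite /pr subrK. Qed.

Lemma peqP x y : peq x y <-> pr x = pr y.
Proof.
split => [[c ->]|h]; first by rewrite prD.
exists (vmax x - vmax y); rewrite {1}(prE x) h {1}/pr -addrA -scaleNr -scalerDl.
by congr (_ + _ *: _); rewrite addrC.
Qed.

Lemma pr_cont : continuous (@pr R d).
Proof.
apply: (@lip_continuous R V V 2) => x y.
have -> : pr x - pr y = (x - y) + (vmax y - vmax x) *: one.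
  by apply/rowP => i; rewrite !mxE; ring.
rewrite (le_trans (ler_normD _ _))// mulr2n mulrDl mul1r lerD//.
apply: norm_le_coord => // i; rewrite !mxE mulr1.
by rewrite distrC vmax_lip.
Qed.

Lemma rank1_pr A x y : rank1 A -> pr (A x) = pr (A y).
Proof. by move=> rA; apply/peqP; exact: rA. Qed.

End Vectors.

(** * Borel vectors, and joint measurability of random continuous maps *)

Section BorelVectors.
Context {R : realType} {d : nat}.
Local Notation V := 'rV[R]_d.

Lemma VB_open (U : set V) : open U -> measurable (U : set (VB R d)).
Proof. by move=> oU; exact: sub_sigma_algebra. Qed.

Lemma VB_closed (U : set V) : closed U -> measurable (U : set (VB R d)).
Proof.
by move=> cU; rewrite -(setCK U); apply: measurableC; apply: VB_open; exact: closed_openC.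
Qed.

Lemma VB_measurable {disp} {T : measurableType disp} (f : T -> VB R d) :
  (forall U : set V, open U -> measurable (f @^-1` U)) -> measurable_fun setT f.
Proof.
move=> h; apply: (@measurability _ _ T (VB R d) setT f (@open V)) => //.
by move=> _ [U oU <-]; rewrite setTI; exact: h.
Qed.

Lemma VB_cont_real (f : V -> R) : continuous f -> measurable_fun setT (f : VB R d -> R).
Proof.
move=> cf; apply: (@measurability _ _ _ _ _ _ (@RGenOpens.G R)).
  exact: RGenOpens.measurableE.
move=> _ [_ [a [b ->]] <-]; rewrite setTI; apply: VB_open.
by apply: open_comp => //; move=> x _; exact: cf.
Qed.

Lemma VB_cont (f : V -> V) : continuous f -> measurable_fun setT (f : VB R d -> VB R d).
Proof.
move=> cf; apply: VB_measurable => U oU; apply: VB_open.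
by apply: open_comp => // x _; exact: cf.
Qed.

(** The lattice of mesh [1 / (k + 1)], indexed by a countable type so that unions and intersections
    over it preserve measurability. *)
Definition grid (k : nat) (z : {ffun 'I_d -> int}) : V := \row_i ((z i)%:~R / k.+1%:R).
Definition gridf (k : nat) (x : V) : {ffun 'I_d -> int} :=
  [ffun i => Num.floor (x ord0 i * k.+1%:R)].

Lemma grid_approx k x : `|x - grid k (gridf k x)| <= k.+1%:R^-1.
Proof.
apply: norm_le_coord => // i; rewrite !mxE ffunE.
have k0 : (0 : R) < k.+1%:R by rewrite ltr0n.
set r := x ord0 i; have /andP[h1 h2] := floor_itv (r * k.+1%:R).
rewrite ger0_norm; last by rewrite subr_ge0 ler_pdivrMr.
rewrite lerBlDl -[X in _ + X]mul1r -mulrDl ler_pdivlMr// ltW//.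
by rewrite (lt_le_trans h2)// intrD.
Qed.

Lemma gridf_cell k z : measurable ([set x | gridf k x = z] : set (VB R d)).
Proof.
rewrite (_ : [set x | _] = \bigcap_(i : 'I_d) [set x : V | Num.floor (x ord0 i * k.+1%:R) = z i]).
  apply: bigcap_countType_measurable => i.
  pose f := (fun x : V => x ord0 i * k.+1%:R).
  rewrite (_ : [set x | _] = f @^-1` `[(z i)%:~R, (z i + 1)%:~R[).
    rewrite -[X in measurable X]setTI.
    apply: (_ : measurable_fun setT (f : VB R d -> R)) => //.
    apply: VB_cont_real; apply: (@lip_continuous R V R^o k.+1%:R) => x y.
    rewrite /f -mulrBl normrM mulrC normr_nat ler_wpM2l//.
    by have := coord_le_norm (x - y) i; rewrite !mxE.
  apply/seteqP; split => x /=; rewrite in_itv/=.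
    by move=> <-; exact: floor_itv.
  by move=> h; apply/eqP; rewrite floor_eq.
apply/seteqP; split => x /=; first by move=> <- i _ /=; rewrite /gridf ffunE.
by move=> h; apply/ffunP => i; rewrite /gridf ffunE; exact: h.
Qed.

Section Caratheodory.
Context {disp} {T : measurableType disp} (F : T -> V -> V).
Hypothesis mF : forall x, measurable_fun setT (fun w => F w x : VB R d).
Hypothesis cF : forall w, continuous (F w).

(** The points at distance at least [1 / (j + 1)] from the complement of [U]. These closed sets
    exhaust an open [U]. *)
Let core (U : set V) (j : nat) : set V := [set y | forall u, `|u - y| < j.+1%:R^-1 -> U u].

Let core_closed U j : closed (core U j).
Proof.
rewrite -[core U j]setCK; apply: open_closedC.
rewrite openE => y /= /existsNP[u /not_implyP[uy Uu]].
have r0 : 0 < j.+1%:R^-1 - `|u - y| by rewrite subr_gt0.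
apply: (nbhs_dist_lt r0) => y' hy' /(_ u); apply/not_implyP; split => //.
by rewrite -(subrKA y) (le_lt_trans (ler_normD _ _))// -ltrBrDl.
Qed.

(** [F w x] is the limit of the values of [F w] at the grid points next to [x], which depend on [x]
    only through its cell. The limit lies in the open set [U] exactly when, for some [j], these
    values are eventually in [core U j]. *)
Lemma caratheodory : measurable_fun setT (fun z : T * VB R d => F z.1 z.2 : VB R d).
Proof.
apply: VB_measurable => U oU.
rewrite (_ : _ @^-1` U = \bigcup_j \bigcup_K \bigcap_k
   \bigcup_(z : {ffun 'I_d -> int})
     ([set w | core U j (F w (grid (k + K)%N z))] `*` [set x : VB R d | gridf (k + K)%N x = z])).
  apply: bigcupT_measurable => j; apply: bigcupT_measurable => K.
  apply: bigcapT_measurable => k.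
  apply: bigcup_countType_measurable => z; apply: measurableX; last exact: gridf_cell.
  rewrite -[X in measurable X]setTI; apply: (mF (grid (k + K)%N z)) => //.
  exact: VB_closed.
have inv_cvg : (fun k : nat => k.+1%:R^-1 : R) @ \oo --> (0 : R) := cvg_harmonic.
have gcv x : (fun k => grid k (gridf k x)) @ \oo --> x.
  apply/cvgrPdist_le => e e0; near=> k; apply: (le_trans (grid_approx _ _)).
  near: k; have /cvgrPdist_le/(_ _ e0) := inv_cvg.
  by apply: filterS => k; rewrite sub0r normrN ger0_norm.
have Fcv w x : (fun k => F w (grid k (gridf k x))) @ \oo --> F w x.
  by apply: (cvg_comp _ _ (gcv x)); exact: cF.
apply/seteqP; split => -[w x] /=.
  move=> Ux.
  have /nbhs_ballP[r /= r0 rU] : nbhs (F w x) U by apply: open_nbhs_nbhs.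
  have r20 : 0 < r / 2 by rewrite divr_gt0.
  have [j jr] : exists j : nat, j.+1%:R^-1 < r / 2.
    have /cvgrPdist_lt/(_ _ r20) := inv_cvg => -[j _ hj].
    by exists j; have := hj j (leqnn j); rewrite /= sub0r normrN ger0_norm.
  have /cvgrPdist_lt/(_ _ r20) := Fcv w x => -[K _ hK].
  exists j => //; exists K => // k _; exists (gridf (k + K)%N x) => //; split => //= u hu.
  apply: rU; rewrite -ball_normE/=.
  rewrite -(subrKA (F w (grid (k + K)%N (gridf (k + K)%N x)))) (le_lt_trans (ler_normD _ _))//.
  rewrite (splitr r) ltrD//; first by apply: hK; rewrite /= leq_addl.
  by rewrite distrC; exact: (lt_trans hu).
move=> [j _ [K _ h]].
have j0 : (0 : R) < j.+1%:R^-1 by [].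
have /cvgrPdist_lt/(_ _ j0) := Fcv w x => -[M _ hM].
have [z _ [hz zE]] := h M I.
apply: hz; rewrite -zE; apply: hM => /=; exact: leq_addr.
Unshelve. all: by end_near. Qed.

End Caratheodory.
End BorelVectors.

(** * The Markov property *)

Section Laws.
Context {R : realType} {d d1 d2 : measure_display}.
Context {T : measurableType d} {T1 : measurableType d1} {T2 : measurableType d2}.
Variable P : probability T R.

Definition mfun_of {d'} {T' : measurableType d'} (X : T -> T')
    (mX : measurable_fun setT X) : {mfun T >-> T'} :=
  HB.pack X (isMeasurableFun.Build _ _ _ _ _ mX).

Lemma Ex_distribution {d'} {T' : measurableType d'} (X : {mfun T >-> T'}) (f : T' -> R) : bm f ->
  Ex (distribution P X) f = Ex P (fun w => f (X w)).
Proof.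
move=> bf; rewrite /Ex integral_distribution//.
  by apply/measurable_EFinP; case: bf.
apply: (bm_integrable P (f := f \o X)); apply: bm_comp => //.
Qed.

Lemma Ex_law (X Y : T -> T1) (f : T1 -> R) :
  measurable_fun setT X -> measurable_fun setT Y ->
  (forall B, measurable B -> P (X @^-1` B) = P (Y @^-1` B)) -> bm f ->
  Ex P (fun w => f (X w)) = Ex P (fun w => f (Y w)).
Proof.
move=> mX mY XY bf.
rewrite -(Ex_distribution (mfun_of mX) bf) -(Ex_distribution (mfun_of mY) bf).
rewrite /Ex; congr fine; apply: eq_measure_integral => B mB _.
exact: XY.
Qed.

(** Factorization on rectangles identifies the joint law with the product of the marginals, by
    uniqueness of product measures. *)
Lemma indep_Fubini (X : T -> T1) (Y : T -> T2) (f : T1 * T2 -> R) :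
  measurable_fun setT X -> measurable_fun setT Y ->
  (forall B C, measurable B -> measurable C ->
    P (X @^-1` B `&` Y @^-1` C) = (P (X @^-1` B) * P (Y @^-1` C))%E) ->
  bm f ->
  Ex P (fun w => f (X w, Y w)) = Ex P (fun w1 => Ex P (fun w2 => f (X w1, Y w2))).
Proof.
move=> mX mY XY bf.
have mXY : measurable_fun setT (fun w => (X w, Y w)) by exact: measurable_fun_pair.
transitivity (Ex (distribution P (mfun_of mX))
    (fun x => Ex (distribution P (mfun_of mY)) (fun y => f (x, y)))).
  rewrite -(Ex_distribution (mfun_of mXY) bf).
  have [mf [M fM]] := bf.
  rewrite -[RHS](@RFubini_prod _ _ _ _ _ (distribution P (mfun_of mX))
     (distribution P (mfun_of mY)) f (cst `|M|) (cst 1)) //; last 3 first.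
  - exact: finite_measure_integrable_cst.
  - exact: finite_measure_integrable_cst.
  - by move=> x y; rewrite mulr1 (le_trans (fM _))// ler_norm.
  rewrite /Ex /Rintegral; congr fine; apply: eq_measure_integral => D mD _.
  apply/esym; apply: product_measure_unique (mD) => B C mB mC.
  exact: (XY B C mB mC).
rewrite Ex_distribution; last exact: bm_Ex2.
congr Ex; apply/funext => w; rewrite Ex_distribution//.
by apply: bm_comp => //; exact: measurable_pair1.
Qed.

End Laws.

(** A single identity encodes the independence of [X0], A(1), A(2), ... and the equality of the laws
    of the A(k), each factor being computed with A(1). Marginal statements follow by taking some of
    the sets to be [setT]. *)
Definition indep {R : realType} {d : nat} {dO : measure_display}
  {Omega : measurableType dO} (P : probability Omega R)
  (A : nat -> Omega -> 'rV[R]_d -> 'rV[R]_d) (X0 : Omega -> 'rV[R]_d) :=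
  forall (n : nat) (B : set (VB R d)) (E : nat -> set (OpB R d)),
     measurable B -> (forall k, measurable (E k)) ->
     P [set w | B (X0 w) /\ forall k : nat, (k < n)%N -> E k (A k.+1 w)] =
     (P (X0 @^-1` B) * \prod_(k < n) P (A 1%N @^-1` E k))%E.

Section Markov.
Context {R : realType} {d : nat} {dO : measure_display} {Omega : measurableType dO}.
Variable P : probability Omega R.
Variable A : nat -> Omega -> 'rV[R]_d -> 'rV[R]_d.
Local Notation V := 'rV[R]_d.
Hypothesis tA : forall n w, (0 < n)%N -> topical_op (A n w).
Hypothesis mA : forall n, (0 < n)%N -> measurable_fun setT (A n : Omega -> OpB R d).

Lemma topical_prodA n w : topical_op (prodA A n w).
Proof. by elim: n => [|n IH] //=; apply: topical_comp => //; exact: tA. Qed.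

Lemma eval_measurable (x : V) : measurable_fun setT (fun F : OpB R d => F x : VB R d).
Proof.
apply: VB_measurable => U oU; apply: sub_sigma_algebra.
by exists x, U.
Qed.

Lemma measurable_A n (x : V) : (0 < n)%N -> measurable_fun setT (fun w => A n w x : VB R d).
Proof. by move=> n0; exact: (measurableT_comp (eval_measurable x) (mA n0)). Qed.

Lemma measurable_prodA n (x : V) : measurable_fun setT (fun w => prodA A n w x : VB R d).
Proof.
elim: n => [|n IH] /=; first exact: measurable_cst.
have mc := caratheodory (fun x => measurable_A x (ltn0Sn n))
  (fun w => topical_op_cont (tA w (ltn0Sn n))).
exact: (measurableT_comp mc (measurable_fun_pair (@measurable_id _ _ _) IH)).
Qed.

Lemma measurable_prodA2 n : measurable_fun setT
  (fun z : Omega * VB R d => prodA A n z.1 z.2 : VB R d).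
Proof.
by apply: caratheodory => [x|w]; [exact: measurable_prodA|exact/topical_op_cont/topical_prodA].
Qed.

Definition Pop (G : V -> R) : V -> R := fun x => Ex P (fun w => G (A 1%N w x)).

Lemma bm_Pop (G : VB R d -> R) : bm G -> bm (Pop G : VB R d -> R).
Proof.
move=> bG; apply: (bm_Ex2 P (f := fun z : VB R d * Omega => G (A 1%N z.2 z.1))).
apply: (bm_comp bG (g := fun z : VB R d * Omega => A 1%N z.2 z.1 : VB R d)).
have mc := caratheodory (fun x => measurable_A x (ltn0Sn 0))
  (fun w => topical_op_cont (tA w (ltn0Sn 0))).
exact: (measurableT_comp mc (measurable_fun_pair measurable_snd measurable_fst)).
Qed.

Lemma bm_iter_Pop k (G : VB R d -> R) : bm G -> bm (iter k Pop G : VB R d -> R).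
Proof. by move=> bG; elim: k => //= k; exact: bm_Pop. Qed.

Section Start.
Variable X0 : Omega -> V.
Hypothesis mX0 : measurable_fun setT (X0 : Omega -> VB R d).
Hypothesis iX : indep P A X0.

Lemma measurable_xn n : measurable_fun setT (xn A X0 n : Omega -> VB R d).
Proof.
exact: (measurableT_comp (measurable_prodA2 n) (measurable_fun_pair (@measurable_id _ _ _) mX0)).
Qed.

Lemma same_law n (E : set (OpB R d)) : (0 < n)%N -> measurable E ->
  P (A n @^-1` E) = P (A 1%N @^-1` E).
Proof.
case: n => // n _ mE.
(* Every constraint but the one on [A n.+1] is trivial, so all the other factors are 1. *)
have := iX n.+1 measurableT (E := fun k => if k == n then E else setT).
rewrite preimage_setT probability_setT mul1e (bigD1 ord_max)//= eqxx big1; last first.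
  move=> i /negP hi; case: ifPn => [/eqP h|_]; last by rewrite preimage_setT probability_setT.
  by exfalso; apply: hi; apply/eqP/val_inj.
rewrite mule1 => <-; last by move=> k; case: ifP.
congr (P _); apply/seteqP; split => w /=.
  by move=> Ew; split => // k kn; case: ifPn => // /eqP ->.
by move=> [_ /(_ n (ltnSn n))]; rewrite eqxx.
Qed.

(** The cylinder events in [X0], A(1), ..., A(n). They are stable under intersection, and [past n]
    is [Omega] with the sigma-algebra they generate, so that being a function of the past becomes
    measurability on another type. *)
Definition past_gen (n : nat) : set (set Omega) :=
  [set D | exists (B : set (VB R d)) (E : nat -> set (OpB R d)),
    [/\ measurable B, (forall k, measurable (E k)) &
     D = [set w | B (X0 w) /\ forall k : nat, (k < n)%N -> E k (A k.+1 w)]]].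

Definition past n := g_sigma_algebraType (past_gen n).

Lemma past_gen_measurable n D : past_gen n D -> measurable D.
Proof.
move=> [B [E [mB mE ->]]].
rewrite (_ : [set w | _] = X0 @^-1` B `&`
   \bigcap_k (if (k < n)%N then A k.+1 @^-1` E k else setT)).
  apply: measurableI; first by rewrite -[X in measurable X]setTI; exact: mX0.
  apply: bigcapT_measurable => k; case: ifP => // _.
  by rewrite -[X in measurable X]setTI; exact: mA.
apply/seteqP; split => w /=.
  by move=> [Bw Ew]; split => // k _; case: ifP => // kn; exact: Ew.
by move=> [Bw Ew]; split => // k kn; have := Ew k I; rewrite kn.
Qed.

Lemma past_measurable n : measurable_fun setT (id : Omega -> past n).
Proof.
apply: (@measurability _ _ Omega (past n) setT id (past_gen n)) => //.
by move=> _ [D GD <-]; rewrite setTI; exact: past_gen_measurable GD.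
Qed.

Lemma past_setI n : setI_closed (past_gen n).
Proof.
move=> _ _ [B [E [mB mE ->]]] [B' [E' [mB' mE' ->]]].
exists (B `&` B'), (fun k => E k `&` E' k); split.
- exact: measurableI.
- by move=> k; exact: measurableI.
apply/seteqP; split => w /=.
  by move=> [[h1 h2] [h3 h4]]; split => // k kn; split; [exact: h2|exact: h4].
by move=> [[h1 h3] h]; split; split => // k kn; have [] := h k kn.
Qed.

(** Pi-lambda argument: the finite measures [D |-> P (D & C)] and [D |-> P C * P D] agree on
    cylinders, hence on the sigma-algebra that these generate. *)
Lemma past_indep n (D : set (past n)) (E : set (OpB R d)) :
  measurable D -> measurable E ->
  P ((D : set Omega) `&` A n.+1 @^-1` E) = (P (D : set Omega) * P (A n.+1 @^-1` E))%E.
Proof.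
move=> mD mE.
have mC : measurable (A n.+1 @^-1` E).
  by rewrite -[X in measurable X]setTI; exact: mA.
set C := A n.+1 @^-1` E.
have c0 : 0 <= fine (P C) by rewrite fine_ge0.
pose m1 := mrestr P mC; pose m2 := mscale (NngNum c0) P.
have PC : (fine (P C))%:E = P C by rewrite fineK// fin_num_measure.
suff : m1 (D : set Omega) = m2 (D : set Omega).
  by rewrite /m1 /m2 /mrestr /mscale /= PC muleC.
have genE : [set X | past_gen n X /\ X `<=` setT] = past_gen n.
  by apply/seteqP; split => X //= [].
apply: (g_sigma_algebra_measure_unique_trace (past_gen n) setT) => //.
- by rewrite genE; exact: past_gen_measurable.
- by rewrite genE; exact: past_setI.
- by rewrite /m1 /m2 /= /mrestr /mscale /= setTI probability_setT mule1 PC.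
- rewrite genE => X [B [E' [mB mE' ->]]].
  rewrite /m1 /m2 /= /mrestr /mscale /= PC.
  have := iX n.+1 mB (E := fun k => if k == n then E else E' k).
  rewrite big_ord_recr/= eqxx muleA.
  rewrite (eq_bigr (fun k : 'I_n => P (A 1%N @^-1` E' k))); last first.
    by move=> k _; rewrite ltn_eqF.
  rewrite -(iX n mB mE') /C (same_law _ mE)// [RHS]muleC => <-; last by move=> k; case: ifP.
  congr (P _); apply/seteqP; split => w /=.
    move=> [[Bw h] Ew]; split => // k; rewrite ltnS leq_eqVlt => /predU1P[->|kn].
      by rewrite eqxx.
    by rewrite ltn_eqF//; exact: h.
  move=> [Bw h]; split; last by have := h n (ltnSn n); rewrite eqxx.
  by split => // k kn; have := h k (ltnW kn); rewrite ltn_eqF.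
- by rewrite /m1 /= /mrestr setTI -ge0_fin_numE// fin_num_measure.
- rewrite genE; exact: mD.
Qed.

Lemma measurable_X0_past n : measurable_fun setT (X0 : past n -> VB R d).
Proof.
move=> _ B mB; rewrite setTI; apply: sub_sigma_algebra.
exists B, (fun=> setT); split => //.
by apply/seteqP; split => w //= [].
Qed.

Lemma measurable_A_past n k : (k < n)%N -> measurable_fun setT (A k.+1 : past n -> OpB R d).
Proof.
move=> kn _ E mE; rewrite setTI; apply: sub_sigma_algebra.
exists setT, (fun j => if j == k then E else setT); split => //.
  by move=> j; case: ifP.
apply/seteqP; split => w /=; first by move=> Ew; split => // j _; case: ifPn => // /eqP ->.
by move=> [_ /(_ k kn)]; rewrite eqxx.
Qed.

Lemma measurable_xn_past n m : (m <= n)%N ->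
  measurable_fun setT (xn A X0 m : past n -> VB R d).
Proof.
elim: m => [|m IH] mn; first exact: measurable_X0_past.
have mc := @caratheodory R d _ (past n) (A m.+1)
  (fun x => measurableT_comp (eval_measurable x) (measurable_A_past mn))
  (fun w => topical_op_cont (tA w (ltn0Sn m))).
exact: (measurableT_comp mc (measurable_fun_pair (@measurable_id _ _ _) (IH (ltnW mn)))).
Qed.

Lemma markov n (U : past n -> R) (G : VB R d -> R) : bm U -> bm G ->
  Ex P (fun w => U w * G (xn A X0 n.+1 w)) = Ex P (fun w => U w * Pop G (xn A X0 n w)).
Proof.
move=> bU bG.
(* [Omega] with the sigma-algebra of [A n.+1]. The two identity maps from [Omega] to [past n] and to
   [T2] are then independent variables, and the integrand is a function on the product, taken on the
   diagonal. *)
pose T2 := g_sigma_algebra_preimageType (A n.+1 : Omega -> OpB R d).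
have mid2 : measurable_fun setT (id : Omega -> T2).
  by move=> _ B [E mE <-]; rewrite !setTI -[X in measurable X]setTI; exact: mA.
have mc := @caratheodory R d _ T2 (A n.+1)
  (fun x => measurableT_comp (eval_measurable x)
     (fun _ E mE => ex_intro2 _ _ E mE erefl : measurable (setT `&` A n.+1 @^-1` E : set T2)))
  (fun w => topical_op_cont (tA w (ltn0Sn n))).
pose f (z : past n * T2) := U z.1 * G (A n.+1 z.2 (xn A X0 n z.1)).
have bf : bm f.
  apply: bmM; first exact: (bm_comp bU measurable_fst).
  apply: (bm_comp bG (g := fun z : past n * T2 => A n.+1 z.2 (xn A X0 n z.1) : VB R d)).
  have h1 : measurable_fun setT (fun z : past n * T2 => xn A X0 n z.1 : VB R d).
    exact: (measurableT_comp (measurable_xn_past (leqnn n)) measurable_fst).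
  have h2 : measurable_fun setT (fun z : past n * T2 => (z.2, xn A X0 n z.1) : T2 * VB R d).
    by apply: measurable_fun_pair => //; exact: measurable_snd.
  exact: (measurableT_comp mc h2).
rewrite -[LHS]/(Ex P (fun w => f (w, w))).
rewrite (@indep_Fubini _ _ _ _ _ (past n) T2 P id id f)//; last 2 first.
- exact: past_measurable.
- by move=> B _ mB [E mE <-]; rewrite setTI /=; exact: past_indep.
congr Ex; apply/funext => w1; rewrite /f /= /Pop.
have bGA k : (0 < k)%N -> bm (fun w => G (A k w (xn A X0 n w1))).
  by move=> k0; apply: (bm_comp bG (g := fun w => A k w (xn A X0 n w1) : VB R d)); exact: measurable_A.
rewrite ExZ; last exact: bGA.
congr (_ * _); apply: (@Ex_law _ _ _ _ (VB R d)) => //.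
- exact: measurable_A.
- exact: measurable_A.
- move=> B mB.
  have mE : measurable ((fun F : OpB R d => F (xn A X0 n w1)) @^-1` B).
    by rewrite -[X in measurable X]setTI; exact: eval_measurable.
  exact: (same_law (ltn0Sn n) mE).
Qed.

Lemma markov_iter m k (psi G : VB R d -> R) : bm psi -> bm G ->
  Ex P (fun w => psi (xn A X0 m w) * G (xn A X0 (m + k) w)) =
  Ex P (fun w => psi (xn A X0 m w) * iter k Pop G (xn A X0 m w)).
Proof.
move=> bpsi; elim: k G => [|k IH] G bG; first by rewrite addn0.
rewrite addnS (@markov (m + k) (fun w => psi (xn A X0 m w)))//; last first.
  by apply: (bm_comp bpsi); apply: measurable_xn_past; exact: leq_addr.
by rewrite IH ?iterSr//; exact: bm_Pop.
Qed.

Lemma Ex_xn n (G : VB R d -> R) : bm G ->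
  Ex P (fun w => G (xn A X0 n w)) = Ex P (fun w => iter n Pop G (X0 w)).
Proof.
move=> bG; have := markov_iter 0 n (bm_cst 1) bG; rewrite add0n.
by under eq_fun do rewrite mul1r; under [X in _ = Ex _ X]eq_fun do rewrite mul1r.
Qed.

End Start.

(** Lets the Markov property be used from a deterministic starting point, which gives the formula
    for the iterates of [Pop] below. *)
Lemma indep_cst X0 (x : V) : indep P A X0 -> indep P A (fun=> x).
Proof.
move=> iX n B E mB mE.
have := iX n setT E measurableT mE; rewrite preimage_setT probability_setT mul1e => <-.
have [Bx|Bx] := pselect (B x).
  rewrite (_ : _ @^-1` B = setT) ?probability_setT ?mul1e; last by apply/seteqP; split.
  by congr (P _); apply/seteqP; split => w /= [].
rewrite (_ : _ @^-1` B = set0) ?measure0 ?mul0e; last by apply/seteqP; split.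
by rewrite (_ : [set w | _] = set0) ?measure0//; apply/seteqP; split => w /= [].
Qed.

Lemma iter_PopE X0 n (G : VB R d -> R) (x : V) : indep P A X0 -> bm G ->
  iter n Pop G x = Ex P (fun w => G (prodA A n w x)).
Proof.
move=> /(indep_cst x) iX bG.
by rewrite -[LHS](Ex_cst P); apply/esym; exact: (Ex_xn (measurable_cst _) iX n bG).
Qed.

End Markov.

(** * Contraction by rank-one blocks *)

Section Trigo.
Context {R : realType}.
Implicit Types (p q x y : R).

Lemma polar p q : exists a,
  p = Num.sqrt (p ^+ 2 + q ^+ 2) * cos a /\ q = Num.sqrt (p ^+ 2 + q ^+ 2) * sin a.
Proof.
set r := Num.sqrt _.
have s0 : 0 <= p ^+ 2 + q ^+ 2 by rewrite addr_ge0 ?sqr_ge0.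
have rE : r ^+ 2 = p ^+ 2 + q ^+ 2 by rewrite sqr_sqrtr.
have [r0|rn0] := eqVneq r 0.
  move/eqP: rE; rewrite r0 expr0n/= eq_sym paddr_eq0 ?sqr_ge0// !sqrf_eq0.
  by move=> /andP[/eqP -> /eqP ->]; exists 0; rewrite !mul0r.
have rp : 0 < r by rewrite lt_def rn0 sqrtr_ge0.
have pr2 : (p / r) ^+ 2 + (q / r) ^+ 2 = 1.
  by rewrite !expr_div_n -mulrDl -rE divff// expf_neq0.
have pI : -1 <= p / r <= 1.
  rewrite -ler_norml -(@ler_pXn2r _ 2)// ?nnegrE//.
  by rewrite expr1n real_normK ?num_real// -pr2 lerDl sqr_ge0.
have cE : cos (acos (p / r)) = p / r by rewrite acosK// in_itv.
have sE : sin (acos (p / r)) = `|q / r|.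
  by rewrite sin_acos// -pr2 addrAC subrr add0r sqrtr_sqr.
have [q0|q0] := leP 0 (q / r).
  exists (acos (p / r)); rewrite cE sE ger0_norm//.
  by split; rewrite mulrC divfK.
exists (- acos (p / r)); rewrite cosN sinN cE sE ltr0_norm// opprK.
by split; rewrite mulrC divfK.
Qed.

Lemma sin_natmul n x : `|sin (n%:R * x)| <= n%:R * `|sin x|.
Proof.
elim: n => [|n IH]; first by rewrite !mul0r sin0 normr0.
rewrite -natr1 !mulrDl !mul1r sinD (le_trans (ler_normD _ _))// lerD//.
  rewrite normrM (le_trans _ IH)// -[leRHS]mulr1 ler_wpM2l//; exact: cos_max.
by rewrite normrM -[leRHS]mul1r ler_wpM2r//; exact: cos_max.
Qed.

Lemma cos_half x : 1 - cos x = 2 * sin (x / 2) ^+ 2.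
Proof.
rewrite {1}(splitr x) cosD -!expr2 cos2sin2; ring.
Qed.

(** By the half-angle formula this is the square of [|sin (n y)| <= n |sin y|]. *)
Lemma cos_natmul n x : 1 - cos (n%:R * x) <= n%:R ^+ 2 * (1 - cos x).
Proof.
rewrite !cos_half [leRHS]mulrCA ler_wpM2l// -exprMn -mulrA.
rewrite -[X in X <= _]real_normK ?num_real// -[X in _ <= X]real_normK ?num_real//.
rewrite normrM normr_nat ler_pXn2r// ?nnegrE// ?mulr_ge0//.
exact: sin_natmul.
Qed.

(** With [r] the left-hand side, this is [2 r <= 1 + r ^ 2]. It turns a bound on the squared modulus
    of a characteristic function into a contraction factor, and is the source of the division of the
    gap by 2. *)
Lemma sqrt_le_amgm p q : Num.sqrt (p ^+ 2 + q ^+ 2) <= 1 - (1 - p ^+ 2 - q ^+ 2) / 2.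
Proof.
set r := Num.sqrt _.
have rE : r ^+ 2 = p ^+ 2 + q ^+ 2 by rewrite sqr_sqrtr// addr_ge0 ?sqr_ge0.
have := sqr_ge0 (1 - r); have -> : 1 - p ^+ 2 - q ^+ 2 = 1 - r ^+ 2 by rewrite rE; ring.
move=> h; nra.
Qed.

End Trigo.

Section ParamExpectation.
Context {R : realType} {disp : measure_display} {T : measurableType disp}.
Variable P : probability T R.

Lemma ExZr (c : R) (f : T -> R) : bm f -> Ex P (fun x => f x * c) = Ex P f * c.
Proof. by move=> bf; rewrite !ExE RintegralZr//; exact: bm_integrable. Qed.

Lemma Ex_continuous (f : R -> T -> R) (M : R) :
  (forall t, measurable_fun setT (f t)) -> (forall t w, `|f t w| <= M) ->
  (forall w, continuous (f ^~ w)) -> continuous (fun t => Ex P (f t)).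
Proof.
move=> mf fM cf t.
have tI : t \in (`]t - 1, t + 1[%classic : set R).
  by rewrite inE /= in_itv/=; apply/andP; split; lra.
apply: (@continuity_under_integral R _ T P f setT measurableT (t - 1) (t + 1)
  _ _ (cst M)) => //.
- by move=> x _; apply: bm_integrable; split => //; exists M.
- by apply: aeW => w _ x _; exact: cf.
- exact: finite_measure_integrable_cst.
- by move=> x _; apply: aeW => w _; exact: fM.
Qed.

End ParamExpectation.

Section RankOne.
Context {R : realType} {d : nat} {dO : measure_display} {Omega : measurableType dO}.
Variable P : probability Omega R.
Variable A : nat -> Omega -> 'rV[R]_d -> 'rV[R]_d.
Variable X0 : Omega -> 'rV[R]_d.
Local Notation V := 'rV[R]_d.
Local Notation one := (@ones R d).
Hypothesis d0 : (0 < d)%N.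
Hypothesis tA : forall n w, (0 < n)%N -> topical_op (A n w).
Hypothesis mA : forall n, (0 < n)%N -> measurable_fun setT (A n : Omega -> OpB R d).
Hypothesis iX : indep P A X0.

Local Notation Pop := (Pop P A).
Let tP := topical_prodA tA.

Definition rank1_event N : set Omega := [set w | rank1 (prodA A N w)].

(* By continuity, having rank one can be tested on the countably many grid points. *)
Lemma measurable_rank1 N : measurable (rank1_event N).
Proof.
rewrite (_ : rank1_event N = \bigcap_k \bigcap_(z : {ffun 'I_d -> int}) \bigcap_(i : 'I_d)
   [set w | pr (prodA A N w (grid k z)) ord0 i == pr (prodA A N w 0) ord0 i]).
  apply: bigcapT_measurable => k; apply: bigcap_countType_measurable => z.
  apply: bigcap_countType_measurable => i.
  have mp x : measurable_fun setT (fun w => pr (prodA A N w x) ord0 i).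
    have mpr : measurable_fun setT (fun x : VB R d => pr x ord0 i).
      apply: VB_cont_real => y.
      apply: (@continuous_comp _ _ _ (@pr R d) (fun x : V => x ord0 i)).
        exact: pr_cont.
      exact: coord_continuous.
    exact: (measurableT_comp mpr (measurable_prodA tA mA N x)).
  have := measurable_fun_eqr (mp (grid k z)) (mp 0).
  by move=> /(_ measurableT [set true] I); rewrite setTI.
apply/seteqP; split => w /=.
  by move=> rw k _ z _ i _ /=; rewrite (rank1_pr d0 _ 0 rw).
move=> h.
have hk x : pr (prodA A N w x) = pr (prodA A N w 0).
  apply/rowP => i.
  have hc : (fun k => pr (prodA A N w (grid k (gridf k x))) ord0 i) @ \oo -->
     pr (prodA A N w x) ord0 i.
    apply/cvgrPdist_le => e e0.
    have : (fun k : nat => k.+1%:R^-1 : R) @ \oo --> (0 : R) by exact: cvg_harmonic.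
    have e30 : 0 < e / 2 by rewrite divr_gt0.
    move=> /cvgrPdist_le/(_ _ e30); apply: filterS => k; rewrite sub0r normrN ger0_norm// => hk.
    set y := grid k _.
    have hxy : `|prodA A N w x - prodA A N w y| <= e / 2.
      by rewrite (le_trans (topical_op_lip _ _ (tP N w)))// (le_trans (grid_approx _ _)).
    have h1 := le_trans (vmax_lip d0 (prodA A N w x) (prodA A N w y)) hxy.
    have := le_trans (coord_le_norm (prodA A N w x - prodA A N w y) i) hxy.
    move: h1; rewrite /pr !mxE !mulr1 => h1 h2.
    rewrite (_ : _ - _ = (prodA A N w x ord0 i - prodA A N w y ord0 i) -
      (vmax (prodA A N w x) - vmax (prodA A N w y))); last by ring.
    by rewrite (le_trans (ler_normB _ _))// (splitr e) lerD.
  have : (fun k => pr (prodA A N w (grid k (gridf k x))) ord0 i) @ \oo -->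
     pr (prodA A N w 0) ord0 i.
    rewrite (_ : (fun k => _) = (fun _ => pr (prodA A N w 0) ord0 i)); first exact: cvg_cst.
    by apply/funext => k; apply/eqP; exact: (h k I (gridf k x) I i I).
  by move=> h2; apply: (cvg_unique _ hc h2).
by move=> x y; apply/(peqP d0); rewrite !hk.
Qed.

Definition proj_inv (F : V -> R) := forall x c, F (x + c *: one) = F x.

Lemma proj_inv_pr F x : proj_inv F -> F (pr x) = F x.
Proof. by move=> iF; rewrite [in RHS](prE x) iF. Qed.

Lemma proj_inv_rank1 F B x y : proj_inv F -> rank1 B -> F (B x) = F (B y).
Proof. by move=> iF rB; have [c ->] := rB x y; rewrite iF. Qed.

Lemma proj_inv_Pop k F : proj_inv F -> proj_inv (iter k Pop F).
Proof.
move=> iF; elim: k => //= k IH x c; rewrite /Defs.Ex /Pop.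
congr Ex; apply/funext => w.
by rewrite (tA w (ltn0Sn 0)).2 IH.
Qed.

Section Block.
Variable N : nat.
Let p := fine (P (rank1_event N)).

(** Coupling: the same N maps drive both starting points, and on the rank-one event the two
    trajectories end in the same class. *)
Lemma osc_contraction (F : VB R d -> R) (b : R) : bm F -> proj_inv F ->
  (forall x y, `|F x - F y| <= b) ->
  forall x y, `|iter N Pop F x - iter N Pop F y| <= (1 - p) * b.
Proof.
move=> bF iF Fb x y.
have bFA z : bm (fun w => F (prodA A N w z)).
  exact: (bm_comp bF (measurable_prodA tA mA N z)).
rewrite !(iter_PopE tA mA N _ iX bF)// -ExB//.
have bR := bm_indic (R := R) (measurable_rank1 N).
have -> : (1 - p) * b = Ex P (fun w => (1 - \1_(rank1_event N) w) * b).
  rewrite ExZr; last by apply: bmB => //; exact: bm_cst.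
  rewrite ExB//; last exact: bm_cst.
  rewrite Ex_cst; congr ((_ - _) * _).
  by rewrite /p -(Ex_indic P (measurable_rank1 N)).
apply: Ex_norm_le.
- exact: (bmB (bFA x) (bFA y)).
- exact: (bmM (bmB (bm_cst 1) bR) (bm_cst b)).
move=> w /=; rewrite indicE.
case: (boolP (w \in rank1_event N)) => [|_]; last by rewrite subr0 mul1r.
rewrite inE => rw; rewrite subrr mul0r.
by rewrite (proj_inv_rank1 x y iF rw) subrr normr0.
Qed.

Lemma osc_contraction_iter q (F : VB R d -> R) (b : R) : bm F -> proj_inv F ->
  (forall x y, `|F x - F y| <= b) ->
  forall x y, `|iter (q * N) Pop F x - iter (q * N) Pop F y| <= (1 - p) ^+ q * b.
Proof.
move=> bF iF Fb; elim: q => [|q IH] x y; first by rewrite mul0n expr0 mul1r.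
rewrite mulSn exprS -mulrA !iterD.
apply: osc_contraction => //; first exact: bm_iter_Pop.
exact: proj_inv_Pop.
Qed.

(* Real form of [F (x + a 1) = exp (- i t a) F x], with [G] and [G'] the real and imaginary parts
   of [F]. *)
Definition eqv (t M : R) (G : V -> R) :=
  [/\ bm (G : VB R d -> R), (forall x, `|G x| <= M) &
   exists2 G' : V -> R, bm (G' : VB R d -> R) &
     forall x a, G (x + a *: one) = cos (t * a) * G x + sin (t * a) * G' x].

Lemma eqv_Pop k t M G : eqv t M G -> eqv t M (iter k Pop G).
Proof.
move=> eG; elim: k => //= k [bG GM [G' bG' GE]]; split.
- exact: bm_Pop.
- move=> x; apply: Ex_bound => //.
  exact: (bm_comp bG (measurable_A mA x (ltn0Sn 0))).
exists (Pop G'); first exact: bm_Pop.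
have bA (H : VB R d -> R) x : bm H -> bm (fun w => H (A 1%N w x)).
  by move=> bH; exact: (bm_comp bH (measurable_A mA x (ltn0Sn 0))).
move=> x a; rewrite /Pop -!ExZ; [|exact: bA..].
rewrite -ExD; [|by apply: bmZ; exact: bA..].
by congr Ex; apply/funext => w; rewrite (tA w (ltn0Sn 0)).2 GE.
Qed.

(** Writing [(u, v) = r (cos a, sin a)], the combination is [r] times the value of [G] at
    [x + (a / t) 1]. The sup norm of [G] thus plays the part of the modulus of the complex
    function. *)
Lemma eqv_comb t M G G' (u v : R) x : t != 0 -> (forall x, `|G x| <= M) ->
  (forall x a, G (x + a *: one) = cos (t * a) * G x + sin (t * a) * G' x) ->
  `|u * G x + v * G' x| <= Num.sqrt (u ^+ 2 + v ^+ 2) * M.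
Proof.
move=> t0 GM GE; have [a [uE vE]] := polar u v.
set r := Num.sqrt _ in uE vE *.
rewrite uE vE -!mulrA -mulrDr normrM ger0_norm ?sqrtr_ge0// ler_wpM2l ?sqrtr_ge0//.
by have := GE x (a / t); rewrite mulrCA divff// mulr1 => <-.
Qed.

Variable m : nat.

(** The variable W. The noises [w1], [w2], [w3] drive the first, middle and last block
    independently; [w2] comes last because it is integrated with the other two frozen. *)
Definition block_phase (w1 w3 w2 : Omega) : R :=
  vmax (prodA A N w3 (prodA A m w2 (prodA A N w1 0))).

Lemma measurable_block_phase3 : measurable_fun setT
  (fun z : (Omega * Omega) * Omega => block_phase z.1.1 z.1.2 z.2).
Proof.
have m2 := measurable_prodA2 tA mA.
have h1 : measurable_fun setT (fun z : (Omega * Omega) * Omega => prodA A N z.1.1 0 : VB R d).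
  apply: (measurableT_comp (measurable_prodA tA mA N 0)).
  exact: (measurableT_comp measurable_fst measurable_fst).
have h2 : measurable_fun setT (fun z : (Omega * Omega) * Omega =>
    prodA A m z.2 (prodA A N z.1.1 0) : VB R d).
  exact: (measurableT_comp (m2 m) (measurable_fun_pair measurable_snd h1)).
have h3 : measurable_fun setT (fun z : (Omega * Omega) * Omega =>
    prodA A N z.1.2 (prodA A m z.2 (prodA A N z.1.1 0)) : VB R d).
  exact: (measurableT_comp (m2 N) (measurable_fun_pair
    (measurableT_comp measurable_snd measurable_fst) h2)).
apply: measurableT_comp h3; apply: VB_cont_real.
exact/topical_fun_cont/topical_vmax.
Qed.

Lemma measurable_block_phase w1 w3 : measurable_fun setT (block_phase w1 w3).
Proof. exact: (measurableT_comp measurable_block_phase3 (measurable_pair1 (w1, w3))). Qed.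

Definition phase_cos (t : R) w1 w3 := Ex P (fun w2 => cos (t * block_phase w1 w3 w2)).
Definition phase_sin (t : R) w1 w3 := Ex P (fun w2 => sin (t * block_phase w1 w3 w2)).
(* [1 - |E exp (i t W)|^2], where [W] is the phase of the middle block. *)
Definition phase_gap (t : R) w1 w3 := 1 - phase_cos t w1 w3 ^+ 2 - phase_sin t w1 w3 ^+ 2.

Let bcos t w1 w3 : bm (fun w2 => cos (t * block_phase w1 w3 w2)).
Proof.
by apply: bm_cos; apply: measurable_funM; [exact: measurable_cst|exact: measurable_block_phase].
Qed.

Let bsin t w1 w3 : bm (fun w2 => sin (t * block_phase w1 w3 w2)).
Proof.
by apply: bm_sin; apply: measurable_funM; [exact: measurable_cst|exact: measurable_block_phase].
Qed.

(** Symmetrization: [|E exp (i t W)|^2] is the characteristic function of W minus an independent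
    copy. Positivity of the gap and its behaviour under [t |-> n t] are then read off the
    integrand. *)
Lemma phase_gap_double t w1 w3 : phase_gap t w1 w3 =
  Ex P (fun w => Ex P (fun w' => 1 - cos (t * (block_phase w1 w3 w - block_phase w1 w3 w')))).
Proof.
have E w : Ex P (fun w' => 1 - cos (t * (block_phase w1 w3 w - block_phase w1 w3 w'))) =
   1 - (phase_cos t w1 w3 * cos (t * block_phase w1 w3 w) + phase_sin t w1 w3 * sin (t * block_phase w1 w3 w)).
  under eq_fun do rewrite mulrBr cosB.
  rewrite ExB; [|exact: bm_cst|by apply: bmD; exact: bmZ].
  by rewrite Ex_cst ExD ?ExZ//; [congr (_ - (_ + _)); rewrite mulrC|exact: bmZ..].
under eq_fun do rewrite E.
rewrite ExB; [|exact: bm_cst|by apply: bmD; exact: bmZ].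
by rewrite Ex_cst ExD ?ExZ//; [rewrite /phase_gap opprD addrA|exact: bmZ..].
Qed.

Lemma phase_gap_ge0 t w1 w3 : 0 <= phase_gap t w1 w3.
Proof.
rewrite phase_gap_double; apply: Ex_ge0 => w; apply: Ex_ge0 => w'.
by rewrite subr_ge0 cos_le1.
Qed.

Lemma phase_gap_le1 t w1 w3 : phase_gap t w1 w3 <= 1.
Proof. by rewrite /phase_gap -addrA gerDl -opprD oppr_le0 addr_ge0 ?sqr_ge0. Qed.

Lemma phase_gap_natmul n t w1 w3 : phase_gap (n%:R * t) w1 w3 <= n%:R ^+ 2 * phase_gap t w1 w3.
Proof.
have bD s w : bm (fun w' => 1 - cos (s * (block_phase w1 w3 w - block_phase w1 w3 w'))).
  apply: bmB; first exact: bm_cst.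
  apply: bm_cos; apply: measurable_funM; first exact: measurable_cst.
  by apply: measurable_funB; [exact: measurable_cst|exact: measurable_block_phase].
have bDD s : bm (fun w => Ex P (fun w' => 1 - cos (s * (block_phase w1 w3 w - block_phase w1 w3 w')))).
  apply: (bm_Ex2 P (f := fun z => 1 - cos (s * (block_phase w1 w3 z.1 - block_phase w1 w3 z.2)))).
  apply: bmB; first exact: bm_cst.
  apply: bm_cos; apply: measurable_funM; first exact: measurable_cst.
  apply: measurable_funB.
    exact: (measurableT_comp (measurable_block_phase w1 w3) measurable_fst).
  exact: (measurableT_comp (measurable_block_phase w1 w3) measurable_snd).
rewrite !phase_gap_double -ExZ//; apply: Ex_le => //; first exact: bmZ.
move=> w; rewrite -ExZ//; apply: Ex_le => //; first exact: bmZ.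
by move=> w'; rewrite -mulrA; exact: cos_natmul.
Qed.

Definition rank1_ind w : R := \1_(rank1_event N) w.

Lemma rank1_ind01 w : 0 <= rank1_ind w <= 1.
Proof. by rewrite /rank1_ind indicE; case: (_ \in _); rewrite ?ler01 ?lexx. Qed.

Lemma bm_rank1_ind : bm rank1_ind. Proof. exact: bm_indic (measurable_rank1 N). Qed.

Lemma bm_RRD t : bm (fun z : Omega * Omega => rank1_ind z.1 * rank1_ind z.2 * phase_gap t z.1 z.2).
Proof.
have mt : measurable_fun setT
    (fun z : (Omega * Omega) * Omega => t * block_phase z.1.1 z.1.2 z.2).
  by apply: measurable_funM; [exact: measurable_cst|exact: measurable_block_phase3].
have bC : bm (fun z : Omega * Omega => phase_cos t z.1 z.2).
  exact: (bm_Ex2 P (bm_cos mt)).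
have bS : bm (fun z : Omega * Omega => phase_sin t z.1 z.2).
  exact: (bm_Ex2 P (bm_sin mt)).
apply: bmM; first apply: bmM.
- exact: (bm_comp bm_rank1_ind measurable_fst).
- exact: (bm_comp bm_rank1_ind measurable_snd).
by apply: bmB; [apply: bmB; [exact: bm_cst|exact: bmM]|exact: bmM].
Qed.

(** The indicators keep only pairs of rank-one outer blocks: for the others the middle block need
    not act through a phase, and the trivial bound is used. *)
Definition outer_gap (t : R) w1 := Ex P (fun w3 => rank1_ind w1 * rank1_ind w3 * phase_gap t w1 w3).
Definition mean_gap (t : R) := Ex P (outer_gap t).

Lemma bm_RRD1 t w1 : bm (fun w3 => rank1_ind w1 * rank1_ind w3 * phase_gap t w1 w3).
Proof. exact: (bm_comp (bm_RRD t) (measurable_pair1 w1)). Qed.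

Lemma bm_outer_gap t : bm (outer_gap t).
Proof. exact: (bm_Ex2 P (bm_RRD t)). Qed.

Lemma RRD_ge0 t w1 w3 : 0 <= rank1_ind w1 * rank1_ind w3 * phase_gap t w1 w3.
Proof.
have /andP[h1 _] := rank1_ind01 w1; have /andP[h3 _] := rank1_ind01 w3.
by rewrite !mulr_ge0// phase_gap_ge0.
Qed.

Lemma RRD_le1 t w1 w3 : rank1_ind w1 * rank1_ind w3 * phase_gap t w1 w3 <= 1.
Proof.
have /andP[h1 h1'] := rank1_ind01 w1; have /andP[h3 h3'] := rank1_ind01 w3.
by rewrite !mulr_ile1 ?mulr_ge0 ?phase_gap_ge0 ?phase_gap_le1.
Qed.

Lemma mean_gap_ge0 t : 0 <= mean_gap t.
Proof. by apply: Ex_ge0 => w1; apply: Ex_ge0 => w3; exact: RRD_ge0. Qed.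

Lemma mean_gap_le1 t : mean_gap t <= 1.
Proof.
rewrite -[leRHS](Ex_cst P 1); apply: Ex_le; [exact: bm_outer_gap|exact: bm_cst|].
move=> w1; rewrite -[leRHS](Ex_cst P 1).
by apply: Ex_le; [exact: bm_RRD1|exact: bm_cst|move=> w3; exact: RRD_le1].
Qed.

Lemma mean_gap_natmul n t : mean_gap (n%:R * t) <= n%:R ^+ 2 * mean_gap t.
Proof.
rewrite -ExZ; last exact: bm_outer_gap.
apply: Ex_le => [||w1]; [exact: bm_outer_gap|by apply: bmZ; exact: bm_outer_gap|].
rewrite -ExZ; last exact: bm_RRD1.
apply: Ex_le => [||w3]; [exact: bm_RRD1|by apply: bmZ; exact: bm_RRD1|].
rewrite mulrCA ler_wpM2l ?phase_gap_natmul//.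
by have /andP[h1 _] := rank1_ind01 w1; have /andP[h3 _] := rank1_ind01 w3; rewrite mulr_ge0.
Qed.

Lemma mean_gap_continuous : continuous mean_gap.
Proof.
have cC w1 w3 : continuous (fun t => phase_cos t w1 w3).
  apply: (Ex_continuous (M := 1)) => [t|t w|w t].
  - by case: (bcos t w1 w3).
  - exact: cos_max.
  - have h := @continuous_comp R R R (fun t => t * block_phase w1 w3 w) cos t.
    by apply: h; [exact: mulrr_continuous|exact: continuous_cos].
have cS w1 w3 : continuous (fun t => phase_sin t w1 w3).
  apply: (Ex_continuous (M := 1)) => [t|t w|w t].
  - by case: (bsin t w1 w3).
  - exact: sin_max.
  - have h := @continuous_comp R R R (fun t => t * block_phase w1 w3 w) sin t.
    by apply: h; [exact: mulrr_continuous|exact: continuous_sin].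
have cD w1 w3 : continuous (fun t => phase_gap t w1 w3).
  move=> t; rewrite /phase_gap; apply: cvgB; last by apply: cvgM; exact: cS.
  by apply: cvgB; [exact: cvg_cst|apply: cvgM; exact: cC].
have n1 (r : R) : 0 <= r -> r <= 1 -> `|r| <= 1 by move=> ? ?; rewrite ger0_norm.
apply: (Ex_continuous (M := 1)) => [t|t w1|w1].
- by case: (bm_outer_gap t).
- by apply: Ex_bound => [|w3]; [exact: bm_RRD1|apply: n1; [exact: RRD_ge0|exact: RRD_le1]].
apply: (Ex_continuous (M := 1)) => [t|t w3|w3].
- by case: (bm_RRD1 t w1).
- by apply: n1; [exact: RRD_ge0|exact: RRD_le1].
by move=> t; apply: cvgM; [exact: cvg_cst|exact: cD].
Qed.

(* Conditionally on the two outer rank-one blocks, the middle block acts on [G] only through the phase [block_phase]. *)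
Lemma block_bound t M G w1 w3 x : t != 0 -> eqv t M G ->
  `|Ex P (fun w2 => G (prodA A N w3 (prodA A m w2 (prodA A N w1 x))))|
    <= M * (1 - rank1_ind w1 * rank1_ind w3 * phase_gap t w1 w3 / 2).
Proof.
move=> t0 [bG GM [G' bG' GE]].
have M0 : 0 <= M by apply: le_trans (GM 0).
have m23 y : measurable_fun setT (fun w2 => prodA A N w3 (prodA A m w2 y) : VB R d).
  have := measurableT_comp (measurable_prodA2 tA mA N) (measurable_fun_pair
    (measurable_cst w3) (measurable_prodA tA mA m y)).
  exact.
have [|] := boolP (w1 \in rank1_event N); last first.
  move=> h; rewrite {1}/rank1_ind indicE (negbTE h) !mul0r subr0 mulr1.
  by apply: Ex_bound => [|w2] //; exact: (bm_comp bG (m23 _)).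
have [|] := boolP (w3 \in rank1_event N); last first.
  move=> h _; rewrite {2}/rank1_ind indicE (negbTE h) mulr0 !mul0r subr0 mulr1.
  by apply: Ex_bound => [|w2] //; exact: (bm_comp bG (m23 _)).
move=> h3 h1; rewrite /rank1_ind !indicE h1 h3 !mul1r.
move: h1 h3; rewrite !inE => r1 r3.
have [c cE] := r1 x 0.
(* The first block sends [x] to its value at 0 plus [c 1], and the last one always outputs the class
   of its value at 0. The final point is therefore [zc + W 1]. *)
pose zc := pr (prodA A N w3 0) + c *: one.
have E w2 : G (prodA A N w3 (prodA A m w2 (prodA A N w1 x))) =
   G zc * cos (t * block_phase w1 w3 w2) + G' zc * sin (t * block_phase w1 w3 w2).
  rewrite cE (tP m w2).2 (tP N w3).2 [X in G (X + _)](prE _).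
  rewrite (rank1_pr d0 _ 0 r3) -/(block_phase w1 w3 w2) addrAC GE.
  by rewrite mulrC; congr (_ + _); rewrite mulrC.
under eq_fun do rewrite E.
rewrite ExD ?ExZ//; [|exact: bmZ..].
rewrite mulrC [X in _ + X]mulrC.
apply: (le_trans (eqv_comb _ _ _ t0 GM GE)).
by rewrite mulrC ler_wpM2l//; exact: sqrt_le_amgm.
Qed.

Lemma block_contraction t M G : t != 0 -> eqv t M G ->
  eqv t (M * (1 - mean_gap t / 2)) (iter (N + (m + N)) Pop G).
Proof.
move=> t0 eG; have [bG' _ G'E] := eqv_Pop (N + (m + N)) eG.
split => // x; have [bG GM _] := eG.
have M0 : 0 <= M by apply: le_trans (GM 0).
rewrite 2!iterD (iter_PopE tA mA N x iX); last exact: (bm_iter_Pop P tA mA m (bm_iter_Pop P tA mA N bG)).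
have -> : M * (1 - mean_gap t / 2) = Ex P (fun w1 => M * (1 - outer_gap t w1 / 2)).
  rewrite ExZ; last by apply: bmB; [exact: bm_cst|apply: bmM; [exact: bm_outer_gap|exact: bm_cst]].
  rewrite ExB; [|exact: bm_cst|by apply: bmM; [exact: bm_outer_gap|exact: bm_cst]].
  rewrite Ex_cst; congr (_ * (_ - _)).
  by rewrite ExZr//; exact: bm_outer_gap.
apply: Ex_norm_le.
- exact: (bm_comp (bm_iter_Pop P tA mA m (bm_iter_Pop P tA mA N bG)) (measurable_prodA tA mA N x)).
- by apply: bmZ; apply: bmB; [exact: bm_cst|apply: bmM; [exact: bm_outer_gap|exact: bm_cst]].
move=> w1; rewrite (iter_PopE tA mA m _ iX); last exact: (bm_iter_Pop P tA mA N bG).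
under eq_fun do rewrite (iter_PopE tA mA N _ iX bG).
(* The noise of the middle block is moved innermost, so that it is integrated with both outer blocks
   frozen. *)
rewrite (@Ex_Fubini _ _ _ _ _ P P (fun z => G (prodA A N z.2 (prodA A m z.1 (prodA A N w1 x)))))/=; last first.
  apply: (bm_comp bG (g := fun z : Omega * Omega => prodA A N z.2 (prodA A m z.1 (prodA A N w1 x)) : VB R d)).
  exact: (measurableT_comp (measurable_prodA2 tA mA N) (measurable_fun_pair measurable_snd
    (measurableT_comp (measurable_prodA tA mA m _) measurable_fst))).
have -> : M * (1 - outer_gap t w1 / 2) = Ex P (fun w3 => M * (1 - rank1_ind w1 * rank1_ind w3 * phase_gap t w1 w3 / 2)).
  have bq : bm (fun w3 => rank1_ind w1 * rank1_ind w3 * phase_gap t w1 w3 / 2).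
    by apply: bmM; [exact: bm_RRD1|exact: bm_cst].
  rewrite ExZ; last by apply: bmB; [exact: bm_cst|].
  rewrite ExB//; last exact: bm_cst.
  rewrite Ex_cst; congr (_ * (_ - _)).
  by rewrite ExZr//; exact: bm_RRD1.
apply: Ex_norm_le.
- apply: (bm_Ex2 P (f := fun z => G (prodA A N z.1 (prodA A m z.2 (prodA A N w1 x))))).
  apply: (bm_comp bG (g := fun z : Omega * Omega => prodA A N z.1 (prodA A m z.2 (prodA A N w1 x)) : VB R d)).
  exact: (measurableT_comp (measurable_prodA2 tA mA N) (measurable_fun_pair measurable_fst
    (measurableT_comp (measurable_prodA tA mA m _) measurable_snd))).
- apply: bmZ; apply: bmB; first exact: bm_cst.
  by apply: bmM; [exact: bm_RRD1|exact: bm_cst].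
by move=> w3; exact: block_bound.
Qed.

End Block.
End RankOne.

(** For small [t] take [n] the integer part of [1 / t]. Then [n t] is within [t] of 1, so
    [D 1 / 2 <= D (n t) <= n^2 D t], and [n t <= 1]. *)
Lemma subquadratic_near0 {R : realType} (D : R -> R) : continuous D ->
  (forall n t, D (n%:R * t) <= n%:R ^+ 2 * D t) -> 0 < D 1 ->
  exists k r : R, [/\ 0 < k, 0 < r &
    forall t, 0 < t -> `|0 - t| < r -> k * t ^+ 2 <= D t].
Proof.
move=> cD nD D1.
have c0 : 0 < D 1 / 2 by rewrite divr_gt0.
have /cvgrPdist_lt/(_ _ c0)/nbhs_ballP[r /= r0 hr] := cD 1.
exists (D 1 / 2), (Num.min r 1); split; [exact: c0|by rewrite lt_min r0 ltr01|].
move=> t tp; rewrite sub0r normrN (gtr0_norm tp) lt_min => /andP[tr t1].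
pose n := Num.truncn t^-1.
have /andP[n1 n2] : (n%:R : R) <= t^-1 < n.+1%:R.
  by apply: truncn_itv; rewrite invr_ge0 ltW.
have nt1 : n%:R * t <= 1 by rewrite -ler_pdivlMr// mul1r.
have nt2 : 1 < n%:R * t + t.
  by rewrite -[X in _ + X]mul1r -mulrDl natr1 -ltr_pdivrMr// mul1r.
have h : `|D 1 - D (n%:R * t)| < D 1 / 2.
  apply: hr; rewrite -ball_normE/= ger0_norm ?subr_ge0//; lra.
have h2 : D 1 / 2 <= D (n%:R * t) by move: h; rewrite ltr_norml => /andP[_]; lra.
have h3 := le_trans h2 (nD n t).
have nn : 0 <= n%:R * t by rewrite mulr_ge0 ?ler0n// ltW.
have D0 : 0 < D t.
  rewrite ltNge; apply/negP => Dt.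
  have : n%:R ^+ 2 * D t <= 0 by rewrite mulr_ge0_le0 ?sqr_ge0.
  move: h3 c0; lra.
have : D 1 / 2 * t ^+ 2 <= (n%:R * t) ^+ 2 * D t.
  by rewrite exprMn [leRHS]mulrAC; apply: ler_wpM2r h3; exact: sqr_ge0.
move=> /le_trans; apply; rewrite -[leRHS]mul1r; apply: ler_wpM2r; first exact: ltW.
by rewrite expr_le1.
Qed.

(** Away from 0 a positive lower bound suffices. It is put in the form [k t^2], using [t <= 2 t0],
    to match the estimate near 0. *)
Lemma quadratic_near_pos {R : realType} (D : R -> R) t0 : continuous D ->
  0 < t0 -> 0 < D t0 ->
  exists k r : R, [/\ 0 < k, 0 < r &
    forall t, 0 < t -> `|t0 - t| < r -> k * t ^+ 2 <= D t].
Proof.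
move=> cD t00 Dm.
have c0 : 0 < D t0 / 2 by rewrite divr_gt0.
have /cvgrPdist_lt/(_ _ c0)/nbhs_ballP[r /= r0 hr] := cD t0.
exists (D t0 / 2 / (2 * t0) ^+ 2), (Num.min r t0); split.
- by rewrite divr_gt0// exprn_gt0// mulr_gt0.
- by rewrite lt_min r0.
move=> t tp; rewrite lt_min => /andP[tr t1].
have h : `|D t0 - D t| < D t0 / 2 by apply: hr; rewrite -ball_normE.
have h2 : D t0 / 2 <= D t by move: h; rewrite ltr_norml => /andP[_]; lra.
apply: le_trans h2.
have s0 : 0 < (2 * t0) ^+ 2 by rewrite exprn_gt0// mulr_gt0.
have ht : t ^+ 2 <= (2 * t0) ^+ 2.
  by move: t1; rewrite ltr_norml => /andP[h3 _]; rewrite ler_pXn2r ?nnegrE ?mulr_ge0 ?ltW//; lra.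
by rewrite mulrAC ler_pdivrMr// ler_wpM2l// ltW.
Qed.

(** * Gaussian decay, uniform over bounded frequencies *)

Section Decay.
Context {R : realType} {d : nat} {dO : measure_display} {Omega : measurableType dO}.
Variable P : probability Omega R.
Variable A : nat -> Omega -> 'rV[R]_d -> 'rV[R]_d.
Variable X0 : Omega -> 'rV[R]_d.
Local Notation V := 'rV[R]_d.
Local Notation one := (@ones R d).
Hypothesis d0 : (0 < d)%N.
Hypothesis tA : forall n w, (0 < n)%N -> topical_op (A n w).
Hypothesis mA : forall n, (0 < n)%N -> measurable_fun setT (A n : Omega -> OpB R d).
Hypothesis iX : indep P A X0.
Variable N : nat.

Local Notation Pop := (Pop P A).
Local Notation mean_gap := (mean_gap P A N).

(** The common consequence of the two non-arithmeticity hypotheses. The length [m] of the middle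
    block is allowed to depend on [t]. *)
Definition nonlattice := forall t, 0 < t -> exists m, 0 < mean_gap m t.

Lemma mean_gap_quadratic (t0 : R) : nonlattice -> 0 <= t0 ->
  exists m (k r : R), [/\ 0 < k, 0 < r &
    forall t, 0 < t -> `|t0 - t| < r -> k * t ^+ 2 <= mean_gap m t].
Proof.
move=> NA; rewrite le_eqVlt => /predU1P[<-|t00].
  have [m Dm] := NA 1 ltr01; exists m.
  apply: (subquadratic_near0 _ _ Dm).
    exact: (@mean_gap_continuous _ _ _ _ P A d0 tA mA N m).
  exact: (mean_gap_natmul P d0 tA mA N m).
have [m Dm] := NA t0 t00; exists m.
apply: (quadratic_near_pos _ t00 Dm).
exact: (@mean_gap_continuous _ _ _ _ P A d0 tA mA N m).
Qed.

Lemma block_contraction_iter m q t M G : t != 0 -> eqv t M G ->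
  eqv t (M * (1 - mean_gap m t / 2) ^+ q) (iter (q * (N + (m + N))) Pop G).
Proof.
move=> t0 eG; elim: q => [|q IH]; first by rewrite mul0n expr0 mulr1.
by rewrite mulSn iterD exprSr mulrA; exact: (block_contraction d0 tA mA iX).
Qed.

Lemma decay_block m (k t M : R) G n x : 0 <= k -> t != 0 -> eqv t M G ->
  k * t ^+ 2 <= mean_gap m t -> (0 < N)%N -> (N + (m + N) <= n)%N ->
  `|iter n Pop G x| <= M * expR (- (k / (4 * (N + (m + N))%:R) * n%:R * t ^+ 2)).
Proof.
move=> k0 t0 eG kD N0 Ln; set L := (N + (m + N))%N in Ln *.
have L0 : (0 < L)%N by rewrite /L addn_gt0 N0.
have M0 : 0 <= M by have [_ GM _] := eG; apply: le_trans (GM 0).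
rewrite (divn_eq n L); set q := (n %/ L)%N; set r := (n %% L)%N.
have q1 : (0 < q)%N by rewrite divn_gt0.
rewrite addnC iterD.
have [_ h _] := eqv_Pop P tA mA r (block_contraction_iter m q t0 eG).
apply: (le_trans (h x)); rewrite ler_wpM2l//.
have D1 := mean_gap_le1 P d0 tA mA N m t.
apply: (@le_trans _ _ (expR (- (mean_gap m t / 2)) ^+ q)).
  by rewrite ler_pXn2r ?nnegrE ?expR_ge0//; [exact: expR_ge1Dx|lra].
rewrite -expRM_natl ler_expR mulrN lerN2 -/q -/L.
have LR : 0 < L%:R :> R by rewrite ltr0n.
(* At least one full block fits, so the remainder at most doubles the time. With the factor 1/2 of
   the contraction this makes the constant [4 L]. *)
have nq : (r + q * L)%:R <= 2 * q%:R * L%:R :> R.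
  rewrite natrD natrM -mulrA mulrDl mul1r lerD2r -natrM ler_nat.
  by rewrite (leq_trans (ltnW (ltn_pmod n L0)))// leq_pmull.
apply: (@le_trans _ _ (k / (4 * L%:R) * (2 * q%:R * L%:R) * t ^+ 2)).
  by rewrite ler_wpM2r ?sqr_ge0// ler_wpM2l// divr_ge0// mulr_ge0// ltW.
have -> : k / (4 * L%:R) * (2 * q%:R * L%:R) * t ^+ 2 = q%:R * (k * t ^+ 2 / 2).
  by field; rewrite lt0r_neq0.
by rewrite ler_wpM2l// ler_wpM2r.
Qed.

(** The block length and the rate are local in [t]; compactness of [[0, K]], with [c] tending to 0
    from the right, makes them uniform. The same [c] gives the rate and the threshold on [n]. *)
Lemma decay (K : R) : nonlattice -> (0 < N)%N -> exists2 c : R, 0 < c &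
  forall t, 0 < t -> t <= K -> forall M G, eqv t M G -> forall n, c^-1 <= n%:R ->
  forall x, `|iter n Pop G x| <= M * expR (- (c * n%:R * t ^+ 2)).
Proof.
move=> NA N0.
pose Q (c t : R) := 0 < t -> forall M G, eqv t M G -> forall n, c^-1 <= n%:R ->
  forall x, `|iter n Pop G x| <= M * expR (- (c * n%:R * t ^+ 2)).
have /compact_near_coveringP/(_ R (0 : R)^'+ (fun c t => 0 < c -> Q c t)) :=
  @segment_compact R 0 K.
case.
  move=> t0 /=; rewrite in_itv/= => /andP[t00 _].
  have [m [k [r [k0 r0 h]]]] := mean_gap_quadratic NA t00.
  set L := (N + (m + N))%N.
  have LR : 0 < L%:R :> R by rewrite ltr0n addn_gt0 N0.
  (* The second term turns [c^-1 <= n] into [L <= n]: one full block fits. *)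
  pose c0 := Num.min (k / (4 * L%:R)) (L%:R^-1).
  have c00 : 0 < c0 by rewrite lt_min divr_gt0 ?mulr_gt0 ?invr_gt0.
  exists (ball t0 r, [set c | c < c0]) => /=.
    split; first exact: nbhsx_ballx.
    exact: nbhs_right_lt.
  move=> [t c] /= [tr cc0] cp tp M G eG n nc x.
  have M0 : 0 <= M by have [_ GM _] := eG; apply: le_trans (GM 0).
  move: cc0; rewrite lt_min => /andP[ck cL].
  have hk : k * t ^+ 2 <= mean_gap m t by apply: h => //; rewrite -[_ < r]/(ball_ normr t0 r t) ball_normE.
  have Ln : (L <= n)%N.
    rewrite -(ler_nat R) (le_trans _ nc)//.
    by rewrite -[L%:R]invrK lef_pV2 ?posrE ?invr_gt0// ltW.
  apply: (le_trans (decay_block x (ltW k0) (lt0r_neq0 tp) eG hk N0 Ln)).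
  by rewrite ler_wpM2l// ler_expR lerN2 ler_wpM2r ?sqr_ge0// ler_wpM2r// ltW.
move=> e /= e0 he; pose c := e / 2.
have c0 : 0 < c by rewrite divr_gt0.
exists c => // t tp tK.
apply: (he c) => //=.
- by rewrite sub0r normrN gtr0_norm// /c; lra.
- by rewrite in_itv/= (ltW tp).
Qed.

End Decay.

(** * Non-arithmeticity *)

Lemma positive_ae_ex {R : realType} {disp : measure_display} {T : measurableType disp}
  (P : probability T R) (D : set T) (Q : T -> Prop) :
  measurable D -> (0 < P D)%E -> {ae P, forall x, Q x} -> exists2 x, D x & Q x.
Proof.
move=> mD PD [S [mS S0 hS]].
apply: contrapT => /forall2NP h.
have DS : D `<=` S by move=> x Dx; apply: hS => /= Qx; case: (h x).
by move: PD; rewrite ltNge => /negP; apply; rewrite -S0; apply: le_measure => //; rewrite inE.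
Qed.

Section Phase.
Context {R : realType} {d : nat} {dO : measure_display} {Omega : measurableType dO}.
Variable P : probability Omega R.
Variable A : nat -> Omega -> 'rV[R]_d -> 'rV[R]_d.
Variable X0 : Omega -> 'rV[R]_d.
Local Notation V := 'rV[R]_d.
Local Notation one := (@ones R d).
Hypothesis d0 : (0 < d)%N.
Hypothesis tA : forall n w, (0 < n)%N -> topical_op (A n w).
Hypothesis mA : forall n, (0 < n)%N -> measurable_fun setT (A n : Omega -> OpB R d).
Hypothesis iX : indep P A X0.
Variable N : nat.
Hypothesis PN : (0 < P (rank1_event A N))%E.

Local Notation Pop := (Pop P A).

Lemma lattice_outer_blocks t : (forall m, ~ 0 < mean_gap P A N m t) ->
  exists w1 w3, [/\ rank1 (prodA A N w1), rank1 (prodA A N w3) &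
    forall m, phase_gap P A N m t w1 w3 = 0].
Proof.
move=> h.
have mR := measurable_rank1 d0 tA mA N.
have J0 m : Ex P (outer_gap P A N m t) = 0.
  apply/eqP; rewrite eq_le leNgt; apply/andP; split; first exact/negP/h.
  exact: (mean_gap_ge0 P d0 tA mA).
have ae1 : {ae P, forall w1 m, outer_gap P A N m t w1 = 0}.
  apply/ae_foralln => m; apply: Ex_eq0_ae (J0 m); first exact: (bm_outer_gap P d0 tA mA).
  by move=> w1; apply: Ex_ge0 => w3; exact: (RRD_ge0 P d0 tA mA).
have [w1 r1 h1] := positive_ae_ex mR PN ae1.
have ae3 : {ae P, forall w3 m, rank1_ind A N w1 * rank1_ind A N w3 * phase_gap P A N m t w1 w3 = 0}.
  apply/ae_foralln => m; apply: Ex_eq0_ae (h1 m); first exact: (bm_RRD1 P d0 tA mA).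
  by move=> w3; exact: (RRD_ge0 P d0 tA mA).
have [w3 r3 h3] := positive_ae_ex mR PN ae3.
exists w1, w3; split => // m; have := h3 m.
by rewrite /rank1_ind !indicE (mem_set r1) (mem_set r3) !mul1r.
Qed.

(* A vanishing [phase_gap] means that the phase is almost surely constant modulo [2 pi / t]. *)
Lemma lattice_phase t : (forall m, ~ 0 < mean_gap P A N m t) ->
  exists (Th : V -> V) (v : V) (beta : nat -> R), [/\ topical_op Th, rank1 Th &
    forall m, Ex P (fun w => cos (t * vmax (Th (prodA A m w v)) - beta m)) = 1].
Proof.
move=> /lattice_outer_blocks[w1 [w3 [_ r3 D0]]].
exists (prodA A N w3), (prodA A N w1 0).
suff /choice[beta hb] : forall m, exists b : R,
    Ex P (fun w => cos (t * vmax (prodA A N w3 (prodA A m w (prodA A N w1 0))) - b)) = 1.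
  by exists beta; split => //; exact: topical_prodA.
move=> m; have := D0 m.
set C := phase_cos P A N m t w1 w3; set S := phase_sin P A N m t w1 w3; rewrite /phase_gap -/C -/S => E.
have CS : C ^+ 2 + S ^+ 2 = 1 by move: E; lra.
have [b [Cb Sb]] := polar C S; exists b.
move: Cb Sb; rewrite CS sqrtr1 !mul1r => Cb Sb.
under eq_fun do rewrite cosB.
have mW : measurable_fun setT (fun w => t * block_phase A N m w1 w3 w).
  by apply: measurable_funM; [exact: measurable_cst|exact: (measurable_block_phase d0 tA mA)].
have bc := bm_cos mW; have bs := bm_sin mW.
rewrite ExD; [|by apply: bmM => //; exact: bm_cst..].
by rewrite !ExZr//= -/(phase_cos P A N m t w1 w3) -/(phase_sin P A N m t w1 w3) -/C -/S -Cb -Sb -!expr2.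
Qed.

(** * The spectral hypothesis: iterates of [Qt] *)

Section SpectralCase.
Variable phi : V -> R.
Hypothesis tphi : topical_fun phi.
Local Notation Qt := (Qt P A phi).

(** With [twist'], the real and imaginary parts of [exp (i t (phi x - c)) (f1 x + i f2 x)]. *)
Let twist (t c : R) (f1 f2 : V -> R) (x : V) :=
  cos (t * (phi x - c)) * f1 x - sin (t * (phi x - c)) * f2 x.

Let twist' (t c : R) (f1 f2 : V -> R) (x : V) :=
  cos (t * (phi x - c)) * f2 x + sin (t * (phi x - c)) * f1 x.

Let mphi : measurable_fun setT (phi : VB R d -> R).
Proof. by apply: VB_cont_real; exact: topical_fun_cont. Qed.

Let mph t c : measurable_fun setT (fun x : VB R d => t * (phi x - c)).
Proof.
apply: measurable_funM; first exact: measurable_cst.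
by apply: measurable_funB => //; exact: measurable_cst.
Qed.

Lemma bm_twist t c f1 f2 : bm (f1 : VB R d -> R) -> bm (f2 : VB R d -> R) ->
  bm (twist t c f1 f2 : VB R d -> R).
Proof. by move=> b1 b2; apply: bmB; apply: bmM => //; [exact: bm_cos|exact: bm_sin]. Qed.

Lemma bm_twist' t c f1 f2 : bm (f1 : VB R d -> R) -> bm (f2 : VB R d -> R) ->
  bm (twist' t c f1 f2 : VB R d -> R).
Proof. by move=> b1 b2; apply: bmD; apply: bmM => //; [exact: bm_cos|exact: bm_sin]. Qed.

Lemma iter_Pop_lin n (a b : R) (F G : VB R d -> R) y : bm F -> bm G ->
  iter n Pop (fun x => a * F x + b * G x) y = a * iter n Pop F y + b * iter n Pop G y.
Proof.
move=> bF bG; rewrite !(iter_PopE tA mA n y iX)//; last by apply: bmD; exact: bmZ.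
have bA (H : VB R d -> R) : bm H -> bm (fun w => H (prodA A n w y)).
  by move=> bH; exact: (bm_comp bH (measurable_prodA tA mA n y)).
have bFA := bA _ bF; have bGA := bA _ bG.
rewrite ExD; [|exact: (bmZ a bFA)|exact: (bmZ b bGA)].
by rewrite (ExZ _ a bFA) (ExZ _ b bGA).
Qed.

(** The increments of [phi] along a trajectory telescope, so only its values at both ends appear in
    the phase. *)
Lemma iter_Qt t n (f1 f2 : V -> R) z : bm (f1 : VB R d -> R) -> bm (f2 : VB R d -> R) ->
  iter n (Qt t) (fun z => Complex (f1 (z.1 z.2)) (f2 (z.1 z.2))) z =
  Complex (iter n Pop (twist t (phi (z.1 z.2)) f1 f2) (z.1 z.2))
          (iter n Pop (twist' t (phi (z.1 z.2)) f1 f2) (z.1 z.2)).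
Proof.
move=> b1 b2; elim: n z => [|n IH] z /=.
  by rewrite /twist /twist' subrr mulr0 cos0 sin0 !mul1r !mul0r subr0 addr0.
rewrite /Defs.Qt /cEx; set y := z.1 z.2.
have h w := IH (A 1%N w, y); rewrite /= in h.
have key w a b : a = phi (A 1%N w y) ->
    t * (a - b) = t * (phi (A 1%N w y) - b) by move=> ->.
congr Complex; rewrite /Pop; congr Ex; apply/funext => w; rewrite h /expi /=.
  rewrite -mulNr -iter_Pop_lin; [|exact: bm_twist|exact: bm_twist'].
  congr (iter n _ _ _); apply/funext => x; rewrite /twist /twist'.
  have -> : t * (phi x - phi y) =
    t * (phi (A 1%N w y) - phi y) + t * (phi x - phi (A 1%N w y)) by ring.
  by rewrite cosD sinD; ring.
rewrite -iter_Pop_lin; [|exact: bm_twist'|exact: bm_twist].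
congr (iter n _ _ _); apply/funext => x; rewrite /twist /twist'.
have -> : t * (phi x - phi y) =
  t * (phi (A 1%N w y) - phi y) + t * (phi x - phi (A 1%N w y)) by ring.
by rewrite cosD sinD; ring.
Qed.

Lemma cnormE (a b : R) : cnorm (Complex a b) = Num.sqrt (a ^+ 2 + b ^+ 2).
Proof. by []. Qed.

Lemma cnorm_re (a b : R) : `|a| <= cnorm (Complex a b).
Proof. by rewrite cnormE -[`|a|]sqrtr_sqr ler_wsqrtr// lerDl sqr_ge0. Qed.

Lemma cnorm_im (a b : R) : `|b| <= cnorm (Complex a b).
Proof. by rewrite cnormE -[`|b|]sqrtr_sqr ler_wsqrtr// lerDr sqr_ge0. Qed.

Lemma cnorm_le (a b : R) : cnorm (Complex a b) <= `|a| + `|b|.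
Proof.
rewrite cnormE -[leRHS]ger0_norm ?addr_ge0// -[leRHS]sqrtr_sqr ler_wsqrtr//.
rewrite sqrrD !real_normK ?num_real// addrAC lerDl mulrn_wge0// mulr_ge0//.
Qed.

(** A crude bound, 2 for each of the real and imaginary parts. It makes the operator norms finite,
    so that the [fine] in [specrad] is their true value and not the default 0. *)
Lemma iter_Qt_bound t n (g : (V -> V) * V -> R[i]) : Binf g -> (supnorm g <= 1)%E ->
  (supnorm (iter n (Qt t) g) <= 4%:E)%E.
Proof.
move=> [f [cf1 [cf2 [[M fM] [_ ->]]]]] g1.
pose f1 x := complex.Re (f x); pose f2 x := complex.Im (f x).
have fE : (fun z : (V -> V) * V => f (z.1 z.2)) =
   (fun z => Complex (f1 (z.1 z.2)) (f2 (z.1 z.2))).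
  by apply/funext => z; rewrite /f1 /f2; case: (f _).
have f1b x : cnorm (f x) <= 1.
  rewrite -lee_fin; apply: le_trans g1; apply: ereal_sup_ubound.
  by exists (id, x) => //=; exact: topical_id.
have n1 x : `|f1 x| <= 1.
  by apply: le_trans (f1b x); rewrite /f1; case: (f x) => a b; exact: cnorm_re.
have n2 x : `|f2 x| <= 1.
  by apply: le_trans (f1b x); rewrite /f2; case: (f x) => a b; exact: cnorm_im.
have b1 : bm (f1 : VB R d -> R) by split; [exact: VB_cont_real|exists 1].
have b2 : bm (f2 : VB R d -> R) by split; [exact: VB_cont_real|exists 1].
have prod1 (a b : R) : `|a| <= 1 -> `|b| <= 1 -> `|a * b| <= 1.
  by move=> ha hb; rewrite normrM mulr_ile1.
have nt c x : `|twist t c f1 f2 x| <= 2.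
  rewrite (le_trans (ler_normB _ _))// mulr2n lerD// prod1//; [exact: cos_max|exact: sin_max].
have nt' c x : `|twist' t c f1 f2 x| <= 2.
  rewrite (le_trans (ler_normD _ _))// mulr2n lerD// prod1//; [exact: cos_max|exact: sin_max].
have itb (H : VB R d -> R) y : bm H -> (forall x, `|H x| <= 2) -> `|iter n Pop H y| <= 2.
  move=> bH hH; rewrite (iter_PopE tA mA n y iX)//; apply: Ex_bound => //.
  exact: (bm_comp bH (measurable_prodA tA mA n y)).
rewrite fE; apply: ge_ereal_sup => _ [z _ <-]; rewrite lee_fin iter_Qt//.
apply: (le_trans (cnorm_le _ _)).
have -> : 4 = 2 + 2 :> R by ring.
by rewrite lerD// itb//; [exact: bm_twist|exact: bm_twist'].
Qed.

(** An infimum below 1 in Gelfand's formula means that some power has operator norm below 1. *)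
Lemma spectral_contraction t : system_non_arithmetic P A phi -> t != 0 ->
  exists n, forall g, Binf g -> (supnorm g <= 1)%E ->
    forall z, Edom z -> cnorm (iter n (Qt t) g z) < 1.
Proof.
move=> [_ h] /h; rewrite /specrad => /inf_lt[].
  by exists (fine (opnorm (iter 1 (Qt t))) `^ 1%:R^-1), 1%N.
move=> _ [n /= n0 <-] pw; exists n => g Bg g1 z Ez.
have op4 : (opnorm (iter n (Qt t)) <= 4%:E)%E.
  by apply: ge_ereal_sup => _ [g' /= [Bg' g1'] <-]; exact: iter_Qt_bound.
have le1 : (supnorm (iter n (Qt t) g) <= opnorm (iter n (Qt t)))%E.
  by apply: ereal_sup_ubound; exists g.
have le2 : ((cnorm (iter n (Qt t) g z))%:E <= supnorm (iter n (Qt t) g))%E.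
  by apply: ereal_sup_ubound; exists z.
have le3 := le_trans le2 le1.
have opfin : opnorm (iter n (Qt t)) \is a fin_num.
  rewrite fin_numElt (lt_le_trans _ le3) ?ltNyr//=.
  by rewrite (le_lt_trans op4) ?ltry.
move: le3; rewrite -(fineK opfin) lee_fin => /le_lt_trans; apply.
rewrite ltNge; apply/negP => op1; move: pw; rewrite ltNge => /negP; apply.
apply: (@le_trans _ _ (1 `^ n%:R^-1)); first by rewrite powR1.
apply: ge0_ler_powR; rewrite ?nnegrE ?invr_ge0 ?ler0n ?ler01//.
exact: le_trans op1.
Qed.

(* Otherwise [g = exp (i t (psi - phi))], with [psi = vmax \o Th], has [|Q_t^m g| = 1] for all [m]
   at the point [v], while the spectral radius is below 1. *)
Lemma spectral_nonlattice : system_non_arithmetic P A phi -> nonlattice P A N.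
Proof.
move=> sna t tp; apply: contrapT => /forallNP /lattice_phase[Th [v [beta [tTh rTh hb]]]].
have [n hn] := spectral_contraction sna (lt0r_neq0 tp).
pose psi x := vmax (Th x).
have tpsi : topical_fun psi by apply: topical_fun_comp => //; exact: topical_vmax.
have cpsi := topical_fun_cont tpsi; have cphi := topical_fun_cont tphi.
pose th x := t * (psi x - phi x).
have cth : continuous th.
  apply: (@lip_continuous R V R^o (2 * `|t|)) => x y.
  rewrite /th -mulrBr normrM [2 * _]mulrC -mulrA ler_wpM2l//.
  have -> : psi x - phi x - (psi y - phi y) = (psi x - psi y) - (phi x - phi y) by ring.
  by rewrite (le_trans (ler_normB _ _))// mulr2n mulrDl mul1r lerD// topical_fun_lip.
have mth : measurable_fun setT (th : VB R d -> R) by exact: VB_cont_real.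
pose g (z : (V -> V) * V) := Complex (cos (th (z.1 z.2))) (sin (th (z.1 z.2))).
have Bg : Binf g.
  exists (fun x => Complex (cos (th x)) (sin (th x))); split.
    move=> x; have h := @continuous_comp V R R th cos x.
    by apply: h; [exact: cth|exact: continuous_cos].
  split.
    move=> x; have h := @continuous_comp V R R th sin x.
    by apply: h; [exact: cth|exact: continuous_sin].
  split; first by exists 1 => x; rewrite cnormE cos2Dsin2 sqrtr1.
  split => // x c; rewrite /th tpsi.2 tphi.2.
  by have -> : psi x + c - (phi x + c) = psi x - phi x by ring.
have g1 : (supnorm g <= 1)%E.
  by apply: ge_ereal_sup => _ [z _ <-]; rewrite lee_fin cnormE cos2Dsin2 sqrtr1.
have := hn g Bg g1 (id, v) topical_id.
rewrite (iter_Qt t n (f1 := cos \o th) (f2 := sin \o th))/=; last 2 first.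
- exact: bm_cos.
- exact: bm_sin.
have -> : twist t (phi v) (cos \o th) (sin \o th) = (fun x => cos (t * psi x - t * phi v)).
  apply/funext => x; rewrite /twist /= -cosD; congr cos; rewrite /th; ring.
have -> : twist' t (phi v) (cos \o th) (sin \o th) = (fun x => sin (t * psi x - t * phi v)).
  apply/funext => x; rewrite /twist' /= addrC -sinD; congr sin; rewrite /th; ring.
have mps c : measurable_fun setT (fun x : VB R d => t * psi x - c).
  apply: measurable_funB; last exact: measurable_cst.
  by apply: measurable_funM; [exact: measurable_cst|exact: VB_cont_real].
have bc := bm_cos (mps (t * phi v)); have bs := bm_sin (mps (t * phi v)).
rewrite !(iter_PopE tA mA n v iX)//.
set C := Ex _ _; set S := Ex _ _; apply/negP; rewrite -leNgt.
change (1 <= Num.sqrt (C ^+ 2 + S ^+ 2)).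
(* The angle from [t phi v] to the almost sure phase: the vector [(C, S)] rotated by [e] has first
   coordinate 1, so its norm is at least 1. *)
pose e := t * phi v - beta n.
have : cos e * C - sin e * S = 1.
  rewrite -(hb n) /C /S.
  have bA (H : VB R d -> R) : bm H -> bm (fun w => H (prodA A n w v)).
    by move=> bH; exact: (bm_comp bH (measurable_prodA tA mA n v)).
  have bcA := bA _ bc; have bsA := bA _ bs.
  rewrite -!ExZ// -ExB; [|exact: bmZ|exact: bmZ].
  congr Ex; apply/funext => w; rewrite -cosD; congr cos; rewrite /e /psi; ring.
move=> E1.
rewrite -[leLHS]sqrtr1 ler_wsqrtr//.
have := cos2Dsin2 e; have := sqr_ge0 (sin e * C + cos e * S) => h1 h2.
have : (C ^+ 2 + S ^+ 2) * (cos e ^+ 2 + sin e ^+ 2) = 1 + (sin e * C + cos e * S) ^+ 2.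
  by rewrite -[1](expr1n _ 2) -E1; ring.
by rewrite h2 mulr1 => ->; rewrite lerDl.
Qed.

End SpectralCase.
End Phase.

(** * The algebraic hypothesis: phases of words in the support *)

Section CosOne.
Context {R : realType}.

Lemma cosD_int (x : R) (z : int) : cos (x + 2 * pi * z%:~R) = cos x.
Proof.
have h n y : cos (y + (pi *+ 2) *+ n) = cos y :> R by exact: (periodicn (@cosD2pi R)).
case: z => n.
  rewrite -[in RHS](h n x); congr (cos (_ + _)).
  by rewrite -(mulr_natr (pi *+ 2)) -(mulr_natl pi 2).
rewrite NegzE -[in LHS](h n.+1); congr cos.
by rewrite -(mulr_natr (pi *+ 2)) -(mulr_natl pi 2) mulrNz -pmulrn; ring.
Qed.

Lemma cos_eq1 (x : R) : cos x = 1 -> exists z : int, x = 2 * pi * z%:~R.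
Proof.
move=> cx; have pi0 := pi_gt0 R.
have p20 : 0 < 2 * pi :> R by rewrite mulr_gt0.
pose z := Num.floor (x / (2 * pi)); exists z.
have /andP[z1 z2] := floor_itv (x / (2 * pi)).
move: z1 z2; rewrite -/z ler_pdivlMr// ltr_pdivrMr// intrD mulrDl mul1r => z1 z2.
pose r := x - 2 * pi * z%:~R.
have cr : cos r = 1.
  by rewrite -(cosD_int r z) /r subrK.
have r0 : 0 <= r by rewrite /r; lra.
have r2 : r < 2 * pi by rewrite /r; lra.
suff : r = 0 by rewrite /r; lra.
have [rpi|rpi] := leP r pi.
  by apply: cos_inj; rewrite ?in_itv/= ?r0 ?rpi ?lexx ?ltW// cr cos0.
have : 2 * pi - r = 0.
  apply: cos_inj; rewrite ?in_itv/= ?lexx ?(ltW pi0)//.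
    by apply/andP; split; lra.
  by rewrite cos0 -cosN -(cosD_int _ 1) -[RHS]cr; congr cos; rewrite mulr1; ring.
by move=> h; exfalso; lra.
Qed.

End CosOne.

Section Clamp.
Context {R : realType} {d : nat}.
Local Notation V := 'rV[R]_d.

(** The 1-Lipschitz retraction onto the ball of radius [k]. A condition on the ball becomes one on
    all of the space, testable at every grid point. *)
Definition clamp (k : R) (x : V) : V := \row_i Num.max (- k) (Num.min k (x ord0 i)).

Lemma clamp_norm k x : 0 <= k -> `|clamp k x| <= k.
Proof.
move=> k0; apply: norm_le_coord => // i; rewrite mxE ler_norml le_max lexx/=.
by rewrite ge_max ge_min lexx/= andbT; lra.
Qed.

Lemma clamp_id k x : `|x| <= k -> clamp k x = x.
Proof.
move=> xk; apply/rowP => i; rewrite mxE.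
have := le_trans (coord_le_norm x i) xk; rewrite ler_norml => /andP[h1 h2].
by rewrite (min_idPr h2) (max_idPr h1).
Qed.

Lemma clamp_lip k x y : `|clamp k x - clamp k y| <= `|x - y|.
Proof.
apply: norm_le_coord => // i; have := coord_le_norm (x - y) i; rewrite !mxE.
move: (x ord0 i) (y ord0 i) => a b; apply: le_trans.
by rewrite /Num.max /Num.min; do !case: ifPn; rewrite -?leNgt => *;
  rewrite ler_norml; have := ler_norm (a - b); have := ler_norm (b - a);
  rewrite (distrC b a) => *; apply/andP; split; lra.
Qed.

End Clamp.

Lemma compact_norm_ball {R : realType} {d : nat} (k : R) :
  compact [set x : 'rV[R]_d | `|x| <= k].
Proof.
apply: bounded_closed_compact.
  exists k; split => [|M kM x]; first by rewrite num_real.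
  by move=> /= /le_trans; apply; exact: ltW.
rewrite (_ : [set x | _] = (fun x : 'rV[R]_d => `|x|) @^-1` [set r | r <= k])//.
apply: closed_comp; last exact: closed_le.
move=> x _; apply: (@lip_continuous R 'rV[R]_d R^o 1) => y z.
by rewrite mul1r ler_dist_dist.
Qed.

Section SupportCase.
Context {R : realType} {d : nat} {dO : measure_display} {Omega : measurableType dO}.
Variable P : probability Omega R.
Variable A : nat -> Omega -> 'rV[R]_d -> 'rV[R]_d.
Variable X0 : Omega -> 'rV[R]_d.
Local Notation V := 'rV[R]_d.
Local Notation one := (@ones R d).
Hypothesis d0 : (0 < d)%N.
Hypothesis tA : forall n w, (0 < n)%N -> topical_op (A n w).
Hypothesis mA : forall n, (0 < n)%N -> measurable_fun setT (A n : Omega -> OpB R d).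
Hypothesis iX : indep P A X0.
Variable N : nat.
Hypothesis PN : (0 < P (rank1_event A N))%E.

Let supp := in_support P A.

Lemma measurable_dist n (x b : V) (e : R) : (0 < n)%N ->
  measurable [set w | `|A n w x - b| <= e].
Proof.
move=> n0.
have cf : continuous (fun y : V => `|y - b|).
  apply: (@lip_continuous R V R^o 1) => y z; rewrite mul1r.
  by rewrite (le_trans (ler_dist_dist _ _))// opprB addrA subrK.
have mf := measurableT_comp (VB_cont_real cf) (measurable_A mA x n0).
rewrite (_ : [set w | _] = (fun w => `|A n w x - b|) @^-1` `]-oo, e]); last first.
  by apply/seteqP; split => w /=; rewrite in_itv.
by rewrite -[X in measurable X]setTI; apply: mf.
Qed.

(** A strict inequality between continuous functions holds on a compact ball with a uniform margin
    [1 / (j + 1)]; with that margin it can be tested on the grid. *)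
Lemma support_ball_measurable (B : V -> V) (k e : R) : topical_op B -> 0 < k -> 0 < e ->
  measurable [set w | forall x : V, `|x| <= k -> `|A 1%N w x - B x| < e].
Proof.
move=> tB k0 e0.
pose dist w x := `|A 1%N w (clamp k x) - B (clamp k x)|.
have tA1 w : topical_op (A 1%N w) by exact: tA.
have ldist w x y : `|dist w x - dist w y| <= 2 * `|x - y|.
  rewrite /dist (le_trans (ler_dist_dist _ _))//.
  have -> : A 1%N w (clamp k x) - B (clamp k x) - (A 1%N w (clamp k y) - B (clamp k y)) =
    (A 1%N w (clamp k x) - A 1%N w (clamp k y)) - (B (clamp k x) - B (clamp k y)).
    by apply/rowP => i; rewrite !mxE; ring.
  rewrite (le_trans (ler_normB _ _))// mulr2n mulrDl mul1r lerD//.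
    by rewrite (le_trans (topical_op_lip _ _ (tA1 w)))// clamp_lip.
  by rewrite (le_trans (topical_op_lip _ _ tB))// clamp_lip.
rewrite (_ : [set w | _] = \bigcup_j \bigcap_m \bigcap_(z : {ffun 'I_d -> int})
    [set w | dist w (grid m z) <= e - j.+1%:R^-1]).
  apply: bigcupT_measurable => j; apply: bigcapT_measurable => m.
  by apply: bigcap_countType_measurable => z; exact: measurable_dist.
have inv_cvg : (fun k : nat => k.+1%:R^-1 : R) @ \oo --> (0 : R) := cvg_harmonic.
apply/seteqP; split => w /=.
  move=> h.
  have loc (x : V) : `|x| <= k -> exists2 r : R, 0 < r & exists J, forall (y : V) j,
      `|x - y| < r -> (J <= j)%N -> dist w y <= e - j.+1%:R^-1.
    move=> xk; pose g := e - dist w x.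
    have g0 : 0 < g by rewrite subr_gt0 /dist clamp_id// h.
    have g2 : 0 < g / 2 by rewrite divr_gt0.
    have /cvgrPdist_lt/(_ _ g2)[J _ hJ] := inv_cvg.
    exists (g / 4); first by rewrite divr_gt0.
    exists J => y j xy Jj.
    have := hJ j Jj; rewrite sub0r normrN ger0_norm// => hj.
    have := ldist w y x; rewrite (distrC y x) ler_norml => /andP[_ h2].
    move: xy hj h2; rewrite /g; move: (dist w y) (dist w x) `|x - y| j.+1%:R^-1 => a b n0 q; lra.
  have /compact_near_coveringP/(_ nat \oo
    (fun j x => dist w x <= e - j.+1%:R^-1) _) := @compact_norm_ball R d k.
  case.
    move=> x /= /loc[r r0 [J hJ]].
    exists ([set y | `|x - y| < r], [set j | (J <= j)%N]) => /=.
      split; first by apply: (nbhs_dist_lt r0).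
      by exists J.
    by move=> [y j] /= [xy Jj]; exact: hJ.
  move=> J _ hJ; exists J => // m _ z _ /=.
  have -> : dist w (grid m z) = dist w (clamp k (grid m z)).
    by rewrite /dist (@clamp_id _ _ _ (clamp _ _))// clamp_norm// ltW.
  by apply: hJ => //=; rewrite clamp_norm// ltW.
move=> [j _ h] x xk.
suff : dist w x <= e - j.+1%:R^-1.
  by rewrite /dist clamp_id// => /le_lt_trans; apply; rewrite ltrBlDr ltrDl.
apply/ler_addgt0Pr => r r0.
have r2 : 0 < r / 2 by rewrite divr_gt0.
have /cvgrPdist_lt/(_ _ r2)[J _ hJ] := inv_cvg.
have := hJ J (leqnn J); rewrite /= sub0r normrN ger0_norm// => hr.
have := h J I (gridf J x) I => /= h1.
have := ldist w x (grid J (gridf J x)); rewrite ler_norml => /andP[_ h2].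
have := grid_approx J x => h3.
move: hr h1 h2 h3; move: (dist w x) (dist w _) `|x - _| J.+1%:R^-1 j.+1%:R^-1 => a b n0 q q'; lra.
Qed.

Lemma support_eval (B : V -> V) (y : V) (e : R) : supp B -> 0 < e ->
  (0 < P [set w | (`|A 1%N w y - B y| <= e)%R])%E.
Proof.
move=> [tB hB] e0.
have k0 : 0 < `|y| + 1 by rewrite ltr_wpDl.
apply: (lt_le_trans (hB _ _ k0 e0)); apply: le_measure; rewrite ?inE.
- exact: support_ball_measurable.
- exact: measurable_dist.
by move=> w /= h; apply: ltW; apply: h; rewrite lerDl.
Qed.

(** The head of a word is the last map applied, as the newest factor in [prodA]; appending on the
    right changes the starting point. *)
Definition compose (s : seq (V -> V)) : V -> V := foldr (fun B acc => B \o acc) id s.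

Definition all_supp (s : seq (V -> V)) := forall B, Stdlib.Lists.List.In B s -> supp B.

Lemma compose_cat s1 s2 x : compose (s1 ++ s2) x = compose s1 (compose s2 x).
Proof. by elim: s1 => //= B s1 ->. Qed.

(** By induction on the word: the newest factor is independent of the past, and since it is
    nonexpansive the error made so far is not amplified. *)
Lemma support_compose s (v : V) (e : R) : all_supp s -> 0 < e ->
  (0 < P [set w | (`|prodA A (size s) w v - compose s v| <= e)%R])%E.
Proof.
elim: s e => [|B s IH] e hs e0.
  rewrite (_ : [set w | _] = setT) ?probability_setT//.
  by apply/seteqP; split => w //= _; rewrite subrr normr0 ltW.
have hB : supp B by apply: hs; left.
have hs' : all_supp s by move=> C Cs; apply: hs; right.
have e2 : 0 < e / 2 by rewrite divr_gt0.
set m := size s; set y := compose s v.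
pose D : set Omega := [set w | `|prodA A m w v - y| <= e / 2].
pose E : set (OpB R d) := [set F | `|F y - B y| <= e / 2].
have mdist (b : V) (r : R) : measurable ([set x | `|x - b| <= r] : set (VB R d)).
  have cf : continuous (fun y : V => `|y - b|).
    apply: (@lip_continuous R V R^o 1) => u z; rewrite mul1r.
    by rewrite (le_trans (ler_dist_dist _ _))// opprB addrA subrK.
  rewrite (_ : [set x | _] = (fun x => `|x - b|) @^-1` `]-oo, r]); last first.
    by apply/seteqP; split => x /=; rewrite in_itv.
  by rewrite -[X in measurable X]setTI; apply: (VB_cont_real cf).
have mE : measurable E.
  by have := eval_measurable y measurableT (mdist (B y) (e / 2)); rewrite setTI.
have iv := indep_cst v iX.
have mD : measurable (D : set (past A (fun=> v) m)).
  have mx : measurable_fun setT (xn A (fun=> v) m : past A (fun=> v) m -> VB R d).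
    by apply: measurable_xn_past.
  by have := mx measurableT _ (mdist y (e / 2)); rewrite setTI.
have PE : (0 < P (A m.+1 @^-1` E))%E.
  rewrite (same_law iv (ltn0Sn m) mE); exact: support_eval.
have PDE := past_indep mA (measurable_cst (v : VB R d)) iv mD mE.
have pos : (0 < P (D `&` A m.+1 @^-1` E))%E.
  by rewrite PDE; apply: mule_gt0 => //; exact: IH.
apply: (lt_le_trans pos); apply: le_measure; rewrite ?inE.
- apply: measurableI; last by rewrite -[X in measurable X]setTI; exact: mA.
  have := measurable_prodA tA mA m v measurableT (mdist y (e / 2)).
  by rewrite setTI.
- have := measurable_prodA tA mA m.+1 v measurableT (mdist (compose (B :: s) v) e).
  by rewrite setTI.
move=> w [/= h1 h2]; rewrite -/m -/y.
rewrite -(subrKA (A m.+1 w y)) (le_trans (ler_normD _ _))// (splitr e) lerD//.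
by rewrite (le_trans (topical_op_lip _ _ (tA w (ltn0Sn m)))).
Qed.

(** [h] vanishes almost surely at the random product, which comes arbitrarily close to [compose s v]
    with positive probability. *)
Lemma support_phase (h : V -> R) m (v : V) s : continuous h -> bm (h : VB R d -> R) ->
  (forall x, 0 <= h x) -> Ex P (fun w => h (prodA A m w v)) = 0 ->
  all_supp s -> size s = m -> h (compose s v) = 0.
Proof.
move=> ch bh h0 Eh hs sm.
have ae := Ex_eq0_ae (bm_comp bh (measurable_prodA tA mA m v)) (fun w => h0 _) Eh.
apply/eqP; rewrite eq_le h0 andbT leNgt; apply/negP => hp.
have /cvgrPdist_lt/(_ _ hp)/nbhs_ballP[r /= r0 hr] := ch (compose s v).
have r2 : 0 < r / 2 by rewrite divr_gt0.
have pos := support_compose v hs r2.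
have mdist : measurable [set w | `|prodA A (size s) w v - compose s v| <= r / 2].
  have cf : continuous (fun y : V => `|y - compose s v|).
    apply: (@lip_continuous R V R^o 1) => u z; rewrite mul1r.
    by rewrite (le_trans (ler_dist_dist _ _))// opprB addrA subrK.
  have mf := measurableT_comp (VB_cont_real cf) (measurable_prodA tA mA (size s) v).
  rewrite (_ : [set w | _] = (fun w => `|prodA A (size s) w v - compose s v|) @^-1` `]-oo, r / 2]).
    by rewrite -[X in measurable X]setTI; apply: mf.
  by apply/seteqP; split => w /=; rewrite in_itv.
have [w hw hz] := positive_ae_ex mdist pos ae.
have : `|h (compose s v) - h (prodA A (size s) w v)| < h (compose s v).
  apply: hr; rewrite -ball_normE/= distrC (le_lt_trans hw)//; lra.
by rewrite sm hz subr0 ger0_norm// ltxx.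
Qed.

(* Words of equal length in the support have the same phase modulo [2 pi / t].  Padding both sides
   with powers of [B0] makes the lengths of [B o s] and [B0 o s0] equal, which gives the
   arithmetic constants [u (B0 :: s0) - u s0] and [2 pi / t]. *)
Lemma support_nonlattice : alg_non_arithmetic P A -> nonlattice P A N.
Proof.
move=> nar t tp; apply: contrapT => /forallNP.
move=> /(lattice_phase d0 tA mA PN)[Th [v [beta [tTh rTh hb]]]].
apply: nar.
pose psi x := vmax (Th x).
have tpsi : topical_fun psi by apply: topical_fun_comp => //; exact: topical_vmax.
pose u s := psi (compose s v).
have phase s : all_supp s -> cos (t * u s - beta (size s)) = 1.
  move=> hs.
  pose h x := 1 - cos (t * psi x - beta (size s)).
  have cth : continuous (fun x => t * psi x - beta (size s)).
    apply: (@lip_continuous R V R^o `|t|) => x y.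
    rewrite opprB addrA subrK -mulrBr normrM ler_wpM2l//; exact: topical_fun_lip.
  have ch : continuous h.
    have cg : continuous (fun r : R => 1 - cos r).
      by move=> r; apply: cvgB; [exact: cvg_cst|exact: continuous_cos].
    move=> x.
    have k := @continuous_comp V R R (fun x => t * psi x - beta (size s)) (fun r => 1 - cos r) x.
    by apply: k; [exact: cth|exact: cg].
  have bc : bm ((fun x => cos (t * psi x - beta (size s))) : VB R d -> R).
    by apply: bm_cos; exact: (VB_cont_real cth).
  have bh : bm (h : VB R d -> R) by apply: bmB => //; exact: bm_cst.
  have h0 x : 0 <= h x by rewrite subr_ge0 cos_le1.
  have Eh : Ex P (fun w => h (prodA A (size s) w v)) = 0.
    rewrite ExB; [|exact: bm_cst|exact: (bm_comp bc (measurable_prodA tA mA _ v))].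
    by rewrite Ex_cst (hb (size s)) subrr.
  have := support_phase ch bh h0 Eh hs erefl; rewrite /h -/(u s); lra.
have same s s' : all_supp s -> all_supp s' -> size s = size s' ->
    exists z : int, u s - u s' = 2 * pi / t * z%:~R.
  move=> hs hs' ss.
  have c1 := phase _ hs; have c2 := phase _ hs'.
  have [z1 h1] := cos_eq1 c1; have [z2 h2] := cos_eq1 c2.
  exists (z1 - z2); rewrite intrB.
  have : t * (u s - u s') = 2 * pi * (z1%:~R - z2%:~R) by rewrite mulrBr mulrBr -h1 -h2 ss; ring.
  move=> E; apply: (mulfI (lt0r_neq0 tp)); rewrite E; field; exact: lt0r_neq0.
have catE s s' : all_supp s -> all_supp s' -> all_supp (s ++ s').
  move=> h h' B Bs; case: (Stdlib.Lists.List.in_app_or _ _ _ Bs); [exact: h|exact: h'].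
have nseqE k B : supp B -> all_supp (nseq k B).
  by move=> hB; elim: k => //= k IH C [<-//|]; exact: IH.
have consE B s : supp B -> all_supp s -> all_supp (B :: s).
  by move=> hB hs C [<-//|]; exact: hs.
(* As [compose s] has rank one, changing its starting point by [s'] only shifts its value by a
   multiple of [ones], which cancels in the difference. *)
have diffE B s s' : supp B -> all_supp s -> rank1 (compose s) ->
    u (B :: (s ++ s')) - u (s ++ s') = u (B :: s) - u s.
  move=> [tB _] hs rs; rewrite /u /= compose_cat.
  have [c ->] := rs (compose s' v) v.
  by rewrite tB.2 !tpsi.2; ring.
have [[B0 [s0 [hB0 [hs0 rs0]]]]|none] := pselect (exists B0 s0,
  supp B0 /\ all_supp s0 /\ rank1 (compose s0)); last first.
  (* Without a rank-one word the arithmetic condition is vacuous, and the constants are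
     arbitrary. *)
  exists 0, 0, Th; split => //; split => // B hB th' [s _ [hs ->]] rs.
  by exfalso; apply: none; exists B, s.
exists (u (B0 :: s0) - u s0), (2 * pi / t), Th; split => //; split => //.
move=> B hB th' [s _ [hs ->]] rs x.
set s1 := s ++ nseq (size s0) B0; set s2 := s0 ++ nseq (size s) B0.
have hs1 : all_supp s1 by apply: catE => //; exact: nseqE.
have hs2 : all_supp s2 by apply: catE => //; exact: nseqE.
have sz : size s1 = size s2 by rewrite !size_cat !size_nseq addnC.
have szS : size (B :: s1) = size (B0 :: s2) by rewrite /= sz.
have [z1 hz1] := same _ _ (consE _ _ hB hs1) (consE _ _ hB0 hs2) szS.
have [z2 hz2] := same _ _ hs1 hs2 sz.
have e1 := diffE B s (nseq (size s0) B0) hB hs rs.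
have e2 := diffE B0 s0 (nseq (size s) B0) hB0 hs0 rs0.
exists (z1 - z2).
have E : u (B :: s) - u s = u (B0 :: s0) - u s0 + 2 * pi / t * (z1 - z2)%:~R.
  rewrite -e1 -e2 intrB mulrBr -hz1 -hz2 /s1 /s2; ring.
rewrite -E.
change (Th (B (compose s x)) - Th (compose s x) = (u (B :: s) - u s) *: one).
have [c hc] : peq (compose s x) (compose s v) := rs x v.
rewrite hc hB.1.2 !tTh.2.
(* [Th] has rank one, so its values are determined by their height [psi]. *)
have key a b : Th a = Th b + (psi a - psi b) *: one.
  rewrite [LHS](prE _) (rank1_pr d0 a b rTh) /pr -/(psi a) -/(psi b).
  by apply/rowP => i; rewrite !mxE; ring.
rewrite (key (B (compose s v)) (compose s v)).
rewrite -[u (B :: s)]/(psi (B (compose s v))) -[u s]/(psi (compose s v)).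
by apply/rowP => i; rewrite !mxE; ring.
Qed.

End SupportCase.

(** * Fejer kernels *)

Section RealAnalysis.
Context {R : realType}.
Local Notation mu := (@lebesgue_measure R).
Implicit Types (f g F : R -> R) (a b x y t K : R).

(** This and the next rules are stated on explicit functions of [t], so that derivatives of concrete
    formulas are assembled as terms and compared at the end by [field]. *)
Lemma deriv_add f g x p q : is_derive x 1 f p -> is_derive x 1 g q ->
  is_derive x 1 (fun t => f t + g t) (p + q).
Proof. exact: is_deriveD. Qed.

Lemma deriv_mul f g x p q : is_derive x 1 f p -> is_derive x 1 g q ->
  is_derive x 1 (fun t => f t * g t) (f x * q + g x * p).
Proof. exact: is_deriveM. Qed.

Lemma deriv_comp f g x p q : is_derive (g x) 1 f p -> is_derive x 1 g q ->
  is_derive x 1 (fun t => f (g t)) (p * q).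
Proof. by move=> df dg; apply: is_derive_eq (is_derive1_comp df dg) _; rewrite mulrC. Qed.

Lemma deriv_cst (c : R) x : is_derive x 1 (fun=> c) 0.
Proof. exact: is_derive_cst. Qed.

Lemma deriv_id x : is_derive x 1 (fun t => t) 1.
Proof. exact: is_derive_id. Qed.

Lemma deriv_lin (c : R) x : is_derive x 1 (fun t => t * c) c.
Proof. by apply: is_derive_eq (deriv_mul (deriv_id x) (deriv_cst c x)) _; rewrite mulr0 add0r mulr1. Qed.

Lemma deriv_inv g x q : g x != 0 -> is_derive x 1 g q ->
  is_derive x 1 (fun t => (g t)^-1) (- q / g x ^+ 2).
Proof.
move=> g0 [dg gE]; split; first exact: derivableV.
by rewrite deriveV// gE /GRing.scale/= mulrC mulrN mulNr.
Qed.

Lemma deriv_cont f x p : is_derive x 1 f p -> {for x, continuous f}.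
Proof. by move=> [df _]; apply: differentiable_continuous; exact/derivable1_diffP. Qed.

Lemma derive_lip f (df : R -> R) (M : R) : (forall x, is_derive x 1 f (df x)) ->
  (forall x, `|df x| <= M) -> forall x y, `|f x - f y| <= M * `|x - y|.
Proof.
move=> dfE dfM.
suff h x y : x <= y -> `|f y - f x| <= M * `|y - x|.
  by move=> x y; have [xy|/ltW xy] := leP y x; [exact: h|rewrite distrC [`|x - y|]distrC; exact: h].
move=> xy.
have cf : {within `[x, y], continuous f}.
  by apply: continuous_subspaceT => z; exact: deriv_cont (dfE z).
have [c _ ->] := MVT_segment xy (fun z _ => dfE z) cf.
by rewrite normrM ler_wpM2r.
Qed.

Lemma sin_le_norm x : `|sin x| <= `|x|.
Proof.
have := derive_lip (fun x => is_derive_sin x) (@cos_max R) x 0.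
by rewrite sin0 !subr0 mul1r.
Qed.

Lemma cos_lip x y : `|cos x - cos y| <= `|x - y|.
Proof.
rewrite -[leRHS]mul1r.
apply: (derive_lip (fun x => is_derive_cos x)) => z; rewrite normrN; exact: sin_max.
Qed.

Lemma ftc f F a b : a <= b -> (forall x, a <= x <= b -> is_derive x 1 F (f x)) ->
  (forall x, a <= x <= b -> {for x, continuous f}) ->
  \int[mu]_(x in `[a, b]) f x = F b - F a.
Proof.
rewrite le_eqVlt => /predU1P[->|ab] dF cf.
  by rewrite set_itv1 Rintegral_set1 subrr.
rewrite /Rintegral (@continuous_FTC2 _ f F a b ab).
- by rewrite -EFinB.
- by apply: continuous_in_subspaceT => x /[!inE]/=; rewrite in_itv/=; exact: cf.
- split.
  + by move=> x; rewrite in_itv/= => /andP[h1 h2]; have [] := dF x; rewrite ?ltW.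
  + have [da _] := dF a ltac:(by rewrite lexx ltW).
    apply: cvg_at_right_filter.
    by have /derivable1_diffP/differentiable_continuous := da.
  + have [da _] := dF b ltac:(by rewrite lexx andbT ltW).
    apply: cvg_at_left_filter.
    by have /derivable1_diffP/differentiable_continuous := da.
- move=> x; rewrite in_itv/= => /andP[h1 h2].
  by have [_ <-] := dF x ltac:(by rewrite !ltW); rewrite derive1E.
Qed.

Lemma bs_integrable f (M a b : R) : measurable_fun setT f ->
  (forall r, `|f r| <= M * \1_(`[a, b]%classic) r) -> mu.-integrable setT (EFin \o f).
Proof.
move=> mf fM.
apply: (@le_integrable _ _ _ mu setT measurableT _
  (fun r => M%:E * (\1_(`[a, b]%classic) r)%:E)%E).
- exact/measurable_EFinP.
- by move=> r _ /=; rewrite lee_fin (le_trans (fM r))// ler_norm.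
- by apply: integrableZl => //; exact: integrable_indic_itv.
Qed.

(** Reflection exchanges the open and closed ends of an interval but keeps its length; Lebesgue
    measure is determined by half-open intervals. *)
Lemma mu_reflect (c : R) (D : set (measurableTypeR R)) : measurable D ->
  mu ((fun r : measurableTypeR R => c - r : measurableTypeR R) @^-1` D) = mu D.
Proof.
have mc : measurable_fun setT (fun r : measurableTypeR R => c - r : measurableTypeR R).
  by apply: (@measurable_funB _ _ R) => //; exact: measurable_cst.
move=> mD; apply/esym.
have := @lebesgue_measure_unique R (pushforward mu (mfun_of mc)).
apply => // _ [[a b] _ <-] /=.
rewrite /pushforward /=.
rewrite (_ : (fun r => c - r) @^-1` `]a, b] = `[c - b, c - a[%classic); last first.
  apply/seteqP; split => r /=; rewrite !in_itv/= => /andP[h1 h2]; apply/andP; split; lra.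
rewrite !lebesgue_measure_itv/= !lte_fin.
have -> : (c - b < c - a) = (a < b) by apply/idP/idP => h; lra.
by case: ifP => // _; rewrite -!EFinB; congr EFin; ring.
Qed.

Lemma measurable_reflect (c : R) :
  measurable_fun setT (fun r : measurableTypeR R => c - r : measurableTypeR R).
Proof. by apply: (@measurable_funB _ _ R) => //; exact: measurable_cst. Qed.

Lemma integrable_reflect (c : R) f : mu.-integrable setT (EFin \o f) ->
  mu.-integrable setT (EFin \o (fun r => f (c - r))).
Proof.
move=> /integrableP[mE foo]; apply/integrableP; split.
  exact: (measurableT_comp mE (measurable_reflect c)).
apply: le_lt_trans foo; rewrite le_eqVlt; apply/orP; left; apply/eqP.
have mA : measurable_fun setT (fun x => `|(EFin \o f) x|)%E by exact: measurableT_comp.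
have := @ge0_integral_pushforward _ _ _ _ R _ (measurable_reflect c) mu setT _ measurableT mA.
move=> <-; last by move=> x _; exact: abse_ge0.
apply: eq_measure_integral; first exact: measurable_reflect.
move=> mf D mD _.
exact: mu_reflect.
Qed.

Lemma Rint_reflect (c : R) f : mu.-integrable setT (EFin \o f) ->
  \int[mu]_r f (c - r) = \int[mu]_r f r.
Proof.
move=> intf; have [mE _] := integrableP _ _ _ intf.
rewrite /Rintegral; congr fine.
have := @integral_pushforward _ _ _ _ R _ (measurable_reflect c) mu setT (EFin \o f) mE
  (integrable_reflect c intf) measurableT.
move=> <-.
apply: eq_measure_integral; first exact: measurable_reflect.
move=> mf D mD _.
exact: mu_reflect.
Qed.

(** A translation is the composite of two reflections. *)
Lemma Rint_shift (c : R) f : mu.-integrable setT (EFin \o f) ->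
  \int[mu]_r f (r + c) = \int[mu]_r f r.
Proof.
move=> intf.
transitivity (\int[mu]_r (fun r => f (0 - r)) (- c - r)).
  by apply: eq_Rintegral => r _; rewrite sub0r opprB opprK.
by rewrite (Rint_reflect (- c) (integrable_reflect 0 intf)) Rint_reflect.
Qed.

(** The averaging window. It is left unnormalized, with mass [a^2], so that it is 1-Lipschitz
    whatever [a]. *)
Definition tent a x := Num.max 0 (a - `|x|).

Lemma tent_ge0 a x : 0 <= tent a x. Proof. by rewrite le_max lexx. Qed.

Lemma tent_lip a x y : `|tent a x - tent a y| <= `|x - y|.
Proof.
have h := ler_dist_dist x y; move: h; rewrite /tent.
move: (`|x|) (`|y|) `|x - y| => u v w; rewrite /Num.max.
by rewrite ler_norml => /andP[h1 h2]; do !case: ifPn; rewrite -?leNgt => *; rewrite ler_norml;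
  apply/andP; split; lra.
Qed.

Lemma tent_out a x : a <= `|x| -> tent a x = 0.
Proof. by move=> h; apply/max_idPl; lra. Qed.

Lemma tent_le a x : 0 <= a -> tent a x <= a.
Proof. by move=> a0; rewrite ge_max a0/= gerBl. Qed.

Lemma measurable_tent a : measurable_fun setT (tent a).
Proof.
apply: continuous_measurable_fun; apply: (@lip_continuous R R^o R^o 1) => x y.
by rewrite mul1r tent_lip.
Qed.

Lemma tent_le_indic a x : 0 <= a -> `|tent a x| <= a * \1_(`[(- a)%R, a]%classic) x.
Proof.
move=> a0; rewrite ger0_norm ?tent_ge0// indicE.
have [xa|xa] := leP `|x| a.
  rewrite mem_set ?mulr1 ?tent_le//=; rewrite in_itv/=.
  by rewrite -ler_norml.
by rewrite (tent_out (ltW xa)) mulr_ge0 ?ler0n.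
Qed.

Lemma tent_integrable a : 0 <= a -> mu.-integrable setT (EFin \o tent a).
Proof.
move=> a0; apply: (@bs_integrable _ a (- a) a); first exact: measurable_tent.
by move=> r; exact: tent_le_indic.
Qed.

Lemma tent_integral a : 0 <= a -> \int[mu]_x tent a x = a ^+ 2.
Proof.
move=> a0.
pose f (x : R) : R := tent a x * \1_(`[0%R, a]%classic) x.
pose g (x : R) : R := tent a x * \1_(`]0%R, a]%classic) x.
have ind01 (D : set R) x : 0 <= (\1_D x : R) <= 1.
  by rewrite indicE; case: (_ \in _); rewrite ?lexx ler01.
have itI (D : set R) : measurable D -> mu.-integrable setT (EFin \o (fun x => tent a x * \1_D x)).
  move=> mD; apply: (@bs_integrable _ a (- a) a).
    by apply: measurable_funM; [exact: measurable_tent|exact: measurable_indic].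
  move=> r; apply: le_trans (tent_le_indic r a0).
  have /andP[h1 h2] := ind01 D r.
  by rewrite normrM (ger0_norm h1) -[leRHS]mulr1 ler_wpM2l.
have mfg (D : set R) : measurable D -> measurable_fun setT (fun x => tent a x * \1_D x).
  by move=> mD; apply: measurable_funM; [exact: measurable_tent|exact: measurable_indic].
(* The interval in [g] is open at 0, so that the centre is counted once. *)
have E x : tent a x = f x + g (0 - x).
  rewrite /f /g !indicE !mem_setE/= !in_itv/= sub0r oppr_gt0.
  have tN : tent a (- x) = tent a x by rewrite /tent normrN.
  rewrite tN.
  have [x0|x0] := ltP x 0; rewrite /= ?mulr0 ?add0r ?addr0.
    have [xa|xa] := leP (- x) a; rewrite ?mulr1// mulr0 tent_out// ltr0_norm//; exact: ltW.
  have [xa|xa] := leP x a; rewrite ?mulr1// mulr0 tent_out// ger0_norm//; exact: ltW.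
have If : \int[mu]_x f x = a ^+ 2 / 2.
  transitivity (\int[mu]_(x in `[0, a]) (a - x)).
    rewrite [RHS]Rintegral_mkcond; apply: eq_Rintegral => x _.
    rewrite /f indicE patchE mem_setE/= in_itv/=; case: ifPn => [/andP[x0 xa]|_]; last by rewrite mulr0.
    by rewrite mulr1 /tent ger0_norm//; apply/max_idPr; lra.
  have dF x : 0 <= x <= a -> is_derive x 1 (fun t => t * a + (- 2^-1) * (t * t)) (a - x).
    move=> _; apply: is_derive_eq (deriv_add (deriv_lin a x) (deriv_mul (deriv_cst (- 2^-1) x) (deriv_mul (deriv_id x) (deriv_id x)))) _.
    by field.
  have cF x : 0 <= x <= a -> {for x, continuous (fun t => a - t)}.
    by move=> _; apply: cvgB; [exact: cvg_cst|exact: cvg_id].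
  by rewrite (ftc a0 dF cF); field.
have Ig : \int[mu]_x g x = a ^+ 2 / 2.
  rewrite -If; transitivity (\int[mu]_(x in `]0%R, a]) tent a x).
    rewrite [RHS]Rintegral_mkcond; apply: eq_Rintegral => x _.
    by rewrite /g indicE patchE; case: ifPn => _; rewrite ?mulr1 ?mulr0.
  rewrite Rintegral_itv_obnd_cbnd; last first.
    by apply: integrableS (tent_integrable a0).
  rewrite [LHS]Rintegral_mkcond; apply: eq_Rintegral => x _.
  by rewrite /f indicE patchE; case: ifPn => _; rewrite ?mulr1 ?mulr0.
have mg : measurable_fun setT g by exact: mfg.
have ig : mu.-integrable setT (EFin \o g) by exact: itI.
transitivity (\int[mu]_x (f x + g (0 - x))); first by apply: eq_Rintegral => x _; exact: E.
rewrite RintegralD//; [|exact: itI|].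
  by rewrite If (Rint_reflect 0 ig) Ig -splitr.
have -> : (EFin \o (fun x => g (0 - x))) = EFin \o (fun x => tent a x * \1_(`[(- a)%R, 0%R[%classic) x).
  apply/funext => x /=; rewrite /g !indicE !mem_setE/= !in_itv/= sub0r oppr_gt0 lerNl andbC.
  by rewrite /tent normrN.
exact: itI.
Qed.

End RealAnalysis.

Section Fejer.
Context {R : realType}.
Local Notation mu := (@lebesgue_measure R).
Implicit Types (a b x y t K c : R).

(* Its cosine transform is the Fejer kernel. *)
Definition triangle K t : R := (1 - t / K) * \1_(`[0%R, K]%classic) t.

Lemma measurable_triangle K : measurable_fun setT (triangle K).
Proof.
apply: measurable_funM; last exact: measurable_indic.
apply: measurable_funB; first exact: measurable_cst.
by apply: measurable_funM => //; exact: measurable_cst.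
Qed.

Lemma triangle_bound K t : 0 < K -> 0 <= triangle K t <= \1_(`[0%R, K]%classic) t.
Proof.
move=> K0; rewrite /triangle indicE mem_setE/= in_itv/=.
case: (boolP (0 <= t <= K)) => [/andP[t0 tK]|_]; last by rewrite mulr0 lexx.
by rewrite mulr1 subr_ge0 ler_pdivrMr// mul1r tK/= lerBlDr lerDl divr_ge0// ltW.
Qed.

Lemma triangle_norm K t : 0 < K -> `|triangle K t| <= \1_(`[0%R, K]%classic) t.
Proof. by move=> /(triangle_bound t)/andP[h1 h2]; rewrite ger0_norm. Qed.

Lemma triangle_mul_integrable K (f : R -> R) (M : R) : 0 < K -> measurable_fun setT f ->
  (forall t, `|f t| <= M) -> mu.-integrable setT (EFin \o (fun t => triangle K t * f t)).
Proof.
move=> K0 mf fM; apply: (@bs_integrable _ _ M 0 K).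
  by apply: measurable_funM => //; exact: measurable_triangle.
by move=> r; rewrite normrM mulrC ler_pM//; exact: triangle_norm.
Qed.

Definition fejer K y : R := 2 * \int[mu]_t (triangle K t * cos (t * y)).

Lemma measurable_cos_mul y : measurable_fun setT (fun t : R => cos (t * y)).
Proof.
by case: (@bm_cos R _ (measurableTypeR R) (fun t : R => t * y)) => //;
  apply: measurable_funM => //; exact: measurable_cst.
Qed.

Lemma fejer_integrable K y : 0 < K ->
  mu.-integrable setT (EFin \o (fun t => triangle K t * cos (t * y))).
Proof.
move=> K0; apply: (triangle_mul_integrable (M := 1) K0); first exact: measurable_cos_mul.
by move=> t; exact: cos_max.
Qed.

Lemma fejer_itv K (f : R -> R) : \int[mu]_t (triangle K t * f t) =
  \int[mu]_(t in `[0, K]) ((1 - t / K) * f t).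
Proof.
rewrite [RHS]Rintegral_mkcond; apply: eq_Rintegral => t _.
by rewrite patchE /triangle indicE; case: ifPn => _; rewrite ?mulr1// mulr0 mul0r.
Qed.

(** The closed form of the kernel, multiplied out so as to include [y = 0]. Positivity and the decay
    [4 / (K y^2)] are read off it. *)
Lemma fejerE K y : 0 < K -> K * y ^+ 2 * fejer K y = 2 * (1 - cos (K * y)).
Proof.
move=> K0; have [->|y0] := eqVneq y 0.
  by rewrite expr0n/= !mulr0 mul0r cos0 subrr mulr0.
rewrite /fejer fejer_itv.
pose F t := (1 + t * (- K^-1)) * (sin (t * y) * y^-1) + cos (t * y) * (- (K * y ^+ 2)^-1).
have K1 := lt0r_neq0 K0.
have dF t : 0 <= t <= K -> is_derive t 1 F ((1 - t / K) * cos (t * y)).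
  move=> _.
  have ds : is_derive t 1 (fun t => sin (t * y)) (cos (t * y) * y).
    exact: (deriv_comp (is_derive_sin _) (deriv_lin y t)).
  have dc : is_derive t 1 (fun t => cos (t * y)) (- sin (t * y) * y).
    exact: (deriv_comp (is_derive_cos _) (deriv_lin y t)).
  apply: is_derive_eq (deriv_add (deriv_mul (deriv_add (deriv_cst 1 t) (deriv_lin (- K^-1) t))
    (deriv_mul ds (deriv_cst (y^-1) t))) (deriv_mul dc (deriv_cst (- (K * y ^+ 2)^-1) t))) _.
  by field; rewrite y0 K1.
have cf t : 0 <= t <= K -> {for t, continuous (fun t => (1 - t / K) * cos (t * y))}.
  move=> _; apply: cvgM.
    by apply: cvgB; [exact: cvg_cst|apply: cvgM; [exact: cvg_id|exact: cvg_cst]].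
  have dc : is_derive t 1 (fun t => cos (t * y)) (- sin (t * y) * y).
    exact: (deriv_comp (is_derive_cos _) (deriv_lin y t)).
  exact: deriv_cont dc.
rewrite (ftc (ltW K0) dF cf) /F !mul0r cos0 sin0.
by field; rewrite y0 K1.
Qed.

Lemma triangle_integral K : 0 < K -> \int[mu]_t triangle K t = K / 2.
Proof.
move=> K0.
transitivity (\int[mu]_t (triangle K t * 1)); first by apply: eq_Rintegral => t _; rewrite mulr1.
rewrite fejer_itv.
have K1 := lt0r_neq0 K0.
have dF t : 0 <= t <= K -> is_derive t 1 (fun t => t + (- (2 * K)^-1) * (t * t)) ((1 - t / K) * 1).
  move=> _; apply: is_derive_eq (deriv_add (deriv_id t) (deriv_mul (deriv_cst (- (2 * K)^-1) t) (deriv_mul (deriv_id t) (deriv_id t)))) _.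
  by field.
have cf t : 0 <= t <= K -> {for t, continuous (fun t => (1 - t / K) * 1)}.
  move=> _; apply: cvgM; last exact: cvg_cst.
  by apply: cvgB; [exact: cvg_cst|apply: cvgM; [exact: cvg_id|exact: cvg_cst]].
by rewrite (ftc (ltW K0) dF cf); field.
Qed.

Lemma triangle_integrable K : 0 < K -> mu.-integrable setT (EFin \o triangle K).
Proof.
move=> K0; apply: (@bs_integrable _ _ 1 0 K); first exact: measurable_triangle.
by move=> t; rewrite mul1r triangle_norm.
Qed.

(** On the support of [triangle] one has [|t y| <= 1], hence [cos (t y) >= cos 1], and [triangle]
    has mass [K / 2]. *)
Lemma fejer_lower K y : 0 < K -> `|y| <= K^-1 -> cos 1 * K <= fejer K y.
Proof.
move=> K0 yK.
have c1 := @cos1_gt0 R.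
have : \int[mu]_t (triangle K t * cos 1) <= \int[mu]_t (triangle K t * cos (t * y)).
  apply: le_Rintegral => //; last first.
  - move=> t _; have /andP[l0 lM] := triangle_bound t K0.
    move: lM; rewrite indicE mem_setE/= in_itv/=.
    case: (boolP (0 <= t <= K)) => [/andP[t0 tK] _|_ h]; last first.
      have -> : triangle K t = 0 by apply/eqP; rewrite eq_le h l0.
      by rewrite !mul0r.
    rewrite ler_wpM2l// -[leRHS]cos_norm.
    have ty : `|t * y| <= 1.
      rewrite normrM ger0_norm// (le_trans (ler_pM t0 (normr_ge0 y) tK yK))//.
      by rewrite divff ?lt0r_neq0.
    have p1 : 1 <= pi :> R by apply: le_trans (pi_ge2 R); rewrite ler1n.
    rewrite leNgt ltr_cos ?in_itv/= ?ler01 ?normr_ge0/= -?leNgt//.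
    exact: le_trans p1.
  - exact: fejer_integrable.
  - apply: (triangle_mul_integrable (M := `|cos 1|) K0) => //; exact: measurable_cst.
rewrite RintegralZr//; last exact: triangle_integrable.
by rewrite triangle_integral// /fejer => h; move: h; set I := \int[mu]_t _; lra.
Qed.

Lemma fejer_ge0 K y : 0 < K -> 0 <= fejer K y.
Proof.
move=> K0; have [->|y0] := eqVneq y 0.
  apply: le_trans (fejer_lower K0 _); last by rewrite normr0 invr_ge0 ltW.
  by rewrite mulr_ge0// ltW// cos1_gt0.
have p : 0 < K * y ^+ 2 by rewrite mulr_gt0// exprn_even_gt0.
by rewrite -(pmulr_rge0 _ p) fejerE// mulr_ge0// subr_ge0 cos_le1.
Qed.

Lemma fejer_le K y : 0 < K -> fejer K y <= K.
Proof.
move=> K0.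
have : \int[mu]_t (triangle K t * cos (t * y)) <= \int[mu]_t triangle K t.
  apply: le_Rintegral => //; [exact: fejer_integrable|exact: triangle_integrable|].
  move=> t _; have /andP[l0 _] := triangle_bound t K0.
  by rewrite -[leRHS]mulr1 ler_wpM2l// cos_le1.
by rewrite triangle_integral// /fejer; set I := \int[mu]_t _; lra.
Qed.

Lemma fejer_decay K y : 0 < K -> K * y ^+ 2 * fejer K y <= 4.
Proof. by move=> K0; rewrite fejerE//; have := cos_geN1 (K * y); lra. Qed.

Lemma measurable_fejer K : measurable_fun setT (fejer K).
Proof.
apply: measurable_funM; first exact: measurable_cst.
apply: (measurable_Rint2 mu (f := fun z : R * R => triangle K z.2 * cos (z.2 * z.1))).
apply: measurable_funM.
  exact: (measurableT_comp (measurable_triangle K) measurable_snd).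
have [] // := @bm_cos R _ _ (fun z : measurableTypeR R * measurableTypeR R => z.2 * z.1).
by apply: measurable_funM; [exact: measurable_snd|exact: measurable_fst].
Qed.

(** A lower bound independent of [K] is enough: the Fejer means will be compared with [h] times the
    truncated mass itself, whose exact value does not matter. *)
Lemma fejer_mass K B : 0 < K -> K^-1 <= B ->
  2 * cos 1 <= \int[mu]_r (fejer K r * \1_(`[(- B)%R, B]%classic) r).
Proof.
move=> K0 KB; have c1 := @cos1_gt0 R.
have Ki : 0 < K^-1 by rewrite invr_gt0.
have -> : 2 * cos 1 = \int[mu]_r (cos 1 * K * \1_(`[(- K^-1)%R, K^-1]%classic) r).
  rewrite RintegralZl//; last exact: integrable_indic_itv.
  rewrite /Rintegral integral_indic// setIT /= lebesgue_measure_itv/= lte_fin.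
  have -> : - K^-1 < K^-1 by lra.
  by rewrite -EFinB/=; field; exact: lt0r_neq0.
have mi (D : set R) : measurable D -> measurable_fun setT (\1_D : R -> R) by exact: measurable_indic.
apply: le_Rintegral => //.
- apply: (@bs_integrable _ _ (cos 1 * K) (- K^-1) K^-1).
    by apply: measurable_funM; [exact: measurable_cst|exact: measurable_indic].
  by move=> r; rewrite indicE ger0_norm// mulr_ge0// mulr_ge0// ltW.
- apply: (@bs_integrable _ _ K (- B) B).
    by apply: measurable_funM; [exact: measurable_fejer|exact: measurable_indic].
  move=> r; rewrite indicE ger0_norm; last by rewrite mulr_ge0// fejer_ge0.
  by rewrite ler_wpM2r ?fejer_le.
move=> r _; rewrite !indicE !mem_setE/= !in_itv/=.
case: (boolP (- K^-1 <= r <= K^-1)) => [/andP[h1 h2]|_].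
  have -> : (- B <= r <= B) by apply/andP; split; lra.
  by rewrite !mulr1 fejer_lower// ler_norml h1.
by rewrite mulr0 mulr_ge0// fejer_ge0.
Qed.

Lemma gauss_t_integral c K : 0 < c -> 0 < K ->
  \int[mu]_(t in `[0, K]) (t * expR (- (c * t ^+ 2))) <= (2 * c)^-1.
Proof.
move=> c0 K0; have c1 := lt0r_neq0 c0.
pose F t := expR (- c * (t * t)) * (- (2 * c)^-1).
have dE t : is_derive t 1 (fun t => expR (- c * (t * t)))
   (expR (- c * (t * t)) * (- c * (t * 1 + t * 1) + (t * t) * 0)).
  exact: (deriv_comp (is_derive_expR _) (deriv_mul (deriv_cst (- c) t) (deriv_mul (deriv_id t) (deriv_id t)))).
have dF t : 0 <= t <= K -> is_derive t 1 F (t * expR (- (c * t ^+ 2))).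
  move=> _; apply: is_derive_eq (deriv_mul (dE t) (deriv_cst (- (2 * c)^-1) t)) _.
  by rewrite -expr2 mulNr; field.
have cf t : 0 <= t <= K -> {for t, continuous (fun t => t * expR (- (c * t ^+ 2)))}.
  have cE : {for t, continuous (fun t => expR (- (c * t ^+ 2)))}.
    have -> : (fun t => expR (- (c * t ^+ 2))) = (fun t => expR (- c * (t * t))).
      by apply/funext => s; rewrite mulNr.
    exact: deriv_cont (dE t).
  by move=> _; apply: cvgM; [exact: cvg_id|exact: cE].
rewrite (ftc (ltW K0) dF cf) /F !mulr0 expR0.
have i0 : 0 < (2 * c)^-1 by rewrite invr_gt0 mulr_gt0.
have := expR_gt0 (- c * (K * K)); nra.
Qed.

(** The majorant [2 / (1 + t sqrt c)^2] has an explicit antiderivative and an integral of the right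
    order. *)
Lemma gauss_integral_le c K : 0 < c -> 0 < K ->
  \int[mu]_(t in `[0, K]) expR (- (c * t ^+ 2)) <= 2 / Num.sqrt c.
Proof.
move=> c0 K0; set s := Num.sqrt c.
have s0 : 0 < s by rewrite sqrtr_gt0.
have sE : s ^+ 2 = c by rewrite sqr_sqrtr// ltW.
have pos t : 0 <= t <= K -> 0 < 1 + t * s.
  by move=> /andP[t0 _]; rewrite ltr_pwDl// mulr_ge0// ltW.
pose F t := (1 + t * s)^-1 * (- (2 / s)).
have dF t : 0 <= t <= K -> is_derive t 1 F (2 * ((1 + t * s)^-1) ^+ 2).
  move=> tK; have p := lt0r_neq0 (pos t tK).
  have di := @deriv_inv R (fun t => 1 + t * s) t _ p (deriv_add (deriv_cst 1 t) (deriv_lin s t)).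
  apply: is_derive_eq (deriv_mul di (deriv_cst (- (2 / s)) t)) _.
  by field; rewrite p lt0r_neq0.
have cf t : 0 <= t <= K -> {for t, continuous (fun t => 2 * ((1 + t * s)^-1) ^+ 2)}.
  move=> tK; have p := lt0r_neq0 (pos t tK).
  have di := @deriv_inv R (fun t => 1 + t * s) t _ p (deriv_add (deriv_cst 1 t) (deriv_lin s t)).
  exact: deriv_cont (deriv_mul (deriv_cst 2 t) (deriv_mul di di)).
have cw (f : R -> R) : (forall t, 0 <= t <= K -> {for t, continuous f}) ->
    mu.-integrable `[0, K] (EFin \o f).
  move=> h; apply: continuous_compact_integrable; first exact: segment_compact.
  by apply: continuous_in_subspaceT => x /[!inE]/=; rewrite in_itv/=; exact: h.
apply: (@le_trans _ _ (\int[mu]_(t in `[0, K]) (2 * ((1 + t * s)^-1) ^+ 2))).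
  apply: le_Rintegral => //; [|exact: cw|].
    apply: cw => t _.
    have -> : (fun t => expR (- (c * t ^+ 2))) = (fun t => expR (- c * (t * t))).
      by apply/funext => u; rewrite mulNr.
    have dE : is_derive t 1 (fun t => expR (- c * (t * t)))
       (expR (- c * (t * t)) * (- c * (t * 1 + t * 1) + (t * t) * 0)).
      exact: (deriv_comp (is_derive_expR _) (deriv_mul (deriv_cst (- c) t) (deriv_mul (deriv_id t) (deriv_id t)))).
    exact: deriv_cont dE.
  move=> t; rewrite /= in_itv/= => tK; have p := pos t tK.
  rewrite expRN exprVn ler_pdivlMr ?exprn_gt0// mulrC ler_pdivrMr ?expR_gt0//.
  have : 1 + c * t ^+ 2 <= expR (c * t ^+ 2) by exact: expR_ge1Dx.
  have : (1 + t * s) ^+ 2 <= 2 * (1 + c * t ^+ 2).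
    rewrite -sE -exprMn; set u := t * s; rewrite [s * t]mulrC -/u.
    have := sqr_ge0 (1 - u); nra.
  lra.
rewrite (ftc (ltW K0) dF cf) /F mul0r addr0 invr1 mul1r.
have : 0 < (1 + K * s)^-1 by rewrite invr_gt0 pos// lexx ltW.
have : 0 < 2 / s by rewrite divr_gt0.
nra.
Qed.

End Fejer.

(** * Regularity along the fibres *)

Section Fibre.
Context {R : realType} {d : nat}.
Local Notation V := 'rV[R]_d.
Local Notation one := (@ones R d).
Local Notation mu := (@lebesgue_measure R).
Hypothesis d0 : (0 < d)%N.

Lemma measurable_fibre : measurable_fun setT (fun z : VB R d * R => z.1 - z.2 *: one : VB R d).
Proof.
have mF x : measurable_fun setT (fun r : measurableTypeR R => x - r *: one : VB R d).
  apply: VB_measurable => U oU; apply: open_measurable.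
  apply: open_comp => // r _.
  have := @lip_continuous R R^o V 1 (fun r => x - r *: one); apply => s t.
  have -> : x - s *: one - (x - t *: one) = (t - s) *: one.
    by apply/rowP => i; rewrite !mxE; ring.
  by rewrite mul1r; apply: norm_le_coord => // i; rewrite !mxE mulr1 distrC.
have cF (r : measurableTypeR R) : continuous (fun x : V => x - r *: one).
  apply: (@lip_continuous R V V 1) => x y; rewrite mul1r.
  by rewrite opprB addrA subrK.
have := caratheodory mF cF.
move=> /measurableT_comp/(_ (measurable_fun_pair measurable_snd measurable_fst)).
exact.
Qed.

Lemma measurable_shift a : measurable_fun setT (fun x : VB R d => x + a *: one : VB R d).
Proof.
apply: VB_cont; apply: (@lip_continuous R V V 1) => x y; rewrite mul1r.
by rewrite opprD addrACA subrr addr0.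
Qed.

Lemma eqv_comb1 t M (G G' : V -> R) x : t != 0 -> (forall x, `|G x| <= M) ->
  (forall x a, G (x + a *: one) = cos (t * a) * G x + sin (t * a) * G' x) -> `|G' x| <= M.
Proof.
move=> t0 GM GE; have := eqv_comb 0 1 x t0 GM GE.
by rewrite mul0r add0r mul1r expr0n/= add0r expr1n sqrtr1 mul1r.
Qed.

(** A shift by [a - b] multiplies by a phase, at distance at most [t |a - b|] from 1 in each of its
    cosine and sine parts. The factor [t] is the gain behind the equicontinuity. *)
Lemma eqv_diff t M (G : V -> R) a b : 0 <= t -> eqv t M G ->
  eqv t (2 * (t * `|a - b|) * M) (fun x => G (x + a *: one) - G (x + b *: one)).
Proof.
move=> tge [bG GM [G' bG' GE]].
have M0 : 0 <= M by apply: le_trans (GM 0).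
split.
- by apply: bmB; [exact: (bm_comp bG (measurable_shift a))|exact: (bm_comp bG (measurable_shift b))].
- move=> x; have -> : x + a *: one = (x + b *: one) + (a - b) *: one by rewrite onesD; congr (_ + _ *: _); ring.
  rewrite GE; set y := x + b *: one; set e := t * (a - b).
  have [t0|t0] := eqVneq t 0.
    by rewrite /e t0 !mul0r cos0 sin0 mul1r mul0r addr0 subrr normr0 mulr0 mul0r.
  have -> : cos e * G y + sin e * G' y - G y = (cos e - cos 0) * G y + sin e * G' y.
    by rewrite cos0; ring.
  have ne : `|e| = t * `|a - b| by rewrite normrM ger0_norm.
  have -> : 2 * (t * `|a - b|) * M = t * `|a - b| * M + t * `|a - b| * M by ring.
  apply: (le_trans (ler_normD _ _)); apply: lerD; rewrite normrM; apply: ler_pM => //.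
  + by have := cos_lip e 0; rewrite subr0 ne.
  + by have := sin_le_norm e; rewrite ne.
  + exact: (eqv_comb1 y t0 GM GE).
exists (fun x => G' (x + a *: one) - G' (x + b *: one)).
  by apply: bmB; [exact: (bm_comp bG' (measurable_shift a))|exact: (bm_comp bG' (measurable_shift b))].
move=> x s; have sw c : x + s *: one + c *: one = x + c *: one + s *: one by rewrite addrAC.
by rewrite !sw !GE; ring.
Qed.

Lemma eqv_cos_vmax t b : eqv t 1 (fun x : V => cos (t * (vmax x + b))).
Proof.
have mv : measurable_fun setT (fun x : VB R d => t * (vmax x + b)).
  apply: measurable_funM; first exact: measurable_cst.
  apply: measurable_funD; last exact: measurable_cst.
  by apply: VB_cont_real; apply: topical_fun_cont; exact: topical_vmax.
split; [exact: bm_cos|by move=> x; exact: cos_max|].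
exists (fun x => - sin (t * (vmax x + b))); first by apply: bmN; exact: bm_sin.
move=> x a; rewrite (vmaxD d0).
have -> : t * (vmax x + a + b) = t * a + t * (vmax x + b) by ring.
by rewrite cosD; ring.
Qed.

Variables (h : V -> R) (M C : R).
Hypothesis ch : continuous h.
Hypothesis hM : forall x, `|h x| <= M.
Hypothesis hC : forall x, h x != 0 -> `|vmax x| <= C.
Hypothesis C0 : 0 <= C.

Let M0 : 0 <= M. Proof. exact: le_trans (hM 0). Qed.

(** An interval containing every [r] with [h (x - r 1)] nonzero; its length [2 C] does not depend on
    [x]. *)
Definition fib (x : V) : set R := `[vmax x - C, vmax x + C]%classic.

Lemma fibP x r : fib x r <-> `|vmax x - r| <= C.
Proof.
rewrite /fib /= in_itv/= ler_norml; split => /andP[h1 h2]; apply/andP; split; lra.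
Qed.

Lemma fibre_bound x r : `|h (x - r *: one)| <= M * \1_(fib x) r.
Proof.
have [->|hn] := eqVneq (h (x - r *: one)) 0; first by rewrite normr0 indicE mulr_ge0.
rewrite indicE mem_set ?mulr1//; apply/fibP.
by have := hC hn; rewrite -scaleNr (vmaxD d0).
Qed.

Lemma measurable_hfib : measurable_fun setT (fun z : VB R d * R => h (z.1 - z.2 *: one)).
Proof. exact: (measurableT_comp (VB_cont_real ch) measurable_fibre). Qed.

Lemma measurable_hfib1 x : measurable_fun setT (fun r : R => h (x - r *: one)).
Proof. exact: (measurableT_comp measurable_hfib (measurable_pair1 (x : VB R d))). Qed.

(* Convolution of [h] and [k] along the line [x + R 1]. *)
Definition fibre_conv (k : R -> R) (x : V) : R := \int[mu]_r (h (x - r *: one) * k r).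

Lemma fibre_conv_dom (k : R -> R) (Kb : R) x r : (forall r, `|k r| <= Kb) ->
  `|h (x - r *: one) * k r| <= M * Kb * \1_(fib x) r.
Proof.
by move=> kK; rewrite normrM mulrAC ler_pM//; exact: fibre_bound.
Qed.

Lemma fibre_conv_integrable (k : R -> R) (Kb : R) x : measurable_fun setT k -> (forall r, `|k r| <= Kb) ->
  mu.-integrable setT (EFin \o (fun r => h (x - r *: one) * k r)).
Proof.
move=> mk kK; apply: (@bs_integrable _ _ (M * Kb) (vmax x - C) (vmax x + C)).
  by apply: measurable_funM => //; exact: measurable_hfib1.
by move=> r; exact: fibre_conv_dom.
Qed.

Lemma fib_integral x (c : R) : \int[mu]_r (c * \1_(fib x) r) = c * (2 * C).
Proof.
rewrite /fib.
rewrite RintegralZl//; last exact: integrable_indic_itv.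
rewrite /Rintegral integral_indic// setIT /= lebesgue_measure_itv/= lte_fin.
case: ifPn => [_|]; first by rewrite -EFinB/=; congr (_ * _); ring.
rewrite -leNgt => h1; have -> : C = 0 by apply/eqP; rewrite eq_le C0 andbT; lra.
by rewrite !mulr0.
Qed.

Lemma fibre_conv_le (k : R -> R) (Kb : R) x : measurable_fun setT k -> (forall r, `|k r| <= Kb) ->
  `|fibre_conv k x| <= M * Kb * (2 * C).
Proof.
move=> mk kK; have ik := fibre_conv_integrable x mk kK.
apply: (le_trans (le_normr_Rintegral measurableT ik)).
rewrite -(fib_integral x); apply: le_Rintegral => //.
- exact: (integrable_norm ik).
- apply: (@bs_integrable _ _ (M * Kb) (vmax x - C) (vmax x + C)).
    by apply: measurable_funM; [exact: measurable_cst|rewrite /fib; exact: measurable_indic].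
  have Kb0 : 0 <= Kb by apply: le_trans (kK 0).
  by move=> r; rewrite ger0_norm// indicE; apply: mulr_ge0; [exact: mulr_ge0|].
- by move=> r _; exact: fibre_conv_dom.
Qed.

Lemma bm_fibre_conv (k : R -> R) (Kb : R) : measurable_fun setT k -> (forall r, `|k r| <= Kb) ->
  bm (fibre_conv k : VB R d -> R).
Proof.
move=> mk kK; split; last by exists (M * Kb * (2 * C)) => x; exact: fibre_conv_le.
apply: (measurable_Rint2 mu (f := fun z : VB R d * R => h (z.1 - z.2 *: one) * k z.2)).
apply: measurable_funM; first exact: measurable_hfib.
exact: (measurableT_comp mk measurable_snd).
Qed.

Lemma fibre_conv_shift (k : R -> R) (Kb : R) x a : measurable_fun setT k -> (forall r, `|k r| <= Kb) ->
  fibre_conv k (x + a *: one) = fibre_conv (fun r => k (r + a)) x.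
Proof.
move=> mk kK; rewrite /fibre_conv -(Rint_shift a (fibre_conv_integrable (x + a *: one) mk kK)).
apply: eq_Rintegral => r _; congr (h _ * _).
by apply/rowP => i; rewrite !mxE; ring.
Qed.

Definition fibre_cos t := fibre_conv (fun r => cos (t * r)).

Lemma measurable_cosl (t : R) : measurable_fun setT (fun r : R => cos (t * r)).
Proof.
by case: (@bm_cos R _ (measurableTypeR R) (fun r : R => t * r)) => //;
  apply: measurable_funM => //; exact: measurable_cst.
Qed.

Lemma measurable_sinl (t : R) : measurable_fun setT (fun r : R => sin (t * r)).
Proof.
by case: (@bm_sin R _ (measurableTypeR R) (fun r : R => t * r)) => //;
  apply: measurable_funM => //; exact: measurable_cst.
Qed.

(** Moving [x] along [ones] shifts the argument of the cosine; the companion function is minus the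
    sine transform. *)
Lemma eqv_fibre_cos (t : R) : eqv t (M * (2 * C)) (fibre_cos t).
Proof.
have cb r : `|cos (t * r)| <= 1 by exact: cos_max.
have sb r : `|sin (t * r)| <= 1 by exact: sin_max.
have mc := measurable_cosl t; have ms := measurable_sinl t.
split.
- exact: (bm_fibre_conv mc cb).
- by move=> x; have := fibre_conv_le x mc cb; rewrite mulr1.
exists (fun x => - fibre_conv (fun r => sin (t * r)) x); first by apply: bmN; exact: (bm_fibre_conv ms sb).
move=> x a; rewrite /fibre_cos (fibre_conv_shift x a mc cb) /fibre_conv.
have ic := fibre_conv_integrable x mc cb; have is_ := fibre_conv_integrable x ms sb.
rewrite mulrN -(RintegralZl _ measurableT ic) -(RintegralZl _ measurableT is_).
rewrite -RintegralB//.
- by apply: eq_Rintegral => r _; rewrite mulrDr cosD; ring.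
- exact: (integrableZl measurableT _ ic).
- exact: (integrableZl measurableT _ is_).
Qed.

Lemma measurable_fibre_cos : measurable_fun setT (fun z : VB R d * R => fibre_cos z.2 z.1).
Proof.
apply: (measurable_Rint2 mu (f := fun z : (VB R d * R) * R =>
  h (z.1.1 - z.2 *: one) * cos (z.1.2 * z.2))).
apply: measurable_funM.
  apply: (measurableT_comp measurable_hfib (g := fun z : (VB R d * R) * R => (z.1.1, z.2))).
  apply: measurable_fun_pair; last exact: measurable_snd.
  exact: (measurableT_comp measurable_fst measurable_fst).
have [] // := @bm_cos R _ _ (fun z : (VB R d * R) * R => z.1.2 * z.2).
apply: measurable_funM; last exact: measurable_snd.
exact: (measurableT_comp measurable_snd measurable_fst).
Qed.

Definition Theta (K : R) := fibre_conv (fejer K).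

Lemma fejer_norm (K y : R) : 0 < K -> `|fejer K y| <= K.
Proof. by move=> K0; rewrite ger0_norm ?fejer_ge0// fejer_le. Qed.

(** By Fubini, the Fejer mean superposes equivariant functions of frequencies [t <= K] only, where
    the decay has a uniform constant. *)
Lemma ThetaE K x : 0 < K -> Theta K x = 2 * \int[mu]_t (triangle K t * fibre_cos t x).
Proof.
move=> K0.
rewrite /Theta /fibre_conv.
transitivity (2 * \int[mu]_r \int[mu]_t (h (x - r *: one) * (triangle K t * cos (t * r)))).
  rewrite -RintegralZl//; last first.
    have mk : measurable_fun setT (fun r => fejer K r / 2).
      by apply: measurable_funM; [exact: measurable_fejer|exact: measurable_cst].
    have kK r : `|fejer K r / 2| <= K.
      rewrite normrM (le_trans _ (fejer_norm r K0))// -[leRHS]mulr1 ler_wpM2l//.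
      by rewrite ger0_norm// invf_le1// ler1n.
    have := fibre_conv_integrable x mk kK; apply: eq_integrable => // r _ /=.
    rewrite RintegralZl//; last exact: fejer_integrable.
    by congr EFin; congr (_ * _); rewrite /fejer mulrC mulKf.
  apply: eq_Rintegral => r _; rewrite RintegralZl//; last exact: fejer_integrable.
  by rewrite /fejer mulrCA.
have ii (c a b : R) : mu.-integrable setT (EFin \o (fun r => c * \1_(`[a, b]%classic) r)).
  exact: (integrableZl measurableT c (integrable_indic_itv a b true false)).
have i1 (a b : R) : mu.-integrable setT (EFin \o (\1_(`[a, b]%classic) : R -> R)).
  exact: integrable_indic_itv.
have mf : measurable_fun setT (fun z : R * R => h (x - z.1 *: one) * (triangle K z.2 * cos (z.2 * z.1))).
  apply: measurable_funM; first exact: (measurableT_comp (measurable_hfib1 x) measurable_fst).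
  apply: measurable_funM; first exact: (measurableT_comp (measurable_triangle K) measurable_snd).
  have [] // := @bm_cos R _ _ (fun z : measurableTypeR R * measurableTypeR R => z.2 * z.1).
  by apply: measurable_funM; [exact: measurable_snd|exact: measurable_fst].
have F := @RFubini R _ _ _ _ mu mu _ (fun r => M * \1_(fib x) r)
  (\1_(`[0%R, K]%classic)) mf (ii M _ _) (i1 0 K).
congr (_ * _); rewrite F.
- apply: eq_Rintegral => t _; rewrite /fibre_cos /fibre_conv.
  have cb r : `|cos (t * r)| <= 1 by exact: cos_max.
  rewrite -(RintegralZl _ measurableT (fibre_conv_integrable x (measurable_cosl t) cb)).
  by apply: eq_Rintegral => r _ /=; ring.
- by move=> r; rewrite indicE mulr_ge0.
- by move=> t; rewrite indicE.
- move=> r t /=; rewrite normrM ler_pM ?fibre_bound//.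
  rewrite normrM -[leRHS]mulr1 ler_pM ?cos_max//; exact: triangle_norm.
Qed.

End Fibre.

Section LamExpectation.
Context {R : realType} {dO : measure_display} {Omega : measurableType dO}.
Variable P : probability Omega R.
Local Notation mu := (@lebesgue_measure R).

Lemma triangle_Ex (K M : R) (g : Omega * R -> R) : 0 < K -> measurable_fun setT g ->
  (forall z, `|g z| <= M) ->
  Ex P (fun w => \int[mu]_t (triangle K t * g (w, t))) =
  \int[mu]_t (triangle K t * Ex P (fun w => g (w, t))).
Proof.
move=> K0 mg gM.
have i1 : mu.-integrable setT (EFin \o (\1_(`[0%R, K]%classic) : R -> R)).
  exact: integrable_indic_itv.
have ml : measurable_fun setT (fun z : Omega * R => triangle K z.2 * g z).
  by apply: measurable_funM => //; exact: (measurableT_comp (measurable_triangle K) measurable_snd).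
have F := @RFubini R _ _ _ _ P mu (fun z => triangle K z.2 * g z) (cst `|M|)
  (\1_(`[0%R, K]%classic)) ml (finite_measure_integrable_cst _ _ measurableT) i1.
rewrite ExE F /=.
- apply: eq_Rintegral => t _; rewrite -ExE ExZ//.
  split; first exact: (measurableT_comp mg (measurable_pair2 _)).
  by exists M => w; exact: gM.
- by [].
- by move=> t; rewrite indicE.
- move=> w t; rewrite normrM mulrC ler_pM//; last exact: triangle_norm.
  by rewrite (le_trans (gM _))// ler_norm.
Qed.

Lemma triangle_Ex_le (K M : R) (g : Omega * R -> R) (B : R -> R) : 0 < K -> measurable_fun setT g ->
  (forall z, `|g z| <= M) -> continuous B ->
  (forall t, 0 <= t -> t <= K -> `|Ex P (fun w => g (w, t))| <= B t) ->
  `|Ex P (fun w => \int[mu]_t (triangle K t * g (w, t)))| <= \int[mu]_(t in `[0, K]) B t.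
Proof.
move=> K0 mg gM cB gB; rewrite (triangle_Ex K0 mg gM).
have bg : forall t, bm (fun w => g (w, t)).
  move=> t; split; first exact: (measurableT_comp mg (measurable_pair2 _)).
  by exists M => w; exact: gM.
have mE : measurable_fun setT (fun t : R => Ex P (fun w => g (w, t))).
  apply: (measurable_Rint2 P (f := fun z : R * Omega => g (z.2, z.1))).
  exact: (measurableT_comp mg (measurable_fun_pair measurable_snd measurable_fst)).
have ii : mu.-integrable setT (EFin \o (fun t => triangle K t * Ex P (fun w => g (w, t)))).
  by apply: (triangle_mul_integrable (M := M) K0) => // t; apply: Ex_bound.
have iB : mu.-integrable setT (EFin \o (B \_ `[0, K])).
  have : mu.-integrable `[0, K] (EFin \o B).
    apply: continuous_compact_integrable; first exact: segment_compact.
    exact: continuous_subspaceT.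
  rewrite integrable_mkcond//.
  by rewrite -restrict_EFin.
rewrite [leRHS]Rintegral_mkcond.
apply: (le_trans (le_normr_Rintegral measurableT ii)); apply: le_Rintegral => //.
  exact: (integrable_norm ii).
move=> t _; have l := triangle_norm t K0; rewrite normrM patchE.
move: l; rewrite indicE; case: ifPn => h l; last first.
  have -> : triangle K t = 0 by apply/eqP; rewrite -normr_le0.
  by rewrite normr0 mul0r.
have /gB h2 : 0 <= t by move: h; rewrite inE/= in_itv/= => /andP[].
rewrite -[leRHS]mul1r; apply: ler_pM => //; apply: h2.
by move: h; rewrite inE/= in_itv/= => /andP[].
Qed.

Lemma continuous_gauss (c : R) : continuous (fun t : R => expR (- (c * t ^+ 2))).
Proof.
move=> t.
have -> : (fun t => expR (- (c * t ^+ 2))) = (fun t => expR (- c * (t * t))).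
  by apply/funext => u; rewrite mulNr.
exact: deriv_cont (deriv_comp (is_derive_expR _) (deriv_mul (deriv_cst (- c) t) (deriv_mul (deriv_id t) (deriv_id t)))).
Qed.

End LamExpectation.

Section Regularity.
Context {R : realType} {d : nat} {dO : measure_display} {Omega : measurableType dO}.
Local Notation V := 'rV[R]_d.
Local Notation one := (@ones R d).
Local Notation mu := (@lebesgue_measure R).
Variable P : probability Omega R.
Hypothesis d0 : (0 < d)%N.
Variable Y : nat -> Omega -> V.
Hypothesis mY : forall n, measurable_fun setT (Y n : Omega -> VB R d).
Hypothesis HD : forall K : R, 0 < K -> exists2 c : R, 0 < c &
  forall t : R, 0 < t -> t <= K -> forall M (G : V -> R), eqv t M G -> forall n : nat, c^-1 <= n%:R ->
  `|Ex P (fun w => G (Y n w))| <= M * expR (- (c * n%:R * t ^+ 2)).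

Lemma measurable_vmax : measurable_fun setT (fun x : VB R d => vmax x).
Proof. by apply: VB_cont_real; apply: topical_fun_cont; exact: topical_vmax. Qed.

Lemma measurable_vmaxY n b : measurable_fun setT (fun w => vmax (Y n w) + b).
Proof.
apply: measurable_funD; last exact: measurable_cst.
exact: (measurableT_comp measurable_vmax (mY n)).
Qed.

(** The Fejer kernel of the height is a mixture of the equivariant functions [cos (t (vmax + b))],
    and the decay is integrated over [t] in [[0, 1]]. *)
Lemma fejer_vmax : exists2 c : R, 0 < c & forall n : nat, c^-1 <= n%:R -> forall b,
  Ex P (fun w => fejer 1 (vmax (Y n w) + b)) <= 4 / Num.sqrt (c * n%:R).
Proof.
have [c c0 H] := HD ltr01; exists c => // n cn b.
have n0 : 0 < n%:R :> R by apply: lt_le_trans cn; rewrite invr_gt0.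
have mg : measurable_fun setT (fun z : Omega * R => cos (z.2 * (vmax (Y n z.1) + b))).
  have [] // := @bm_cos R _ _ (fun z : Omega * R => z.2 * (vmax (Y n z.1) + b)).
  apply: measurable_funM; first exact: measurable_snd.
  exact: (measurableT_comp (measurable_vmaxY n b) measurable_fst).
have gM (z : Omega * R) : `|cos (z.2 * (vmax (Y n z.1) + b))| <= 1 by exact: cos_max.
rewrite /fejer ExZ; last first.
  split.
    apply: (measurable_Rint2 mu (f := fun z : Omega * R => triangle 1 z.2 * cos (z.2 * (vmax (Y n z.1) + b)))).
    by apply: measurable_funM => //; exact: (measurableT_comp (measurable_triangle 1) measurable_snd).
  exists 1 => w; have := fejer_norm (vmax (Y n w) + b) (@ltr01 R).
  by rewrite /fejer normrM ger0_norm//; move: `|_|  (normr_ge0 (\int[mu]_t (triangle 1 t * cos (t * (vmax (Y n w) + b))))) => I ? ?; lra.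
have h := @triangle_Ex_le R _ _ P 1 1 _ (fun t => expR (- (c * n%:R * t ^+ 2))) ltr01 mg gM
  (@continuous_gauss R (c * n%:R)).
have {}h := le_trans (h _) (gauss_integral_le (mulr_gt0 c0 n0) ltr01).
rewrite [leRHS](_ : _ = 2 * (2 / Num.sqrt (c * n%:R))); last by ring.
rewrite ler_pM2l// (le_trans (ler_norm _))//; apply: h => t t0 t1.
move: t0; rewrite le_eqVlt => /predU1P[<-|t0].
  rewrite expr0n/= mulr0 oppr0 expR0; apply: Ex_bound; last by move=> w; exact: cos_max.
  by apply: bm_cos; under eq_fun do rewrite mul0r; exact: measurable_cst.
have := H t t0 t1 _ _ (eqv_cos_vmax d0 t b) n cn.
by rewrite mul1r.
Qed.

(* [1 - cos y] and [1 - cos (y + 1)] do not vanish together. *)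
Lemma fejer1_sum (y : R) : 2 * (1 - cos 2^-1) <= (1 + y ^+ 2) * (fejer 1 y + fejer 1 (y + 1)).
Proof.
have E0 := fejerE y (@ltr01 R); have E1 := fejerE (y + 1) (@ltr01 R).
rewrite !mul1r in E0 E1.
have f0 := fejer_ge0 y (@ltr01 R); have f1 := fejer_ge0 (y + 1) (@ltr01 R).
have : 4 * (1 - cos 2^-1) <= 2 * (1 - cos y) + 2 * (1 - cos (y + 1)).
  have -> : cos y = cos ((y + 2^-1) - 2^-1) by congr cos; field.
  have -> : cos (y + 1) = cos ((y + 2^-1) + 2^-1) by congr cos; field.
  move: (y + 2^-1) => z; rewrite cosB cosD.
  have h1 := @cos_le1 R z.
  have h2 : 0 <= cos (2^-1 : R).
    apply: ltW; apply: cos_gt0_pihalf; have := @pi_ge2 R; move: (@pi R) => p p2; apply/andP; split; lra.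
  have h3 : 0 <= cos 2^-1 * (1 - cos z) by rewrite mulr_ge0// subr_ge0.
  move: h3; move: (cos z) (cos 2^-1) (sin _ * sin _) => a b s h3; lra.
rewrite -E0 -E1.
move: (fejer 1 y) (fejer 1 (y + 1)) f0 f1 => f g f0 f1.
move=> h; suff : y ^+ 2 * f + (y + 1) ^+ 2 * g <= 2 * ((1 + y ^+ 2) * (f + g)) by lra.
have := sqr_ge0 (y - 1); have : 0 <= y ^+ 2 by exact: sqr_ge0.
nra.
Qed.

(** A weight with the quadratic tails of the Fejer kernel but without its zeros; two translated
    kernels are needed to dominate it. *)
Definition bump (y : R) : R := (1 + y ^+ 2)^-1.

Lemma bump_ge0 y : 0 <= bump y.
Proof. by rewrite /bump invr_ge0 addr_ge0// sqr_ge0. Qed.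

Lemma bump_le1 y : bump y <= 1.
Proof.
have p : 0 < 1 + y ^+ 2 by rewrite ltr_pwDl// sqr_ge0.
by rewrite /bump invf_le1// lerDl sqr_ge0.
Qed.

Lemma bm_bump d1 (T : measurableType d1) (f : T -> R) : measurable_fun setT f ->
  bm (fun w => bump (f w)).
Proof.
move=> mf; split; last by exists 1 => w; rewrite ger0_norm ?bump_ge0 ?bump_le1.
have cb : continuous (fun y => bump y).
  move=> y; have p : 1 + y * y != 0 by rewrite lt0r_neq0// ltr_pwDl// -expr2 sqr_ge0.
  have -> : (fun y => bump y) = (fun y => (1 + y * y)^-1) by apply/funext.
  have di := @deriv_inv R (fun y => 1 + y * y) y _ p (deriv_add (deriv_cst 1 y) (deriv_mul (deriv_id y) (deriv_id y))).
  exact: deriv_cont di.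
apply: measurableT_comp mf; exact: continuous_measurable_fun.
Qed.

(** A concentration estimate, uniform in [b]: a pointwise error bounded by a small multiple of
    [bump] stays small after multiplication by [sqrt n]. *)
Lemma bump_bound : exists2 CB : R, 0 < CB & exists N : nat, forall n, (N <= n)%N -> forall b,
  Num.sqrt n%:R * Ex P (fun w => bump (vmax (Y n w) + b)) <= CB.
Proof.
have [c c0 H] := fejer_vmax.
have k0 : 0 < 1 - cos (2^-1 : R).
  rewrite subr_gt0 -[ltRHS](cos0 R); have := @pi_ge2 R => p2.
  have i0 : 0 < 2^-1 :> R by rewrite invr_gt0.
  rewrite ltr_cos// in_itv/= ?lexx ?pi_ge0//.
  by rewrite ltW//= (le_trans _ p2)// (@le_trans _ _ 1) ?invf_le1 ?ler1n.
exists (4 / (1 - cos 2^-1) / Num.sqrt c).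
  by rewrite !divr_gt0// sqrtr_gt0.
exists (Num.bound c^-1).+1 => n Nn b.
have cn : c^-1 <= n%:R.
  have := archi_boundP (ltW (ltac:(by rewrite invr_gt0) : 0 < c^-1)).
  by move=> /ltW h; apply: (le_trans h); rewrite ler_nat ltnW.
have n0 : 0 < n%:R :> R by apply: lt_le_trans cn; rewrite invr_gt0.
have bb : bm (fun w => bump (vmax (Y n w) + b)) by apply: bm_bump; exact: measurable_vmaxY.
have bf e : bm (fun w => fejer 1 (vmax (Y n w) + e)).
  split; first by apply: (measurableT_comp (measurable_fejer 1)); exact: measurable_vmaxY.
  by exists 1 => w; exact: fejer_norm.
have h : 2 * (1 - cos 2^-1) * Ex P (fun w => bump (vmax (Y n w) + b)) <=
    2 * (4 / Num.sqrt (c * n%:R)).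
  rewrite -ExZ//.
  apply: (@le_trans _ _ (Ex P (fun w => fejer 1 (vmax (Y n w) + b) + fejer 1 (vmax (Y n w) + (b + 1))))).
    apply: Ex_le; [exact: bmZ|exact: bmD|] => w.
    rewrite /bump ler_pdivrMr; last by rewrite ltr_pwDl// sqr_ge0.
    by rewrite [leRHS]mulrC; have := fejer1_sum (vmax (Y n w) + b); rewrite -[_ + b + 1]addrA.
  rewrite ExD// mulrDl mul1r lerD//; exact: H.
move: h; rewrite (sqrtrM _ (ltW c0)).
have : 0 < Num.sqrt c by rewrite sqrtr_gt0.
have : 0 < Num.sqrt n%:R :> R by rewrite sqrtr_gt0.
move: (Num.sqrt n%:R) (Num.sqrt c) (Ex P _) (1 - cos 2^-1) k0 => s r e k k0 s0 r0.
rewrite -[2 * k * e]mulrA ler_pM2l//.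
rewrite invfM !mulrA => h.
rewrite ler_pdivlMr// mulrAC.
rewrite ler_pdivlMr//.
move: h; rewrite ler_pdivlMr// ler_pdivlMr//.
by move=> h; apply: le_trans h; rewrite le_eqVlt; apply/orP; left; apply/eqP; ring.
Qed.

End Regularity.

Section IntegrableReal.
Context {R : realType} {d : measure_display} {T : measurableType d}.
Variable m : {measure set T -> \bar R}.

Lemma Rintegrable_sub (f g : T -> R) : m.-integrable setT (EFin \o f) ->
  m.-integrable setT (EFin \o g) -> m.-integrable setT (EFin \o (fun r => f r - g r)).
Proof. by move=> i_f i_g; have := integrableB measurableT i_f i_g. Qed.

Lemma Rintegrable_add (f g : T -> R) : m.-integrable setT (EFin \o f) ->
  m.-integrable setT (EFin \o g) -> m.-integrable setT (EFin \o (fun r => f r + g r)).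
Proof. by move=> i_f i_g; have := integrableD measurableT i_f i_g. Qed.

Lemma Rintegrable_scale (c : R) (f : T -> R) : m.-integrable setT (EFin \o f) ->
  m.-integrable setT (EFin \o (fun r => c * f r)).
Proof. by move=> i_f; exact: (integrableZl measurableT c i_f). Qed.

End IntegrableReal.

(** * Approximation by Fejer means, with errors controlled by [bump] *)

Section Approximation.
Context {R : realType} {d : nat}.
Local Notation V := 'rV[R]_d.
Local Notation one := (@ones R d).
Local Notation mu := (@lebesgue_measure R).
Hypothesis d0 : (0 < d)%N.
Variables (h : V -> R) (M C : R).
Hypothesis ch : continuous h.
Hypothesis hM : forall x, `|h x| <= M.
Hypothesis hC : forall x, h x != 0 -> `|vmax x| <= C.
Hypothesis C1 : 1 <= C.
Hypothesis hU : forall w : R, 0 < w -> exists2 eta : R, 0 < eta &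
  forall x r, `|r| <= eta -> `|h x - h (x - r *: one)| <= w.

Let M0 : 0 <= M. Proof. exact: le_trans (hM 0). Qed.
Let C0 : 0 <= C. Proof. exact: le_trans C1. Qed.
Let C0' : 0 < C. Proof. exact: lt_le_trans C1. Qed.

Lemma sqr_normr (x : R) : `|x| ^+ 2 = x ^+ 2.
Proof. exact: real_normK (num_real x). Qed.

Local Notation B := (3 * C).
(** The window of half-width [3 C] contains [fib x] as soon as [|vmax x| <= 2 C]. *)
Definition fejer_center K : R := \int[mu]_r (fejer K r * \1_(`[(- B)%R, B]%classic) r).

Lemma fejer_center_integrable K : 0 < K ->
  mu.-integrable setT (EFin \o (fun r => fejer K r * \1_(`[(- B)%R, B]%classic) r)).
Proof.
move=> K0; apply: (@bs_integrable _ _ K (- B) B).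
  by apply: measurable_funM; [exact: measurable_fejer|exact: measurable_indic].
move=> r; rewrite indicE ger0_norm; last by rewrite mulr_ge0// fejer_ge0.
by rewrite ler_wpM2r ?fejer_le.
Qed.

(** On the fibre [|r|] is at least [|vmax x| / 2], where the kernel is at most
    [16 / (K (vmax x)^2)]. *)
Lemma approx_far K x : 0 < K -> 2 * C < `|vmax x| ->
  `|Theta h K x| <= M * (16 / (K * vmax x ^+ 2)) * (2 * C).
Proof.
move=> K0 hx; set y := vmax x in hx *.
have y0 : 0 < `|y| by apply: le_lt_trans hx; rewrite mulr_ge0.
have y2 : 0 < K * y ^+ 2 by rewrite mulr_gt0// -sqr_normr exprn_gt0.
rewrite -(fib_integral C0 x) /Theta /fibre_conv.
have fK r : `|fejer K r| <= K by exact: fejer_norm.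
have ik := fibre_conv_integrable d0 ch hM hC x (measurable_fejer K) fK.
apply: (le_trans (le_normr_Rintegral measurableT ik)); apply: le_Rintegral => //.
- exact: (integrable_norm ik).
- apply: (@bs_integrable _ _ (M * (16 / (K * y ^+ 2))) (y - C) (y + C)).
    by apply: measurable_funM; [exact: measurable_cst|rewrite /fib; exact: measurable_indic].
  have h16 : 0 <= 16 / (K * y ^+ 2) by rewrite divr_ge0// ltW.
  by move=> r; rewrite ger0_norm// indicE; apply: mulr_ge0; [exact: mulr_ge0|].
move=> r _; rewrite normrM mulrAC.
have [rF|rF] := pselect (fib C x r); last first.
  have := fibre_bound d0 hM hC x r; rewrite indicE memNset// mulr0 => l.
  have -> : `|h (x - r *: one)| = 0 by apply/eqP; rewrite eq_le l normr_ge0.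
  by rewrite !mul0r.
apply: ler_pM => //; first exact: fibre_bound.
rewrite ger0_norm ?fejer_ge0// ler_pdivlMr//.
have ry : y ^+ 2 <= 4 * r ^+ 2.
  have -> : 4 * r ^+ 2 = (2 * `|r|) ^+ 2 by rewrite exprMn sqr_normr; ring.
  rewrite -sqr_normr lerXn2r ?nnegrE// ?mulr_ge0//.
  move/fibP: rF; rewrite -/y => rF.
  have := ler_distD r y 0; rewrite !subr0; lra.
apply: (@le_trans _ _ (4 * (K * r ^+ 2 * fejer K r))); last first.
  by have := fejer_decay r K0; lra.
have -> : fejer K r * (K * y ^+ 2) = K * fejer K r * y ^+ 2 by ring.
have -> : 4 * (K * r ^+ 2 * fejer K r) = K * fejer K r * (4 * r ^+ 2) by ring.
by rewrite ler_wpM2l// mulr_ge0 ?fejer_ge0// ltW.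
Qed.

(** For [|r| <= eta] the oscillation of [h] is at most [w]; beyond, it is at most [2 M] while the
    kernel is below [4 / (K eta^2)]. *)
Lemma approx_near K x w eta : 0 < K -> 0 < eta -> 0 <= w ->
  (forall x r, `|r| <= eta -> `|h x - h (x - r *: one)| <= w) ->
  `|vmax x| <= 2 * C ->
  `|h x * fejer_center K - Theta h K x| <=
    w * fejer_center K + 8 * M / (K * eta ^+ 2) * (2 * B).
Proof.
move=> K0 e0 w0 hw hx.
have fK r : `|fejer K r| <= K by exact: fejer_norm.
have ik := fibre_conv_integrable d0 ch hM hC x (measurable_fejer K) fK.
have iJ := fejer_center_integrable K0.
have E0 : 0 < K * eta ^+ 2 by rewrite mulr_gt0// exprn_gt0.
have F0 r := fejer_ge0 r K0.
set D := 8 * M / (K * eta ^+ 2).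
have D0 : 0 <= D by rewrite divr_ge0 ?mulr_ge0// ltW.
have iD : mu.-integrable setT (EFin \o (fun r => D * \1_(`[(- B)%R, B]%classic) r)).
  exact: (integrableZl measurableT D (integrable_indic_itv (- B) B true false)).
have -> : D * (2 * B) = \int[mu]_r (D * \1_(`[(- B)%R, B]%classic) r).
  rewrite RintegralZl//; last exact: integrable_indic_itv.
  rewrite /Rintegral integral_indic// setIT /= lebesgue_measure_itv/= lte_fin.
  have -> : - B < B by have := C0'; lra.
  by rewrite -EFinB/=; congr (_ * _); ring.
rewrite /fejer_center /Theta /fibre_conv -!(RintegralZl _ measurableT iJ).
rewrite -RintegralB//; last exact: (integrableZl measurableT _ iJ).
rewrite -RintegralD//; last exact: (integrableZl measurableT _ iJ).
have iS := Rintegrable_sub (Rintegrable_scale (h x) iJ) ik.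
apply: (le_trans (le_normr_Rintegral measurableT iS)).
apply: le_Rintegral => //.
- exact: (integrable_norm iS).
- exact: Rintegrable_add (Rintegrable_scale w iJ) iD.
move=> r _.
have [rB|rB] := boolP (r \in `[(- B)%R, B]%classic); last first.
  rewrite indicE (negbTE rB) !mulr0 sub0r addr0 normrN.
  have -> : h (x - r *: one) = 0.
    apply/eqP; apply: contraNT rB => /hC; rewrite -scaleNr (vmaxD d0) => l.
    rewrite inE/= in_itv/= -ler_norml.
    have := ler_distD (vmax x) r 0; rewrite !subr0 [`|r - _|]distrC; lra.
  by rewrite mul0r normr0.
rewrite indicE rB !mulr1 -mulrBl normrM (ger0_norm (F0 r)).
have [re|re] := leP `|r| eta.
  by rewrite -[leLHS]addr0 lerD// ler_wpM2r// hw.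
have Dr : 2 * M * fejer K r <= D.
  rewrite /D ler_pdivlMr//.
  have e2 : eta ^+ 2 <= r ^+ 2 by rewrite -[leRHS]sqr_normr lerXn2r ?nnegrE// ltW.
  have : K * eta ^+ 2 * fejer K r <= 4.
    by apply: le_trans (fejer_decay r K0); rewrite ler_wpM2r// ler_pM2l.
  move: (K * eta ^+ 2) (fejer K r) => a f l.
  have -> : 2 * M * f * a = 2 * M * (a * f) by ring.
  have -> : 8 * M = 2 * M * 4 by ring.
  by rewrite ler_wpM2l// mulr_ge0.
rewrite -[leLHS]add0r; apply: lerD; first exact: mulr_ge0.
apply: le_trans Dr; rewrite ler_wpM2r//.
by have := ler_normB (h x) (h (x - r *: one)); have := hM x; have := hM (x - r *: one); lra.
Qed.

(** The quadratic decay of the Fejer kernel is exactly what an error of the form [bump (vmax x)]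
    allows far from the support of [h]. *)
Lemma fejer_approx e : 0 < e -> exists K : R, 0 < K /\ exists2 J : R, 0 < J &
  forall x, `|h x * J - Theta h K x| <= e * J * bump (vmax x).
Proof.
move=> e0; have c1 := @cos1_gt0 R.
(* [1 / Q] is the least value of [bump] on [|y| <= 2 C]. *)
set Q := 1 + 4 * C ^+ 2.
have Q0 : 0 < Q by rewrite ltr_pwDl// mulr_ge0// exprn_ge0.
have w0 : 0 < e / (2 * Q) by rewrite divr_gt0// mulr_gt0.
have [eta eta0 hw] := hU w0.
(* The second term makes the part [|r| > eta] of the near error small, the third the far error; both
   are compared with [2 cos 1], a lower bound of the mass. *)
pose K := 1 + 16 * M * B * Q / (e * cos 1 * eta ^+ 2) + 32 * M * C / (e * cos 1).
have k1 : 0 <= 16 * M * B * Q / (e * cos 1 * eta ^+ 2).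
  rewrite divr_ge0//; first by rewrite !mulr_ge0// ltW.
  by rewrite !mulr_ge0// ltW.
have k2 : 0 <= 32 * M * C / (e * cos 1) by rewrite divr_ge0// !mulr_ge0// ltW.
have K1 : 1 <= K by rewrite /K; lra.
have K0 : 0 < K by lra.
have J1 : 2 * cos 1 <= fejer_center K.
  apply: fejer_mass => //; apply: (@le_trans _ _ 1); first by rewrite invf_le1.
  by have := C1; lra.
have J0 : 0 < fejer_center K by apply: lt_le_trans J1; rewrite mulr_gt0.
exists K; split => //; exists (fejer_center K) => // x.
set y := vmax x; have yp : 0 < 1 + y ^+ 2 by rewrite ltr_pwDl// sqr_ge0.
rewrite /bump ler_pdivlMr//.
have [hx|hx] := leP `|y| (2 * C).
  have := approx_near K0 eta0 (ltW w0) hw hx; set L := `|_ - _|; move=> HL.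
  have L0 : 0 <= L by exact: normr_ge0.
  have yQ : 1 + y ^+ 2 <= Q.
    rewrite /Q lerD2l -sqr_normr (_ : 4 * C ^+ 2 = (2 * C) ^+ 2); last by ring.
    by rewrite lerXn2r ?nnegrE// mulr_ge0.
  apply: (@le_trans _ _ (L * Q)); first by rewrite ler_wpM2l.
  have tE : 8 * M / (K * eta ^+ 2) * (2 * B) * Q <= e * cos 1.
    have -> : 8 * M / (K * eta ^+ 2) * (2 * B) * Q = (16 * M * B * Q / eta ^+ 2) / K.
      by field; rewrite !lt0r_neq0.
    rewrite ler_pdivrMr// -ler_pdivrMl ?mulr_gt0//.
    apply: (@le_trans _ _ (16 * M * B * Q / (e * cos 1 * eta ^+ 2))); last by rewrite /K; lra.
    by rewrite le_eqVlt; apply/orP; left; apply/eqP; field; rewrite !lt0r_neq0.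
  apply: (@le_trans _ _ (e / 2 * fejer_center K + e * cos 1)).
    apply: (le_trans (ler_wpM2r (ltW Q0) HL)); rewrite mulrDl; apply: lerD => //.
    by rewrite le_eqVlt; apply/orP; left; apply/eqP; field; rewrite !lt0r_neq0.
  have := ler_wpM2l (ltW e0) J1; lra.
have -> : h x = 0.
  by apply/eqP/negP => /negP/hC; rewrite -/y => l; have := C1; lra.
rewrite mul0r sub0r normrN.
have := approx_far K0 hx; rewrite -/y; set L := `|_|; move=> HL.
have y1 : 1 <= y ^+ 2.
  rewrite -sqr_normr; have h1 : 1 <= `|y| by have := C1; lra.
  by rewrite expr_ge1.
have y0 : 0 < y ^+ 2 by lra.
apply: (@le_trans _ _ (L * (2 * y ^+ 2))); first by rewrite ler_wpM2l// ?normr_ge0//; lra.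
apply: (@le_trans _ _ (64 * M * C / K)).
  apply: (le_trans (ler_wpM2r _ HL)); first by rewrite mulr_ge0// ltW.
  by rewrite le_eqVlt; apply/orP; left; apply/eqP; field; rewrite (lt0r_neq0 K0); apply: contraTneq y0 => ->; rewrite expr0n ltxx.
apply: (@le_trans _ _ (e * (2 * cos 1))); last by rewrite ler_pM2l.
rewrite ler_pdivrMr// -ler_pdivrMl ?mulr_gt0//.
apply: (@le_trans _ _ (32 * M * C / (e * cos 1))); last by rewrite /K; lra.
by rewrite le_eqVlt; apply/orP; left; apply/eqP; field; rewrite !lt0r_neq0.
Qed.

End Approximation.

Section RegularityTheorem.
Context {R : realType} {d : nat} {dO : measure_display} {Omega : measurableType dO}.
Local Notation V := 'rV[R]_d.
Local Notation one := (@ones R d).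
Local Notation mu := (@lebesgue_measure R).
Variable P : probability Omega R.
Hypothesis d0 : (0 < d)%N.
Variable Y : nat -> Omega -> V.
Hypothesis mY : forall n, measurable_fun setT (Y n : Omega -> VB R d).
Hypothesis HD : forall K : R, 0 < K -> exists2 c : R, 0 < c &
  forall t : R, 0 < t -> t <= K -> forall M (G : V -> R), eqv t M G -> forall n : nat, c^-1 <= n%:R ->
  `|Ex P (fun w => G (Y n w))| <= M * expR (- (c * n%:R * t ^+ 2)).
Variables (h : V -> R) (M C : R).
Hypothesis ch : continuous h.
Hypothesis hM : forall x, `|h x| <= M.
Hypothesis hC : forall x, h x != 0 -> `|vmax x| <= C.
Hypothesis C1 : 1 <= C.
Hypothesis hU : forall w : R, 0 < w -> exists2 eta : R, 0 < eta &
  forall x r, `|r| <= eta -> `|h x - h (x - r *: one)| <= w.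

Let M0 : 0 <= M. Proof. exact: le_trans (hM 0). Qed.
Let C0 : 0 <= C. Proof. exact: le_trans C1. Qed.

Lemma measurable_shiftY n a : measurable_fun setT (fun w => Y n w + a *: one : VB R d).
Proof. exact: (measurableT_comp (measurable_shift a) (mY n)). Qed.

(** [eqv_diff] brings a factor [t |a - b|], and the integral of [t exp (- c n t^2)] is at most
    [1 / (2 c n)]. *)
Lemma Theta_reg (K : R) : 0 < K -> exists D : R, 0 <= D /\ exists N : nat,
  forall n, (N <= n)%N -> forall a b,
  n%:R * `|Ex P (fun w => Theta h K (Y n w + a *: one)) -
     Ex P (fun w => Theta h K (Y n w + b *: one))| <= D * `|a - b|.
Proof.
move=> K0; have [c c0 H] := HD K0.
exists (2 * (M * (2 * C)) * 2 / (2 * c)); split.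
  by rewrite divr_ge0 ?mulr_ge0// ltW.
exists (Num.bound c^-1).+1 => n Nn a b.
have cn : c^-1 <= n%:R.
  have := archi_boundP (ltW (ltac:(by rewrite invr_gt0) : 0 < c^-1)).
  by move=> /ltW l; apply: (le_trans l); rewrite ler_nat ltnW.
have n0 : 0 < n%:R :> R by apply: lt_le_trans cn; rewrite invr_gt0.
have fK r : `|fejer K r| <= K by exact: fejer_norm.
have bT e : bm (fun w => Theta h K (Y n w + e *: one)).
  exact: (bm_comp (bm_fibre_conv d0 ch hM hC C0 (measurable_fejer K) fK) (measurable_shiftY n e)).
rewrite -ExB//.
pose g (z : Omega * R) := fibre_cos h z.2 (Y n z.1 + a *: one) - fibre_cos h z.2 (Y n z.1 + b *: one).
pose Mg := M * (2 * C) + M * (2 * C).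
have gt t x : `|fibre_cos h t x| <= M * (2 * C).
  by have [_ l _] := eqv_fibre_cos d0 ch hM hC C0 t.
have mg : measurable_fun setT g.
  have mG e : measurable_fun setT (fun z : Omega * R => fibre_cos h z.2 (Y n z.1 + e *: one)).
    apply: (measurableT_comp (measurable_fibre_cos ch) (g := fun z : Omega * R => (Y n z.1 + e *: one : VB R d, z.2))).
    apply: measurable_fun_pair; last exact: measurable_snd.
    exact: (measurableT_comp (measurable_shiftY n e) measurable_fst).
  by apply: measurable_funB.
have gM z : `|g z| <= Mg by apply: (le_trans (ler_normB _ _)); exact: lerD.
have iG x : mu.-integrable setT (EFin \o (fun t => triangle K t * fibre_cos h t x)).
  apply: (triangle_mul_integrable (M := M * (2 * C)) K0) => //.
  exact: (measurableT_comp (measurable_fibre_cos ch) (measurable_pair1 (x : VB R d))).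
have E w : Theta h K (Y n w + a *: one) - Theta h K (Y n w + b *: one) =
    2 * \int[mu]_t (triangle K t * g (w, t)).
  rewrite !(ThetaE d0 ch hM hC)// -mulrBr -RintegralB//; congr (_ * _).
  by apply: eq_Rintegral => t _; rewrite /g mulrBr.
have bI : bm (fun w => \int[mu]_t (triangle K t * g (w, t))).
  have := bmZ 2^-1 (bmB (bT a) (bT b)).
  by under eq_fun do rewrite E mulrA mulVf// mul1r.
have -> : (fun w => Theta h K (Y n w + a *: one) - Theta h K (Y n w + b *: one)) =
    (fun w => 2 * \int[mu]_t (triangle K t * g (w, t))) by apply/funext.
rewrite ExZ// normrM ger0_norm//.
pose Q := 2 * `|a - b| * (M * (2 * C)).
have Q0 : 0 <= Q by rewrite !mulr_ge0.
have cE := @continuous_gauss R (c * n%:R).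
have cB : continuous (fun t : R => Q * (t * expR (- (c * n%:R * t ^+ 2)))).
  by move=> t; apply: cvgM; [exact: cvg_cst|apply: cvgM; [exact: cvg_id|exact: cE]].
have le1 := @triangle_Ex_le R _ _ P K Mg g _ K0 mg gM cB.
have {}le1 : `|Ex P (fun w => \int[mu]_t (triangle K t * g (w, t)))| <=
    Q * \int[mu]_(t in `[0, K]) (t * expR (- (c * n%:R * t ^+ 2))).
  rewrite -RintegralZl//; last first.
    apply: continuous_compact_integrable; first exact: segment_compact.
    apply: continuous_subspaceT => t.
    by apply: cvgM; [exact: cvg_id|exact: cE].
  apply: le1 => t t0 tK.
  move: t0; rewrite le_eqVlt => /predU1P[t0|t0].
    have z : Ex P (fun w => g (w, t)) = 0.
      rewrite -[RHS](Ex_cst P); congr Ex; apply/funext => w; rewrite /g/=.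
      have [_ l _] := eqv_diff a b (ltac:(by rewrite -t0) : 0 <= t) (eqv_fibre_cos d0 ch hM hC C0 t).
      apply/eqP; rewrite -normr_le0; apply: (le_trans (l (Y n w))).
      by rewrite -t0 !(mul0r, mulr0).
    by rewrite z normr0 !mulr_ge0// ?expR_ge0// -t0.
  have := H t t0 tK _ _ (eqv_diff a b (ltW t0) (eqv_fibre_cos d0 ch hM hC C0 t)) n cn.
  move=> l; apply: (le_trans l); rewrite le_eqVlt; apply/orP; left; apply/eqP.
  by rewrite /Q; ring.
have cn0 : 0 < c * n%:R by rewrite mulr_gt0.
have {}le1 := le_trans le1 (ler_wpM2l Q0 (gauss_t_integral cn0 K0)).
have n1 := lt0r_neq0 n0; have c1 := lt0r_neq0 c0.
apply: (le_trans (ler_wpM2l (ltW n0) (ler_wpM2l _ le1))) => //.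
by rewrite le_eqVlt; apply/orP; left; apply/eqP; rewrite /Q; field; rewrite n1 c1.
Qed.

Lemma local_reg e : 0 < e -> exists2 eta : R, 0 < eta & exists N : nat,
  forall n, (N <= n)%N -> forall a b, `|a - b| <= eta * Num.sqrt n%:R ->
  Num.sqrt n%:R * `|Ex P (fun w => h (Y n w + a *: one)) -
     Ex P (fun w => h (Y n w + b *: one))| <= e.
Proof.
move=> e0; have [CB CB0 [N1 HB]] := bump_bound d0 mY HD.
(* [CB] is the concentration constant: each replacement of [h] by its Fejer mean will cost
   [e / 4]. *)
have e1 : 0 < e / (4 * CB) by rewrite divr_gt0// mulr_gt0.
have [K [K0 [J J0 HA]]] := fejer_approx d0 ch hM hC C1 hU e1.
have [D [D0 [N2 HT]]] := Theta_reg K0.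
(* For [|a - b| <= eta sqrt n] the bound [D |a - b| / n], multiplied by [sqrt n], is at most
   [e J / 2]; [D + 1] avoids a division by 0. *)
exists (e * J / (2 * (D + 1))); first by rewrite !(divr_gt0, mulr_gt0)// ltr_wpDl.
exists (maxn 1 (maxn N1 N2)) => n; rewrite !geq_max => /andP[n1 /andP[nN1 nN2]] a b ab.
have n0 : 0 < n%:R :> R by rewrite ltr0n.
have s0 : 0 < Num.sqrt n%:R :> R by rewrite sqrtr_gt0.
have s2 : Num.sqrt n%:R ^+ 2 = n%:R :> R by rewrite sqr_sqrtr// ltW.
have fK r : `|fejer K r| <= K by exact: fejer_norm.
have bT f : bm (fun w => Theta h K (Y n w + f *: one)).
  exact: (bm_comp (bm_fibre_conv d0 ch hM hC C0 (measurable_fejer K) fK) (measurable_shiftY n f)).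
have bh f : bm (fun w => h (Y n w + f *: one)).
  split; last by exists M.
  exact: (measurableT_comp (VB_cont_real ch) (measurable_shiftY n f)).
have bb f : bm (fun w => bump (vmax (Y n w) + f)) by apply: bm_bump; exact: measurable_vmaxY.
have A f : Num.sqrt n%:R * `|J * Ex P (fun w => h (Y n w + f *: one)) -
    Ex P (fun w => Theta h K (Y n w + f *: one))| <= e / 4 * J.
  rewrite -ExZ// -ExB//; last exact: bmZ.
  apply: (@le_trans _ _ (Num.sqrt n%:R * (e / (4 * CB) * J * Ex P (fun w => bump (vmax (Y n w) + f))))).
    rewrite ler_pM2l// -ExZ//; apply: Ex_norm_le; [by apply: bmB => //; exact: bmZ|exact: bmZ|].
    by move=> w; rewrite [J * _]mulrC -(vmaxD d0).
  rewrite mulrCA.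
  apply: (@le_trans _ _ (e / (4 * CB) * J * CB)).
    by rewrite ler_wpM2l ?HB// mulr_ge0// ltW.
  by rewrite le_eqVlt; apply/orP; left; apply/eqP; field; rewrite lt0r_neq0.
have T := HT n nN2 a b.
have Aa := A a; have Ab := A b.
move: (Ex P (fun w => h (Y n w + a *: one))) (Ex P (fun w => h (Y n w + b *: one)))
  (Ex P (fun w => Theta h K (Y n w + a *: one))) (Ex P (fun w => Theta h K (Y n w + b *: one)))
  Aa Ab T => ha hb Ta Tb Aa Ab T.
set s := Num.sqrt n%:R in s0 s2 ab Aa Ab *.
have T' : s * `|Ta - Tb| <= e / 2 * J.
  rewrite -(ler_pM2l s0) mulrA -expr2 s2 (le_trans T)//.
  apply: (le_trans (ler_wpM2l D0 ab)).
  have -> : D * (e * J / (2 * (D + 1)) * s) = (D / (D + 1)) * (s * (e / 2 * J)).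
    by field; rewrite lt0r_neq0// ltr_wpDl.
  rewrite -[leRHS]mul1r ler_wpM2r//; first by rewrite !mulr_ge0// ?divr_ge0// ltW.
  by rewrite ler_pdivrMr ?mul1r ?lerDl// ltr_wpDl.
rewrite -(ler_pM2l J0).
have -> : J * (s * `|ha - hb|) = s * `|J * (ha - hb)| by rewrite normrM (gtr0_norm J0) mulrCA.
have -> : J * (ha - hb) = (J * ha - Ta) + (Ta - Tb) - (J * hb - Tb) by ring.
apply: (@le_trans _ _ (s * (`|J * ha - Ta| + `|Ta - Tb| + `|J * hb - Tb|))).
  rewrite ler_pM2l//; apply: (le_trans (ler_normB _ _)); rewrite lerD2r; exact: ler_normD.
by rewrite !mulrDr; lra.
Qed.

End RegularityTheorem.

(** * Central limit theorem and mixing *)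

Section Min1.
Context {R : realType}.
Implicit Types a b c : R.

Lemma min1_ge0 a : 0 <= a -> 0 <= Num.min 1 a.
Proof. by move=> a0; rewrite le_min ler01. Qed.

Lemma min1_le a b : a <= b -> Num.min 1 a <= Num.min 1 b.
Proof. by move=> ab; rewrite le_min !ge_min lexx/= ab orbT. Qed.

Lemma min1D a b : 0 <= a -> 0 <= b -> Num.min 1 (a + b) <= Num.min 1 a + Num.min 1 b.
Proof.
move=> a0 b0.
have [a1|a1] := leP 1 a; first by rewrite ge_min lerDl min1_ge0.
have [b1|b1] := leP 1 b; first by rewrite ge_min lerDr a0.
by rewrite ge_min lexx orbT.
Qed.

Lemma min1Z c a : 1 <= c -> 0 <= a -> Num.min 1 (c * a) <= c * Num.min 1 a.
Proof.
move=> c1 a0; have [a1|a1] := leP 1 a.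
  by rewrite mulr1 ge_min c1.
by rewrite ge_min lexx orbT.
Qed.

Lemma min1_lip a b : `|Num.min 1 a - Num.min 1 b| <= `|a - b|.
Proof.
have h u c : u <= c -> `|Num.min 1 u - Num.min 1 c| <= `|u - c|.
  move=> uc; rewrite !ler0_norm ?subr_le0 ?min1_le// !opprB.
  by have [c1|c1] := leP 1 c; have [u1|u1] := leP 1 u; lra.
by have [ab|/ltW ab] := leP a b; [exact: h|rewrite distrC [leRHS]distrC; exact: h].
Qed.

End Min1.

Section VanishingMin.
Context {R : realType} {dO : measure_display} {Omega : measurableType dO}.
Variable P : probability Omega R.

Lemma bm_min1_div (f : Omega -> R) c : measurable_fun setT f -> 0 <= c ->
  bm (fun w => Num.min 1 (`|f w| / c)).
Proof.
move=> mf c0; apply: bm_min1 => [|w]; last by rewrite divr_ge0.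
by apply: measurable_funM; [exact: measurableT_comp|exact: measurable_cst].
Qed.

(** The mean of [min 1 |f|] measures smallness in probability for arbitrary [f]. By dominated
    convergence a fixed variable is negligible at scale [sqrt n]. *)
Lemma Ex_min1_cvg (f : Omega -> R) : measurable_fun setT f ->
  forall e, 0 < e -> exists N : nat, forall n, (N <= n)%N ->
    Ex P (fun w => Num.min 1 (`|f w| / Num.sqrt n%:R)) <= e.
Proof.
move=> mf e e0.
have cv : (fun n : nat => Ex P (fun w => Num.min 1 (`|f w| / Num.sqrt n%:R))) @ \oo --> Ex P (fun=> 0).
  apply: (Ex_cvg (M := 1)).
  - by move=> n; case: (bm_min1_div mf (sqrtr_ge0 n%:R)).
  - exact: measurable_cst.
  - move=> n w; rewrite ger0_norm; first by rewrite ge_min lexx.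
    by rewrite min1_ge0// divr_ge0// sqrtr_ge0.
  move=> w; apply/cvgrPdist_le => d d0; near=> n.
  rewrite sub0r normrN ger0_norm; last by rewrite min1_ge0// divr_ge0// sqrtr_ge0.
  rewrite ge_min; apply/orP; right.
  have n1 : (0 < n)%N by near: n; exists 1%N.
  have s0 : 0 < Num.sqrt n%:R :> R by rewrite sqrtr_gt0 ltr0n.
  rewrite ler_pdivrMr// mulrC -ler_pdivrMr//.
  have q0 : 0 <= `|f w| / d by rewrite divr_ge0// ltW.
  rewrite -[leLHS](ger0_norm q0) -sqrtr_sqr; apply: ler_wsqrtr.
  apply: (le_trans (ltW (archi_boundP (exprn_ge0 2 q0)))); rewrite ler_nat.
  by near: n; exists (Num.bound ((`|f w| / d) ^+ 2)).
have /cvgrPdist_le/(_ e e0)[N _ HN] := cv.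
exists N => n /HN /=; rewrite Ex_cst sub0r normrN; apply: le_trans; exact: ler_norm.
Unshelve. all: by end_near. Qed.

End VanishingMin.

Section Mixing.
Context {R : realType} {d : nat} {dO : measure_display} {Omega : measurableType dO}.
Local Notation V := 'rV[R]_d.
Local Notation one := (@ones R d).
Variable P : probability Omega R.
Variable A : nat -> Omega -> V -> V.
Variable X0 : Omega -> V.
Hypothesis d0 : (0 < d)%N.
Hypothesis tA : forall n w, (0 < n)%N -> topical_op (A n w).
Hypothesis mA : forall n, (0 < n)%N -> measurable_fun setT (A n : Omega -> OpB R d).
Hypothesis mX0 : measurable_fun setT (X0 : Omega -> VB R d).
Hypothesis iX : indep P A X0.
Variables (gamma sigma : R).
Hypothesis CLT : forall f : V -> R, continuous f -> (exists M : R, forall x, `|f x| <= M) ->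
     (fun n : nat => Ex P (fun w => f ((Num.sqrt n%:R)^-1 *: (xn A X0 n w - (n%:R * gamma) *: one))))
       @ \oo --> gauss_exp sigma (fun z => f (z *: one)).
Variable nu0 : probability (VB R d) R.
Hypothesis inv : chain_invariant P A nu0.
Variable N : nat.
Hypothesis PN : (0 < P (rank1_event A N))%E.

(** Invariance says that [nu0] is the law of [pr (A 1 w y)] under [nu0 x P]; [F] does not see
    [pr]. *)
Lemma Ex_invariant (F : VB R d -> R) : bm F -> proj_inv F -> Ex nu0 F = Ex nu0 (Pop P A F).
Proof.
move=> bF iF; have [_ H] := inv.
pose f (z : VB R d * Omega) : VB R d := pr (A 1%N z.2 z.1).
have mf : measurable_fun setT f.
  have mc := caratheodory (fun x => measurable_A mA x (ltn0Sn 0))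
    (fun w => topical_op_cont (tA w (ltn0Sn 0))).
  apply: (measurableT_comp (VB_cont (pr_cont d0))).
  exact: (measurableT_comp mc (measurable_fun_pair measurable_snd measurable_fst)).
have bFf : bm (fun z => F (f z)) by exact: bm_comp bF mf.
transitivity (Ex (distribution (nu0 \x P)%E (mfun_of mf)) F).
  rewrite /Ex; congr fine; apply: eq_measure_integral => B mB _.
  transitivity (\int[nu0]_y P [set w | B (pr (A 1%N w y))])%E; first exact: H.
  apply: eq_integral => y _ /=; congr (P _).
  by apply/seteqP; split => w; rewrite /xsection /= inE.
rewrite Ex_distribution// /Pop.
have [mg [M gM]] := bFf.
rewrite [LHS](@RFubini_prod _ _ _ _ _ nu0 P _ (cst `|M|) (cst 1) mg) //.
- congr Ex; apply/funext => y; congr Ex; apply/funext => w.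
  by rewrite /f/= (proj_inv_pr _ iF).
- exact: finite_measure_integrable_cst.
- exact: finite_measure_integrable_cst.
- by move=> x y; rewrite mulr1 (le_trans (gM _))// ler_norm.
Qed.

(** The oscillation of the iterates tends to 0 geometrically while their [nu0]-mean is constant. *)
Lemma Pop_limit (F : VB R d -> R) e : bm F -> proj_inv F -> 0 < e ->
  exists k : nat, forall x, `|iter k (Pop P A) F x - Ex nu0 F| <= e.
Proof.
move=> bF iF e0; have [_ [M FM]] := bF.
have Fb x y : `|F x - F y| <= M + M by apply: (le_trans (ler_normB _ _)); exact: lerD.
set p := fine (P (rank1_event A N)).
have mR := measurable_rank1 d0 tA mA N.
have p0 : 0 < p by apply: fine_gt0; rewrite PN/= ltey_eq fin_num_measure.
have p1 : p <= 1.
  by rewrite /p -lee_fin fineK ?fin_num_measure// probability_le1.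
have M0 : 0 <= M by apply: le_trans (FM 0).
have c0 : (fun q : nat => (1 - p) ^+ q) @ \oo --> 0.
  by apply: cvg_expr; rewrite ger0_norm; lra.
have e1 : 0 < e / (M + M + 1) by rewrite divr_gt0// ltr_wpDl// addr_ge0.
have /cvgrPdist_le/(_ _ e1)[q _ /(_ q (leqnn q))] := c0.
rewrite /= sub0r normrN ger0_norm; last by rewrite exprn_ge0// subr_ge0.
rewrite ler_pdivlMr; last by rewrite ltr_wpDl// addr_ge0.
move=> qe; exists (q * N)%N => x.
have -> : Ex nu0 F = Ex nu0 (iter (q * N) (Pop P A) F).
  elim: (q * N)%N => //= k ->; apply: Ex_invariant; first exact: bm_iter_Pop.
  exact: proj_inv_Pop.
have bI := bm_iter_Pop P tA mA (q * N) bF.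
rewrite -[X in X - _](Ex_cst nu0) -ExB//; last exact: bm_cst.
apply: Ex_bound => [|y]; first by apply: bmB => //; exact: bm_cst.
apply: (le_trans (osc_contraction_iter d0 tA mA iX N q bF iF Fb x y)).
apply: le_trans qe; rewrite ler_wpM2l ?lerDl//.
by rewrite exprn_ge0// subr_ge0.
Qed.

Let v n w := vmax (xn A X0 n w).

Lemma measurable_v n : measurable_fun setT (v n).
Proof. exact: (measurableT_comp (measurable_vmax d0) (measurable_xn tA mA mX0 n)). Qed.

Definition osc (x : V) : R := vmax x + vmax (- x).

Lemma osc_shift x c : osc (x + c *: one) = osc x.
Proof. by rewrite /osc opprD -scaleNr !vmaxD//; ring. Qed.

Lemma osc_scale x (c : R) : 0 <= c -> osc (c *: x) = c * osc x.
Proof. by move=> c0; rewrite /osc -scalerN !(vmaxZ d0)// mulrDr. Qed.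

Lemma osc_lip x y : `|osc x - osc y| <= 2 * `|x - y|.
Proof.
have -> : osc x - osc y = (vmax x - vmax y) + (vmax (- x) - vmax (- y)) by rewrite /osc; ring.
have -> : 2 * `|x - y| = `|x - y| + `|- x - - y| by rewrite -opprD normrN -mulr2n mulr_natl.
by apply: (le_trans (ler_normD _ _)); apply: lerD; exact: vmax_lip.
Qed.

Lemma osc_cont : continuous osc.
Proof. exact: (@lip_continuous R V R^o 2 _ osc_lip). Qed.

Lemma gauss_exp0 : gauss_exp sigma (fun=> 0) = 0 :> R.
Proof.
rewrite /gauss_exp; case: ifP => // _.
rewrite (_ : (fun z => _) = (fun=> 0%E)) ?integral0//.
by apply/funext => z; rewrite mul0r.
Qed.

(** The Gaussian limit is carried by the multiples of [ones], where [osc] vanishes; the central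
    limit theorem is applied to [min 1 osc]. *)
Lemma osc_small e : 0 < e -> exists n0 : nat, forall n, (n0 <= n)%N ->
  Ex P (fun w => Num.min 1 (osc (xn A X0 n w) / Num.sqrt n%:R)) <= e.
Proof.
move=> e0.
have cf : continuous (fun x : V => Num.min 1 (osc x)).
  apply: (@lip_continuous R V R^o 2) => x y.
  exact: le_trans (min1_lip _ _) (osc_lip x y).
have := CLT cf; have bd : exists M : R, forall x, `|Num.min 1 (osc x)| <= M.
  by exists 1 => x; rewrite ger0_norm ?ge_min ?lexx// min1_ge0// vmaxN_ge0.
move=> /(_ bd).
have -> : (fun z => Num.min 1 (osc (z *: one))) = (fun=> 0).
  apply/funext => z; rewrite -[z *: one]add0r osc_shift /osc oppr0 (vmax0 d0) addr0.
  by rewrite min_r.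
rewrite gauss_exp0 => /cvgrPdist_le/(_ e e0)[n0 _ H].
exists n0 => n /H /=; rewrite sub0r normrN => /(le_trans (ler_norm _)).
congr (_ <= _); congr Ex; apply/funext => w; congr (Num.min 1 _).
have s0 : 0 <= (Num.sqrt n%:R)^-1 :> R by rewrite invr_ge0 sqrtr_ge0.
by rewrite osc_scale// -scaleNr osc_shift mulrC.
Qed.

Lemma step_bound n w : `|v n.+1 w - v n w| <= `|vmax (A n.+1 w 0)| + osc (xn A X0 n w).
Proof.
have tv : topical_fun (@vmax R d \o A n.+1 w).
  by apply: topical_fun_comp; [exact: topical_vmax|exact: tA].
have := topical_fun_osc d0 (xn A X0 n w) tv; rewrite /= -/(osc _) => h.
rewrite /v /xn /= -/(xn A X0 n w).
have -> : vmax (A n.+1 w (xn A X0 n w)) - vmax (xn A X0 n w) =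
  vmax (A n.+1 w 0) + (vmax (A n.+1 w (xn A X0 n w)) - vmax (A n.+1 w 0) - vmax (xn A X0 n w)) by ring.
by apply: (le_trans (ler_normD _ _)); rewrite lerD2l.
Qed.

Lemma measurable_osc n : measurable_fun setT (fun w => osc (xn A X0 n w)).
Proof. exact: (measurableT_comp (VB_cont_real osc_cont) (measurable_xn tA mA mX0 n)). Qed.

(** By [step_bound] the increment of the height is at most a variable whose law does not depend on
    [n], plus the oscillation of the state; both are negligible at scale [sqrt n]. *)
Lemma step_small e : 0 < e -> exists n0 : nat, forall n, (n0 <= n)%N ->
  Ex P (fun w => Num.min 1 (`|v n.+1 w - v n w| / Num.sqrt n%:R)) <= e.
Proof.
move=> e0; have e2 : 0 < e / 2 by rewrite divr_gt0.
have mv0 n : measurable_fun setT (fun w => vmax (A n.+1 w 0)).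
  exact: (measurableT_comp (measurable_vmax d0) (measurable_A mA 0 (ltn0Sn n))).
have [n1 H1] := osc_small e2; have [n2 H2] := Ex_min1_cvg P (mv0 0%N) e2.
exists (maxn n1 n2) => n; rewrite geq_max => /andP[nn1 nn2].
have s0 : 0 <= Num.sqrt n%:R :> R := sqrtr_ge0 _.
have o0 w : 0 <= osc (xn A X0 n w) by exact: vmaxN_ge0.
have b1 : bm (fun w => Num.min 1 (osc (xn A X0 n w) / Num.sqrt n%:R)).
  apply: bm_min1 => [|w]; last by rewrite divr_ge0.
  by apply: measurable_funM; [exact: measurable_osc|exact: measurable_cst].
have b2 := bm_min1_div (mv0 n) s0.
have E2 : Ex P (fun w => Num.min 1 (`|vmax (A n.+1 w 0)| / Num.sqrt n%:R)) <= e / 2.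
  apply: le_trans (H2 n nn2); rewrite le_eqVlt; apply/orP; left; apply/eqP.
  apply: (@Ex_law _ _ _ _ (VB R d) P (fun w => A n.+1 w 0) (fun w => A 1%N w 0)
    (fun x => Num.min 1 (`|vmax x| / Num.sqrt n%:R))).
  - exact: measurable_A.
  - exact: measurable_A.
  - move=> B mB.
    have mE : measurable ((fun F : OpB R d => F 0) @^-1` B).
      by rewrite -[X in measurable X]setTI; exact: eval_measurable.
    exact: (same_law iX (ltn0Sn n) mE).
  - exact: (bm_min1_div (measurable_vmax d0) s0).
have -> : e = e / 2 + e / 2 by lra.
apply: le_trans (lerD E2 (H1 n nn1)); rewrite -ExD//; apply: Ex_le.
- apply: bm_min1_div => //; apply: measurable_funB; exact: measurable_v.
- exact: bmD.
move=> w; apply: le_trans (min1D _ _); rewrite ?divr_ge0//.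
by rewrite -mulrDl; apply: min1_le; rewrite ler_wpM2r ?invr_ge0//; exact: step_bound.
Qed.

Lemma lag_small k e : 0 < e -> exists n0 : nat, forall m, (n0 <= m)%N ->
  Ex P (fun w => Num.min 1 (`|v (m + k) w - v m w| / Num.sqrt m%:R)) <= e.
Proof.
elim: k e => [|k IH] e e0.
  exists 0%N => m _; rewrite addn0; under eq_fun do rewrite subrr normr0 mul0r min_r//.
  by rewrite Ex_cst ltW.
have e2 : 0 < e / 2 by rewrite divr_gt0.
have k1 : 1 <= k.+1%:R :> R by rewrite ler1n.
have k0 : 0 < k.+1%:R :> R by rewrite ltr0n.
have e3 : 0 < e / 2 / k.+1%:R by rewrite divr_gt0.
have [n1 H1] := IH _ e2; have [n2 H2] := step_small e3.
exists (maxn 1 (maxn n1 n2)) => m; rewrite !geq_max => /andP[m0 /andP[mn1 mn2]].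
have s0 : 0 < Num.sqrt m%:R :> R by rewrite sqrtr_gt0 ltr0n.
have bv i j n : bm (fun w => Num.min 1 (`|v i w - v j w| / Num.sqrt n%:R)).
  apply: bm_min1_div; last exact: sqrtr_ge0.
  by apply: measurable_funB; exact: measurable_v.
have E2 := H2 (m + k)%N (leq_trans mn2 (leq_addr _ _)).
have -> : e = e / 2 + k.+1%:R * (e / 2 / k.+1%:R) by field; rewrite lt0r_neq0.
apply: le_trans (lerD (H1 m mn1) (ler_wpM2l (ltW k0) E2)).
rewrite -ExZ// -ExD//; last exact: bmZ.
apply: Ex_le => //; first by apply: bmD => //; exact: bmZ.
move=> w; rewrite addnS.
set a := v (m + k).+1 w; set b := v (m + k) w; set c := v m w.
apply: (@le_trans _ _ (Num.min 1 (`|b - c| / Num.sqrt m%:R + k.+1%:R * (`|a - b| / Num.sqrt (m + k)%:R)))).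
  (* Passing from the scale at time [m + k] to the one at time [m] costs a factor [k + 1], as [m] is
     positive. *)
  apply: min1_le; have smk : Num.sqrt (m + k)%:R <= k.+1%:R * Num.sqrt m%:R :> R.
    rewrite -[k.+1%:R]ger0_norm// -sqrtr_sqr -sqrtrM ?sqr_ge0//.
    apply: ler_wsqrtr; rewrite -natrX -natrM ler_nat.
    by apply: (@leq_trans (k.+1 * m)); [rewrite mulSn leq_add2l leq_pmulr|rewrite leq_mul2r expnS leq_pmulr ?expn_gt0 ?orbT].
  have smk0 : 0 < Num.sqrt (m + k)%:R :> R by rewrite sqrtr_gt0 ltr0n addn_gt0 m0.
  have h1 : `|a - b| / Num.sqrt m%:R <= k.+1%:R * (`|a - b| / Num.sqrt (m + k)%:R).
    rewrite mulrCA ler_wpM2l// ler_pdivlMr// mulrC ler_pdivrMr//.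
  apply: le_trans (lerD (lexx _) h1); rewrite -mulrDl ler_wpM2r ?invr_ge0 ?(ltW s0)//.
  by rewrite [leRHS]addrC; exact: ler_distD.
have nn n : 0 <= `|a - b| / Num.sqrt n%:R by rewrite divr_ge0 ?sqrtr_ge0.
have nc : 0 <= `|b - c| / Num.sqrt m%:R by rewrite divr_ge0 ?sqrtr_ge0.
apply: (le_trans (min1D nc _)); first by rewrite mulr_ge0 ?(ltW k0) ?nn.
by rewrite lerD2l; apply: min1Z => //; rewrite divr_ge0 ?sqrtr_ge0.
Qed.

End Mixing.

(** * Gaussian estimates *)

Section Bell.
Context {R : realType}.
Local Notation mu := (@lebesgue_measure R).

Definition bell (x : R) : R := expR (- (x ^+ 2 / 2)).

Lemma bell_ge0 x : 0 <= bell x. Proof. exact: expR_ge0. Qed.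

Lemma bell_le1 x : bell x <= 1.
Proof. by rewrite -expR0 ler_expR oppr_le0 divr_ge0// sqr_ge0. Qed.

Lemma bell_lip x y : `|bell x - bell y| <= `|x - y|.
Proof.
rewrite -[leRHS]mul1r.
have dE (t : R) : is_derive t 1 bell (expR (- 2^-1 * (t * t)) * (- 2^-1 * (t * 1 + t * 1) + (t * t) * 0)).
  have -> : bell = (fun t => expR (- 2^-1 * (t * t))).
    by apply/funext => u; rewrite /bell; congr expR; rewrite expr2; field.
  exact: (deriv_comp (is_derive_expR _) (deriv_mul (deriv_cst (- 2^-1) t) (deriv_mul (deriv_id t) (deriv_id t)))).
apply: (derive_lip dE) => t.
have -> : - 2^-1 * (t * 1 + t * 1) + t * t * 0 = - t by field.
rewrite normrM normrN ger0_norm ?expR_ge0// mulNr expRN.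
rewrite mulrC ler_pdivrMr ?expR_gt0// mul1r.
apply: le_trans (expR_ge1Dx _).
have -> : t * t = `|t| ^+ 2 by rewrite real_normK ?num_real// expr2.
have := sqr_ge0 (`|t| - 1); nra.
Qed.

Lemma bell_cont : continuous bell.
Proof. by apply: (@lip_continuous R R^o R^o 1) => x y; rewrite mul1r; exact: bell_lip. Qed.

Variable s : R.
Hypothesis s0 : 0 < s.
Local Notation pdf := (normal_pdf 0 s).
Local Notation gE := (gauss_exp s).

Lemma normal_pdf_bell x : pdf x = (s * Num.sqrt (2 * pi))^-1 * bell (x / s).
Proof.
have s1 := lt0r_neq0 s0.
rewrite /normal_pdf (negbTE s1) /normal_peak /normal_fun /bell subr0; congr (_^-1 * expR _).
  rewrite -mulr_natl mulrCA sqrtrM ?sqr_ge0// sqrtr_sqr ger0_norm//; exact: ltW.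
by rewrite -mulr_natl; field.
Qed.

Lemma normal_pdf_lip x y :
  `|pdf x - pdf y| <= (s * Num.sqrt (2 * pi))^-1 / s * `|x - y|.
Proof.
have q0 : 0 <= (s * Num.sqrt (2 * pi))^-1 by rewrite invr_ge0 mulr_ge0 ?sqrtr_ge0// ltW.
rewrite !normal_pdf_bell -mulrBr normrM ger0_norm// -mulrA ler_wpM2l//.
apply: (le_trans (bell_lip _ _)).
by rewrite -mulrBl normrM mulrC ger0_norm// invr_ge0 ltW.
Qed.

Lemma gauss_expE f : gE f = \int[mu]_z (f z * pdf z).
Proof. by rewrite /gauss_exp (negbTE (lt0r_neq0 s0)). Qed.

Lemma gauss_integrable (f : R -> R) : bm f -> mu.-integrable setT (EFin \o (fun z => f z * pdf z)).
Proof.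
move=> [mf [M fM]].
apply: (@le_integrable _ _ _ mu setT measurableT _ (fun r => (M%:E * (pdf r)%:E)%E)).
- apply/measurable_EFinP; apply: measurable_funM => //; exact: measurable_normal_pdf.
- move=> r _ /=; rewrite lee_fin !normrM (ger0_norm (normal_pdf_ge0 _ _ _)).
  by rewrite ler_wpM2r ?normal_pdf_ge0// (le_trans (fM r))// ler_norm.
- apply: integrableZl => //; exact: integrable_normal_pdf.
Qed.

Lemma gauss_cst c : gE (fun=> c) = c.
Proof.
rewrite gauss_expE RintegralZl//; last exact: integrable_normal_pdf.
by rewrite /Rintegral integral_normal_pdf /= mulr1.
Qed.

Lemma gauss_le f g : bm f -> bm g -> (forall x, f x <= g x) -> gE f <= gE g.
Proof.
move=> bf bg fg; rewrite !gauss_expE; apply: le_Rintegral => //; [exact: gauss_integrable|exact: gauss_integrable|].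
by move=> x _; rewrite ler_wpM2r ?normal_pdf_ge0.
Qed.

Lemma gaussD f g : bm f -> bm g -> gE (fun x => f x + g x) = gE f + gE g.
Proof.
move=> bf bg; rewrite !gauss_expE -RintegralD//; [|exact: gauss_integrable|exact: gauss_integrable].
by apply: eq_Rintegral => x _; rewrite mulrDl.
Qed.

Lemma gaussZ c f : bm f -> gE (fun x => c * f x) = c * gE f.
Proof.
move=> bf; rewrite !gauss_expE -RintegralZl//; last exact: gauss_integrable.
by apply: eq_Rintegral => x _; rewrite mulrA.
Qed.

Lemma gauss_dist f g c : bm f -> bm g -> (forall x, `|f x - g x| <= c) -> `|gE f - gE g| <= c.
Proof.
move=> bf bg fg; have bc := bm_cst (T1 := R) c.
have h k l : bm k -> bm l -> (forall x, `|k x - l x| <= c) -> gE k <= gE l + c.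
  move=> bk bl kl; rewrite -[X in _ + X](gauss_cst c) -gaussD//.
  apply: gauss_le => //; first exact: bmD.
  by move=> x; have := kl x; rewrite ler_norml => /andP[_]; lra.
have h1 := h f g bf bg fg.
have h2 : gE g <= gE f + c by apply: h => // x; rewrite distrC.
by rewrite ler_norml; apply/andP; split; lra.
Qed.

Lemma bm_tent eta a : 0 <= eta -> bm (fun z : R => tent eta (z - a)).
Proof.
move=> e0; split.
  apply: (measurableT_comp (measurable_tent eta)).
  by apply: measurable_funB => //; exact: measurable_cst.
by exists eta => z; rewrite ger0_norm ?tent_ge0// tent_le.
Qed.

(** Lipschitz constant of the density, times the half-width [eta] of the window, times its mass
    [eta^2]. *)
Lemma gauss_tent eta a : 0 <= eta ->
  `|gE (fun z => tent eta (z - a)) - eta ^+ 2 * pdf a| <=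
  (s * Num.sqrt (2 * pi))^-1 / s * eta ^+ 3.
Proof.
move=> e0; rewrite gauss_expE; set L := _ / s.
have it : mu.-integrable setT (EFin \o (fun z => tent eta (z - a))).
  have := integrable_reflect a (integrable_reflect 0 (tent_integrable e0)).
  by apply: eq_integrable => // r _ /=; congr (EFin (tent _ _)); ring.
have It : \int[mu]_z tent eta (z - a) = eta ^+ 2.
  by rewrite -(tent_integral e0) -(Rint_shift (- a) (tent_integrable e0)).
have iP := gauss_integrable (bm_tent a e0).
have -> : eta ^+ 2 * pdf a = \int[mu]_z (pdf a * tent eta (z - a)).
  by rewrite RintegralZl// It mulrC.
have -> : L * eta ^+ 3 = \int[mu]_z (L * eta * tent eta (z - a)).
  by rewrite RintegralZl// It; ring.
rewrite -RintegralB//; last exact: Rintegrable_scale.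
have iS := Rintegrable_sub iP (Rintegrable_scale (pdf a) it).
apply: (le_trans (le_normr_Rintegral measurableT iS)).
apply: le_Rintegral => //.
- exact: (integrable_norm iS).
- exact: Rintegrable_scale.
move=> z _; rewrite [pdf a * _]mulrC -mulrBr normrM (ger0_norm (tent_ge0 _ _)) mulrC.
have [za|za] := leP eta `|z - a|; first by rewrite (tent_out za) !mulr0.
rewrite ler_wpM2r ?tent_ge0//; apply: (le_trans (normal_pdf_lip z a)).
rewrite -/L ler_wpM2l ?(ltW za)// /L divr_ge0 ?(ltW s0)//.
by rewrite invr_ge0 mulr_ge0 ?sqrtr_ge0// ltW.
Qed.

(** A Lipschitz cut-off, 1 for [|x| <= L - 1] and 0 for [|x| >= L], so that tails can be controlled
    by the central limit theorem. *)
Definition plateau L (x : R) : R := Num.min 1 (tent L x).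

Lemma plateau_ge0 L x : 0 <= plateau L x.
Proof. by rewrite min1_ge0// tent_ge0. Qed.

Lemma plateau_le1 L x : plateau L x <= 1. Proof. by rewrite ge_min lexx. Qed.

Lemma plateau_lip L x y : `|plateau L x - plateau L y| <= `|x - y|.
Proof. exact: le_trans (min1_lip _ _) (tent_lip _ _ _). Qed.

Lemma bm_plateau L : bm (plateau L).
Proof. by apply: bm_min1; [exact: measurable_tent|move=> x; exact: tent_ge0]. Qed.

Lemma tent_plateau eta L a x : 0 <= eta -> L + eta <= `|a| ->
  tent eta (x - a) <= eta * (1 - plateau L x).
Proof.
move=> e0 aL; have [xa|xa] := leP eta `|x - a|.
  by rewrite (tent_out xa) mulr_ge0// subr_ge0 plateau_le1.
rewrite /plateau (@tent_out _ L x); last first.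
  by have := ler_distD x a 0; rewrite !subr0 [`|a - x|]distrC; lra.
by rewrite min_r// subr0 mulr1 tent_le.
Qed.

Lemma gauss_tail e : 0 < e -> exists L : R, 1 - gE (plateau L) <= e.
Proof.
move=> e0.
have cv : (fun n : nat => gE (plateau n%:R)) @ \oo --> (1 : R).
  rewrite -[X in _ --> X](gauss_cst 1) gauss_expE.
  under eq_fun do rewrite gauss_expE.
  have mE n : measurable_fun setT (EFin \o (fun z => plateau n%:R z * pdf z)).
    by case/integrableP: (gauss_integrable (bm_plateau n%:R)).
  have ip := @integrable_normal_pdf R 0 s.
  have cE : {ae mu, forall x, setT x -> (fun n : nat => (EFin \o (fun z => plateau n%:R z * pdf z)) x) @ \oo
      --> (EFin \o (fun z => 1 * pdf z)) x}.
    apply: aeW => x _ /=; apply: cvg_EFin; first exact: nearW.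
    apply/cvgrPdist_le => e1 e10; near=> n.
    have h : 1 <= tent n%:R x.
      rewrite /tent le_max; apply/orP; right; rewrite lerBrDr.
      have hx := archi_boundP (normr_ge0 x).
      apply: (@le_trans _ _ (1 + (Num.bound `|x|)%:R)); first by rewrite lerD2l ltW.
      rewrite [1 + _]addrC natr1 ler_nat.
      by near: n; exists (Num.bound `|x|).+1.
    have p1 : plateau n%:R x = 1 by exact: min_l.
    rewrite /= p1.
    by rewrite subrr normr0 ltW.
  have bE : {ae mu, forall x n, setT x -> (`|(EFin \o (fun z => plateau n%:R z * pdf z)%R) x| <= (pdf x)%:E)%E}.
    apply: aeW => x n _ /=; rewrite lee_fin normrM (ger0_norm (plateau_ge0 _ _)).
    by rewrite (ger0_norm (normal_pdf_ge0 _ _ _)) ler_piMl ?normal_pdf_ge0 ?plateau_le1.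
  have mf : measurable_fun setT (EFin \o (fun z => 1 * pdf z)).
    by case/integrableP: (gauss_integrable (bm_cst (T1 := R) 1)).
  have [i1 _ c1] := @dominated_convergence _ (measurableTypeR R) R mu setT measurableT _ _ _ mE mf cE ip bE.
  apply: fine_cvg; rewrite fineK; last exact: (integrable_fin_num measurableT i1).
  exact: c1.
have /cvgrPdist_le/(_ e e0)[n _ /(_ n (leqnn n))] := cv.
by move=> h; exists n%:R; exact: le_trans (ler_norm _) h.
Unshelve. all: by end_near. Qed.

End Bell.

Section LocalLimit.
Context {R : realType} {d : nat} {dO : measure_display} {Omega : measurableType dO}.
Local Notation V := 'rV[R]_d.
Local Notation one := (@ones R d).
Local Notation mu := (@lebesgue_measure R).
Variable P : probability Omega R.
Variable A : nat -> Omega -> V -> V.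
Variable X0 : Omega -> V.
Hypothesis d0 : (0 < d)%N.
Hypothesis tA : forall n w, (0 < n)%N -> topical_op (A n w).
Hypothesis mA : forall n, (0 < n)%N -> measurable_fun setT (A n : Omega -> OpB R d).
Hypothesis mX0 : measurable_fun setT (X0 : Omega -> VB R d).
Hypothesis iX : indep P A X0.
Variables (gamma sigma : R).
Hypothesis CLT : forall f : V -> R, continuous f -> (exists M : R, forall x, `|f x| <= M) ->
     (fun n : nat => Ex P (fun w => f ((Num.sqrt n%:R)^-1 *: (xn A X0 n w - (n%:R * gamma) *: one))))
       @ \oo --> gauss_exp sigma (fun z => f (z *: one)).
Variable nu0 : probability (VB R d) R.
Hypothesis inv : chain_invariant P A nu0.
Variable N : nat.
Hypothesis PN : (0 < P (rank1_event A N))%E.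

Let v n w := vmax (xn A X0 n w).
Let Z n w := (v n w - n%:R * gamma) / Num.sqrt n%:R.

Lemma measurable_Z n : measurable_fun setT (Z n).
Proof.
apply: measurable_funM; last exact: measurable_cst.
apply: measurable_funB; last exact: measurable_cst.
exact: (measurable_v d0 tA mA mX0).
Qed.

Lemma CLT_vmax (k : R -> R) (c M : R) : (forall x y, `|k x - k y| <= c * `|x - y|) ->
  (forall x, `|k x| <= M) -> 0 <= c ->
  (fun n : nat => Ex P (fun w => k (Z n w))) @ \oo --> gauss_exp sigma k.
Proof.
move=> kc kM c0.
have cf : continuous (fun x : V => k (vmax x)).
  apply: (@lip_continuous R V R^o c) => x y; apply: (le_trans (kc _ _)).
  by rewrite ler_wpM2l// vmax_lip.
have := CLT cf (ex_intro _ M (fun x => kM (vmax x))).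
have -> : (fun z => k (vmax (z *: one))) = k.
  by apply/funext => z; rewrite -[z *: one]add0r (vmaxD d0) (vmax0 d0) add0r.
have -> : (fun n : nat => Ex P (fun w => k (Z n w))) = (fun n : nat => Ex P (fun w =>
    k (vmax ((Num.sqrt n%:R)^-1 *: (xn A X0 n w - (n%:R * gamma) *: one))))).
  apply/funext => n; congr Ex; apply/funext => w; congr k.
  by rewrite (vmaxZ d0) ?invr_ge0 ?sqrtr_ge0// -scaleNr (vmaxD d0) mulrC.
exact.
Qed.

Lemma bm_tentZ eta n a : 0 <= eta -> bm (fun w => tent eta (Z n w - a)).
Proof. by move=> e0; exact: (bm_comp (bm_tent a e0) (measurable_Z n)). Qed.

(** Weak convergence treats one centre [a] at a time. A bounded set of centres is covered by
    compactness and the Lipschitz bound; remote centres only see tails, small for the law and for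
    its limit by tightness. *)
Lemma tent_uniform eta e : 0 < sigma -> 0 < eta -> 0 < e -> exists n0 : nat,
  forall n, (n0 <= n)%N -> forall a,
  `|Ex P (fun w => tent eta (Z n w - a)) - gauss_exp sigma (fun z => tent eta (z - a))| <= e.
Proof.
move=> s0 eta0 e0; have e3 : 0 < e / 3 by rewrite divr_gt0.
have tl a x y : `|tent eta (x - a) - tent eta (y - a)| <= 1 * `|x - y|.
  rewrite mul1r; apply: (le_trans (tent_lip _ _ _)).
  by rewrite opprB addrA subrK.
have tl' a b x : `|tent eta (x - a) - tent eta (x - b)| <= `|a - b|.
  apply: (le_trans (tent_lip _ _ _)).
  have -> : x - a - (x - b) = b - a by ring.
  by rewrite distrC.
have tM a x : `|tent eta (x - a)| <= eta by rewrite ger0_norm ?tent_ge0// tent_le// ltW.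
have bt a := bm_tent a (ltW eta0).
have btZ n a := bm_tentZ n a (ltW eta0).
have e4 : 0 < e / (4 * eta) by rewrite divr_gt0// mulr_gt0.
(* A remote window has height at most [eta] and lives where the plateau vanishes, hence the tail
   level [e / (4 eta)]. *)
have [L HL] := gauss_tail s0 e4.
have /cvgrPdist_le/(_ _ e4)[n1 _ H1] := CLT_vmax (k := plateau L) (c := 1) (M := 1)
  (ltac:(by move=> x y; rewrite mul1r; exact: plateau_lip))
  (ltac:(by move=> x; rewrite ger0_norm ?plateau_ge0 ?plateau_le1)) ler01.
have far n a : (n1 <= n)%N -> L + eta <= `|a| ->
  `|Ex P (fun w => tent eta (Z n w - a)) - gauss_exp sigma (fun z => tent eta (z - a))| <= e.
  move=> nn1 aL; have tp x := tent_plateau x (ltW eta0) aL.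
  have bp := bm_plateau (R := R) L.
  have bpZ : bm (fun w => plateau L (Z n w)) by exact: (bm_comp bp (measurable_Z n)).
  have g1 : gauss_exp sigma (fun z => tent eta (z - a)) <= eta * (1 - gauss_exp sigma (plateau L)).
    have -> : 1 - gauss_exp sigma (plateau L) = gauss_exp sigma (fun z => 1 + -1 * plateau L z).
      rewrite gaussD ?gaussZ ?gauss_cst//; first by rewrite mulN1r.
        exact: bm_cst.
      exact: bmZ.
    rewrite -gaussZ//; last by apply: bmD; [exact: bm_cst|exact: bmZ].
    apply: gauss_le => // [|x]; last by rewrite mulN1r; exact: tp.
    by apply: bmZ; apply: bmD; [exact: bm_cst|exact: bmZ].
  have g0 : 0 <= gauss_exp sigma (fun z => tent eta (z - a)).
    rewrite -[leLHS](gauss_cst s0); apply: gauss_le => //; first exact: bm_cst.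
    by move=> x; exact: tent_ge0.
  have f1 : Ex P (fun w => tent eta (Z n w - a)) <= eta * (1 - Ex P (fun w => plateau L (Z n w))).
    rewrite -[X in X - _](Ex_cst P) -ExB//; last exact: bm_cst.
    rewrite -ExZ; last by apply: bmB => //; exact: bm_cst.
    apply: Ex_le => //.
    by apply: bmZ; apply: bmB => //; exact: bm_cst.
  have f0 : 0 <= Ex P (fun w => tent eta (Z n w - a)) by apply: Ex_ge0 => w; exact: tent_ge0.
  have := H1 n nn1; rewrite /= => hn.
  have g2 : gauss_exp sigma (fun z => tent eta (z - a)) <= e / 4.
    apply: (le_trans g1); apply: (le_trans (ler_wpM2l (ltW eta0) HL)).
    by rewrite le_eqVlt; apply/orP; left; apply/eqP; field; rewrite lt0r_neq0.
  have f2 : Ex P (fun w => tent eta (Z n w - a)) <= e / 2.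
    apply: (le_trans f1).
    have l2 : 1 - Ex P (fun w => plateau L (Z n w)) <= 2 * (e / (4 * eta)).
      move: hn; rewrite ler_norml => /andP[_]; move: HL; lra.
    apply: (le_trans (ler_wpM2l (ltW eta0) l2)).
    by rewrite le_eqVlt; apply/orP; left; apply/eqP; field; rewrite lt0r_neq0.
  by rewrite ler_norml; apply/andP; split; lra.
pose Q (n : nat) (a : R) := `|Ex P (fun w => tent eta (Z n w - a)) - gauss_exp sigma (fun z => tent eta (z - a))| <= e.
have /compact_near_coveringP/(_ nat \oo Q) := @segment_compact R (- (L + eta)) (L + eta).
case.
  move=> a0 _.
  have /cvgrPdist_le/(_ _ e3)[n2 _ H2] := CLT_vmax (tl a0) (tM a0) ler01.
  exists (ball a0 (e / 3), [set n | (n2 <= n)%N]) => /=.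
    by split; [exact: nbhsx_ballx|exists n2].
  move=> [a n] /= [ba nn2]; rewrite /Q.
  have ab : `|a - a0| <= e / 3 by rewrite distrC ltW//; move: ba; rewrite -ball_normE.
  have h1 : `|Ex P (fun w => tent eta (Z n w - a)) - Ex P (fun w => tent eta (Z n w - a0))| <= e / 3.
    rewrite -ExB//; apply: Ex_bound => [|w]; first exact: bmB.
    exact: le_trans (tl' a a0 _) ab.
  have h2 : `|gauss_exp sigma (fun z => tent eta (z - a)) - gauss_exp sigma (fun z => tent eta (z - a0))| <= e / 3.
    apply: gauss_dist => // x; exact: le_trans (tl' a a0 _) ab.
  have h3 := H2 n nn2; move: h1 h2 h3 => /=.
  move: (Ex P (fun w => tent eta (Z n w - a))) (Ex P (fun w => tent eta (Z n w - a0)))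
    (gauss_exp sigma (fun z => tent eta (z - a))) (gauss_exp sigma (fun z => tent eta (z - a0))) => p q r t.
  by rewrite !ler_norml => /andP[? ?] /andP[? ?] /andP[? ?]; apply/andP; split; lra.
move=> n2 _ H2; exists (maxn n1 n2) => n; rewrite geq_max => /andP[nn1 nn2] a.
have [aL|aL] := leP (L + eta) `|a|; first exact: far.
apply: (H2 n nn2 a); rewrite /= in_itv/= -ler_norml; exact: ltW.
Qed.

(* [k] steps mix the projective part but do not change the limit of the rescaled height [Z]. *)
Lemma mixing (eta e : R) (F : VB R d -> R) : 0 < eta -> bm F -> proj_inv F -> 0 < e -> exists n0 : nat,
  forall n, (n0 <= n)%N -> forall a,
  `|Ex P (fun w => F (xn A X0 n w) * tent eta (Z n w - a)) -
    Ex nu0 F * Ex P (fun w => tent eta (Z n w - a))| <= e.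
Proof.
move=> eta0 bF iF e0; have [mF [M FM]] := bF.
have M0 : 0 <= M by apply: le_trans (FM 0).
have p1 : 0 < 2 * (eta + 1) by rewrite mulr_gt0// ltr_wpDl// ltW.
have p2 : 0 < 4 * (M + 1) * (1 + eta) by rewrite !mulr_gt0 ?ltr_wpDl// ltr_pwDl// ltW.
have [k Hk] := Pop_limit d0 tA mA iX inv PN bF iF (divr_gt0 e0 p1).
have [n0 Hl] := lag_small d0 tA mA mX0 iX CLT k (divr_gt0 e0 p2).
exists (maxn 1 n0 + k)%N => n nk a.
have [m nE] : exists m, n = (m + k)%N by exists (n - k)%N; rewrite subnK// (leq_trans _ nk)// leq_addl.
subst n; move: nk; rewrite leq_add2r geq_max => /andP[m1 mn0].
(* The normalization of time [m + k] is kept even when [psi] is evaluated at time [m], so that the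
   two values differ only through the lag of the height. *)
pose psi (x : V) := tent eta ((vmax x - (m + k)%:R * gamma) / Num.sqrt (m + k)%:R - a).
have bpsi : bm (psi : VB R d -> R).
  apply: (bm_comp (bm_tent a (ltW eta0)) (g := fun x : VB R d => (vmax x - (m + k)%:R * gamma) / Num.sqrt (m + k)%:R)).
  apply: measurable_funM; last exact: measurable_cst.
  by apply: measurable_funB; [exact: measurable_vmax|exact: measurable_cst].
have bx (G : VB R d -> R) n : bm G -> bm (fun w => G (xn A X0 n w)).
  by move=> bG; exact: (bm_comp bG (measurable_xn tA mA mX0 n)).
have bI := bm_iter_Pop P tA mA k bF.
have H1 := markov_iter tA mA mX0 iX m k bpsi bF.
have lag := Hl m mn0.
set lg := (fun w => Num.min 1 _) in lag.
have sm0 : 0 < Num.sqrt m%:R :> R by rewrite sqrtr_gt0 ltr0n.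
have smk : Num.sqrt m%:R <= Num.sqrt (m + k)%:R :> R by rewrite ler_wsqrtr// ler_nat leq_addr.
have smk0 : 0 < Num.sqrt (m + k)%:R :> R by apply: lt_le_trans smk.
have blg : bm lg.
  apply: bm_min1_div; last exact: sqrtr_ge0.
  by apply: measurable_funB; exact: (measurable_v d0 tA mA mX0).
(* [psi] has values in [[0, eta]] and is Lipschitz in the rescaled height; the truncated lag
   accounts for both bounds. *)
have dl w : `|psi (xn A X0 (m + k) w) - psi (xn A X0 m w)| <= (1 + eta) * lg w.
  set x := psi _; set y := psi _.
  have x0 : 0 <= x <= eta by rewrite tent_ge0 tent_le// ltW.
  have y0 : 0 <= y <= eta by rewrite tent_ge0 tent_le// ltW.
  have xye : `|x - y| <= eta by rewrite ler_norml; lra.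
  have xyd : `|x - y| <= `|v (m + k) w - v m w| / Num.sqrt m%:R.
    apply: (le_trans (tent_lip _ _ _)); rewrite opprB addrA subrK -mulrBl opprB addrA subrK.
    rewrite normrM [`|_^-1|]ger0_norm ?invr_ge0 ?(ltW smk0)//.
    by rewrite ler_wpM2l// lef_pV2 ?posrE.
  rewrite /lg -/(v _ _) -/(v m w); move: xyd; set z := _ / _ => xyd.
  have [z1|z1] := leP 1 z; first by rewrite mulr1; lra.
  apply: (le_trans xyd); rewrite ler_peMl ?lerDl ?(ltW eta0)//.
  exact: le_trans xyd.
set EL := Ex P lg in lag.
have bZ1 := bx _ (m + k)%N bpsi; have bZ0 := bx _ m bpsi; have bFx := bx _ (m + k)%N bF.
have bIx := bx _ m bI.
have EL1 : `|Ex P (fun w => F (xn A X0 (m + k) w) * psi (xn A X0 (m + k) w)) -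
    Ex P (fun w => psi (xn A X0 m w) * F (xn A X0 (m + k) w))| <= M * (1 + eta) * EL.
  rewrite -ExB ?/EL -?ExZ//; [|exact: bmM|exact: bmM].
  apply: Ex_norm_le; [by apply: bmB; exact: bmM|exact: bmZ|] => w.
  by rewrite [X in _ - X]mulrC -mulrBr normrM -mulrA ler_pM.
have EL2 : `|Ex P (fun w => psi (xn A X0 m w) * iter k (Pop P A) F (xn A X0 m w)) -
    Ex nu0 F * Ex P (fun w => psi (xn A X0 m w))| <= e / 2.
  rewrite -ExZ// -ExB//; [|exact: bmM|exact: bmZ].
  apply: Ex_bound => [|w]; first by apply: bmB; [exact: bmM|exact: bmZ].
  rewrite [X in X - _]mulrC -mulrBl normrM.
  apply: (@le_trans _ _ (e / (2 * (eta + 1)) * eta)).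
    by apply: ler_pM => //; rewrite ger0_norm ?tent_ge0// tent_le// ltW.
  rewrite mulrAC ler_pdivrMr//; move: e0 eta0; nra.
have EL3 : `|Ex P (fun w => psi (xn A X0 m w)) - Ex P (fun w => psi (xn A X0 (m + k) w))| <= (1 + eta) * EL.
  rewrite distrC -ExB// ?/EL -?ExZ//; apply: Ex_norm_le => //; [exact: bmB|exact: bmZ].
have nuM : `|Ex nu0 F| <= M by exact: Ex_bound.
rewrite H1 in EL1.
have EL0 : 0 <= EL by apply: Ex_ge0 => w; rewrite min1_ge0// divr_ge0// ltW.
have bnd : M * (1 + eta) * EL <= e / 4.
  apply: (@le_trans _ _ ((M + 1) * (1 + eta) * (e / (4 * (M + 1) * (1 + eta))))).
    apply: ler_pM => //; first by rewrite mulr_ge0// addr_ge0// ltW.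
    by rewrite ler_wpM2r ?lerDl// addr_ge0// ltW.
  have u1 : M + 1 != 0 by rewrite lt0r_neq0// ltr_wpDl.
  have u2 : 1 + eta != 0 by rewrite lt0r_neq0// ltr_pwDl// ltW.
  by rewrite le_eqVlt; apply/orP; left; apply/eqP; field; rewrite u1 u2.
rewrite -[X in Ex nu0 F * X]/(Ex P (fun w => psi (xn A X0 (m + k) w))).
rewrite -[X in `|X - _|]/(Ex P (fun w => F (xn A X0 (m + k) w) * psi (xn A X0 (m + k) w))).
have EL4 : `|Ex nu0 F * Ex P (fun w => psi (xn A X0 m w)) - Ex nu0 F * Ex P (fun w => psi (xn A X0 (m + k) w))| <= e / 4.
  rewrite -mulrBr normrM; apply: le_trans bnd; rewrite -mulrA; exact: ler_pM.
have EL1' := le_trans EL1 bnd.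
move: EL1' EL2 EL4.
move: (Ex P (fun w => F (xn A X0 (m + k) w) * psi (xn A X0 (m + k) w)))
 (Ex P (fun w => psi (xn A X0 m w) * iter k (Pop P A) F (xn A X0 m w)))
 (Ex nu0 F * Ex P (fun w => psi (xn A X0 m w)))
 (Ex nu0 F * Ex P (fun w => psi (xn A X0 (m + k) w))) => p q r t.
by rewrite !ler_norml => /andP[? ?] /andP[? ?] /andP[? ?]; apply/andP; split; lra.
Qed.

End LocalLimit.

(** * The local limit *)

Section TentAverage.
Context {R : realType} {d : nat}.
Local Notation V := 'rV[R]_d.
Local Notation one := (@ones R d).
Local Notation mu := (@lebesgue_measure R).
Hypothesis d0 : (0 < d)%N.
Variables (h : V -> R) (M C : R).
Hypothesis ch : continuous h.
Hypothesis hM : forall x, `|h x| <= M.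
Hypothesis hC : forall x, h x != 0 -> `|vmax x| <= C.
Hypothesis C1 : 1 <= C.

Let M0 : 0 <= M. Proof. exact: le_trans (hM 0). Qed.
Let C0 : 0 <= C. Proof. exact: le_trans C1. Qed.

Lemma tentZ (s eta y : R) : 0 <= s -> tent (eta * s) (s * y) = s * tent eta y.
Proof.
move=> s0; rewrite /tent normrM (ger0_norm s0) [eta * s]mulrC -mulrBr.
have [l|l] := leP 0 (eta - `|y|).
  by apply/max_idPr; rewrite mulr_ge0.
by rewrite mulr0; apply/max_idPl; rewrite mulr_ge0_le0// ltW.
Qed.

Definition fibre_integral : V -> R := fibre_conv h (fun=> 1).

Let cst1 (r : R) : `|1 : R| <= 1. Proof. by rewrite normr1. Qed.
Let m1 : measurable_fun (setT : set R) (fun=> 1 : R). Proof. exact: measurable_cst. Qed.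

Lemma bm_fibre_integral : bm (fibre_integral : VB R d -> R).
Proof. exact: (bm_fibre_conv d0 ch hM hC C0 m1 cst1). Qed.

Lemma fibre_integral_le x : `|fibre_integral x| <= M * (2 * C).
Proof. by have := fibre_conv_le d0 ch hM hC C0 x m1 cst1; rewrite mulr1. Qed.

Lemma fibre_integral_inv : proj_inv fibre_integral.
Proof. by move=> x c; exact: (fibre_conv_shift d0 ch hM hC x c m1 cst1). Qed.

(** On the fibre [r] is within [C] of [vmax x] and the window is 1-Lipschitz. The error does not
    grow with [a]. *)
Lemma tent_average a x : 0 <= a ->
  `|\int[mu]_r (tent a r * h (x - r *: one)) - tent a (vmax x) * fibre_integral x| <=
  C * M * (2 * C).
Proof.
move=> a0.
have tn r : `|tent a r| <= a by rewrite ger0_norm ?tent_ge0 ?tent_le.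
have i1 : mu.-integrable setT (EFin \o (fun r => tent a r * h (x - r *: one))).
  have := fibre_conv_integrable d0 ch hM hC x (measurable_tent a) tn.
  by apply: eq_integrable => // r _ /=; rewrite mulrC.
have i2 : mu.-integrable setT (EFin \o (fun r => h (x - r *: one) * 1)).
  exact: (fibre_conv_integrable d0 ch hM hC x m1 cst1).
rewrite /fibre_integral /fibre_conv -RintegralZl// -RintegralB//; last exact: Rintegrable_scale.
have i3 := Rintegrable_sub i1 (Rintegrable_scale (tent a (vmax x)) i2).
apply: (le_trans (le_normr_Rintegral measurableT i3)).
rewrite -(fib_integral C0 x); apply: le_Rintegral => //.
- exact: (integrable_norm i3).
- apply: (@bs_integrable _ _ (C * M) (vmax x - C) (vmax x + C)).
    by apply: measurable_funM; [exact: measurable_cst|rewrite /fib; exact: measurable_indic].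
  by move=> r; rewrite ger0_norm// indicE; apply: mulr_ge0; [exact: mulr_ge0|].
move=> r _; rewrite mulr1 -mulrBl normrM -mulrA.
have [rF|rF] := pselect (fib C x r); last first.
  have := fibre_bound d0 hM hC x r; rewrite [\1_ _ _]indicE memNset// !mulr0 => l.
  have -> : `|h (x - r *: one)| = 0 by apply/eqP; rewrite eq_le l normr_ge0.
  by rewrite mulr0.
apply: ler_pM => //; last exact: fibre_bound.
by apply: (le_trans (tent_lip _ _ _)); move/fibP: rF; rewrite distrC.
Qed.

Section Random.
Context {dO : measure_display} {Omega : measurableType dO}.
Variable P : probability Omega R.
Variable Y : Omega -> V.
Hypothesis mY : measurable_fun setT (Y : Omega -> VB R d).

(** The first error comes from averaging the regularity over a window of mass [a^2], the second from
    [tent_average]. *)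
Lemma tent_average_Ex a b e : 0 <= a ->
  (forall r, `|r| <= a -> `|Ex P (fun w => h (Y w + (b - r) *: one)) -
     Ex P (fun w => h (Y w + b *: one))| <= e) ->
  `|a ^+ 2 * Ex P (fun w => h (Y w + b *: one)) -
    Ex P (fun w => tent a (vmax (Y w) + b) * fibre_integral (Y w))| <=
  a ^+ 2 * e + C * M * (2 * C).
Proof.
move=> a0 He.
have tn r : `|tent a r| <= a by rewrite ger0_norm ?tent_ge0 ?tent_le.
have myb : measurable_fun setT (fun w => Y w + b *: one : VB R d).
  exact: (measurableT_comp (measurable_shift b) mY).
have bh : bm (h : VB R d -> R) by split; [exact: VB_cont_real|exists M].
pose g r := Ex P (fun w => h (Y w + (b - r) *: one)).
have gM r : `|g r| <= M.
  apply: Ex_bound => // ; apply: (bm_comp bh (g := fun w => Y w + (b - r) *: one : VB R d)).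
  exact: (measurableT_comp (measurable_shift (b - r)) mY).
have mf : measurable_fun setT (fun z : Omega * R => tent a z.2 * h (Y z.1 + b *: one - z.2 *: one)).
  apply: measurable_funM; first exact: (measurableT_comp (measurable_tent a) measurable_snd).
  apply: (measurableT_comp (measurable_hfib ch) (g := fun z : Omega * R => (Y z.1 + b *: one : VB R d, z.2))).
  by apply: measurable_fun_pair; [exact: (measurableT_comp myb measurable_fst)|exact: measurable_snd].
have iI : mu.-integrable setT (EFin \o (fun r => a * \1_(`[(- a)%R, a]%classic) r)).
  exact: (integrableZl measurableT a (integrable_indic_itv (- a) a true false)).
have F := @RFubini R _ _ _ _ P mu _ (cst M) (fun r => a * \1_(`[(- a)%R, a]%classic) r) mf
  (finite_measure_integrable_cst _ _ measurableT) iI.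
have {}F : Ex P (fun w => \int[mu]_r (tent a r * h (Y w + b *: one - r *: one))) =
    \int[mu]_r (tent a r * g r).
  rewrite ExE F/=.
  - apply: eq_Rintegral => r _; rewrite -ExE ExZ.
      congr (_ * Ex _ _); apply/funext => w; congr h.
      by rewrite scalerBl addrA.
    apply: (bm_comp bh (g := fun w => Y w + b *: one - r *: one : VB R d)).
    under eq_fun do rewrite -scaleNr.
    exact: (measurableT_comp (measurable_shift (- r)) myb).
  - by [].
  - by move=> r; rewrite mulr_ge0// indicE.
  - by move=> w r; rewrite normrM mulrC ler_pM// tent_le_indic.
have mg : measurable_fun setT g.
  apply: (measurable_Rint2 P (f := fun z : R * Omega => h (Y z.2 + (b - z.1) *: one))).
  have -> : (fun z : R * Omega => h (Y z.2 + (b - z.1) *: one)) =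
     (fun z => h ((Y z.2 + b *: one) - z.1 *: one)).
    by apply/funext => z; congr h; rewrite scalerBl addrA.
  apply: (measurableT_comp (measurable_hfib ch) (g := fun z : R * Omega => (Y z.2 + b *: one : VB R d, z.1))).
  by apply: measurable_fun_pair; [exact: (measurableT_comp myb measurable_snd)|exact: measurable_fst].
have ig : mu.-integrable setT (EFin \o (fun r => tent a r * g r)).
  apply: (@bs_integrable _ _ (M * a) (- a) a).
    by apply: measurable_funM => //; exact: measurable_tent.
  by move=> r; rewrite normrM mulrC -mulrA ler_pM// tent_le_indic.
have it := tent_integrable a0.
have E1 : `|\int[mu]_r (tent a r * g r) - a ^+ 2 * Ex P (fun w => h (Y w + b *: one))| <= a ^+ 2 * e.
  rewrite -(tent_integral a0) -!RintegralZr// -RintegralB//; last first.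
    have := Rintegrable_scale (Ex P (fun w => h (Y w + b *: one))) it.
    by apply: eq_integrable => // r _ /=; rewrite mulrC.
  have i4 : mu.-integrable setT (EFin \o (fun r => tent a r * g r - tent a r * Ex P (fun w => h (Y w + b *: one)))).
    apply: Rintegrable_sub => //.
    have := Rintegrable_scale (Ex P (fun w => h (Y w + b *: one))) it.
    by apply: eq_integrable => // r _ /=; rewrite mulrC.
  apply: (le_trans (le_normr_Rintegral measurableT i4)); apply: le_Rintegral => //.
  - exact: (integrable_norm i4).
  - have := Rintegrable_scale e it.
    by apply: eq_integrable => // r _ /=; rewrite mulrC.
  move=> r _; rewrite -mulrBr normrM (ger0_norm (tent_ge0 _ _)).
  have [ra|ra] := leP a `|r|; first by rewrite tent_out// !mul0r.
  by rewrite ler_wpM2l ?tent_ge0// He// ltW.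
have mI : measurable_fun setT (fun w => \int[mu]_r (tent a r * h (Y w + b *: one - r *: one))).
  exact: (measurable_Rint2 mu mf).
have bT : bm (fun w => tent a (vmax (Y w) + b) * fibre_integral (Y w)).
  apply: bmM; last exact: (bm_comp bm_fibre_integral mY).
  have := bm_comp (bm_tent (- b) a0) (measurableT_comp (measurable_vmax d0) mY).
  by under eq_fun do rewrite /= opprK.
have ptw w : `|\int[mu]_r (tent a r * h (Y w + b *: one - r *: one)) -
    tent a (vmax (Y w) + b) * fibre_integral (Y w)| <= C * M * (2 * C).
  have := tent_average (Y w + b *: one) a0.
  by rewrite (vmaxD d0) fibre_integral_inv.
have bI : bm (fun w => \int[mu]_r (tent a r * h (Y w + b *: one - r *: one))).
  split=> //; have [_ [B HB]] := bT; exists (C * M * (2 * C) + B) => w.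
  rewrite -[X in `|X|](subrK (tent a (vmax (Y w) + b) * fibre_integral (Y w))).
  by apply: (le_trans (ler_normD _ _)); exact: lerD.
have E2 : `|\int[mu]_r (tent a r * g r) - Ex P (fun w => tent a (vmax (Y w) + b) * fibre_integral (Y w))|
    <= C * M * (2 * C).
  by rewrite -F -ExB//; apply: Ex_bound => //; exact: bmB.
move: E1 E2.
move: (\int[mu]_r (tent a r * g r)) (a ^+ 2 * Ex P (fun w => h (Y w + b *: one))) (a ^+ 2 * e)
  (Ex P (fun w => tent a (vmax (Y w) + b) * fibre_integral (Y w))) (C * M * (2 * C)) => p q r t u.
by rewrite !ler_norml => /andP[? ?] /andP[? ?]; apply/andP; split; lra.
Qed.

End Random.
End TentAverage.

(** * Continuous functions with compact support *)

Section CompactSupport.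
Context {R : realType} {d : nat}.
Local Notation V := 'rV[R]_d.
Local Notation one := (@ones R d).
Hypothesis d0 : (0 < d)%N.
Variable h : V -> R.
Hypothesis ch : continuous h.
Hypothesis hK : compact (closure [set x | h x != 0]).

Lemma support_bounded : exists2 C : R, 1 <= C & forall x, h x != 0 -> `|x| <= C.
Proof.
have [M [_ HM]] := compact_bounded hK.
exists (Num.max 1 (M + 1)); first by rewrite le_max lexx.
move=> x hx; apply: HM; last by apply: subset_closure.
by rewrite lt_max; apply/orP; right; rewrite ltrDl.
Qed.

Lemma norm_scale_ones (r : R) : `|r *: one| <= `|r|.
Proof. by apply: norm_le_coord => // i; rewrite !mxE mulr1. Qed.

Lemma compact_support_le : exists M : R, forall x, `|h x| <= M.
Proof.
have [C C1 HC] := support_bounded.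
have /compact_bounded[M [_ HM]] : compact (h @` [set x | `|x| <= C]).
  apply: continuous_compact; last exact: compact_norm_ball.
  exact: continuous_subspaceT.
exists (Num.max 0 (M + 1)) => x.
have [->|hx] := eqVneq (h x) 0; first by rewrite normr0 le_max lexx.
apply: HM; first by rewrite lt_max; apply/orP; right; rewrite ltrDl.
by exists x => //=; exact: HC.
Qed.

Lemma compact_support_unif (w : R) : 0 < w -> exists2 eta : R, 0 < eta &
  forall x r, `|r| <= eta -> `|h x - h (x - r *: one)| <= w.
Proof.
move=> w0; have [C C1 HC] := support_bounded.
pose Q (eta : R) (x : V) := forall r, `|r| <= eta -> `|h x - h (x - r *: one)| <= w.
(* The radius exceeds [C] by 1: for [|r| <= 1] and [x] outside this ball, both values of [h] are
   0. *)
have /compact_near_coveringP/(_ R (0 : R)^'+ Q) := @compact_norm_ball R d (C + 1).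
case.
  move=> x0 _ /=.
  have w2 : 0 < w / 2 by rewrite divr_gt0.
  have /cvgrPdist_lt/(_ _ w2)/nbhs_ballP[r /= r0 Hr] := @ch x0.
  have r2 : 0 < r / 2 by rewrite divr_gt0.
  have hb y : `|x0 - y| < r -> `|h x0 - h y| < w / 2.
    by move=> l; apply: Hr; rewrite -ball_normE.
  exists (ball x0 (r / 2), [set c | c < r / 2]) => /=.
    split; first exact: nbhsx_ballx.
    exact: nbhs_right_lt.
  move=> [x c] /= []; rewrite -ball_normE /= => xr cr s sc.
  have h1 : `|h x0 - h x| < w / 2 by apply: hb; lra.
  have h2 : `|h x0 - h (x - s *: one)| < w / 2.
    apply: hb; rewrite opprB addrA addrAC; apply: (le_lt_trans (ler_normD _ _)).
    by have := norm_scale_ones s; lra.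
  by have := ler_distD (h x0) (h x) (h (x - s *: one)); rewrite [`|h x - h x0|]distrC; lra.
move=> e /= e0 he; exists (Num.min (e / 2) 1); first by rewrite lt_min divr_gt0//=.
move=> x r; rewrite le_min => /andP[re r1].
have [xC|xC] := leP `|x| (C + 1).
  apply: (he (e / 2)) => //=; last by rewrite divr_gt0.
  by rewrite sub0r normrN gtr0_norm ?divr_gt0//; lra.
have z y : C < `|y| -> h y = 0.
  by move=> yC; apply/eqP/negP => /negP/HC; rewrite leNgt yC.
rewrite (z x) ?(z (x - r *: one)) ?subrr ?normr0 ?ltW//; last by lra.
have := ler_normB (x - r *: one) (- (r *: one)); rewrite opprK subrK normrN.
by have := norm_scale_ones r; lra.
Qed.

End CompactSupport.

Section LocalLimitTheorem.
Context {R : realType} {d : nat} {dO : measure_display} {Omega : measurableType dO}.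
Local Notation V := 'rV[R]_d.
Local Notation one := (@ones R d).
Variable P : probability Omega R.
Variable A : nat -> Omega -> V -> V.
Variable X0 : Omega -> V.
Hypothesis d0 : (0 < d)%N.
Hypothesis tA : forall n w, (0 < n)%N -> topical_op (A n w).
Hypothesis mA : forall n, (0 < n)%N -> measurable_fun setT (A n : Omega -> OpB R d).
Hypothesis mX0 : measurable_fun setT (X0 : Omega -> VB R d).
Hypothesis iX : indep P A X0.
Variables (gamma sigma : R).
Hypothesis CLT : forall f : V -> R, continuous f -> (exists M : R, forall x, `|f x| <= M) ->
     (fun n : nat => Ex P (fun w => f ((Num.sqrt n%:R)^-1 *: (xn A X0 n w - (n%:R * gamma) *: one))))
       @ \oo --> gauss_exp sigma (fun z => f (z *: one)).
Variable nu0 : probability (VB R d) R.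
Hypothesis inv : chain_invariant P A nu0.
Variable N : nat.
Hypothesis N0 : (0 < N)%N.
Hypothesis PN : (0 < P (rank1_event A N))%E.
Hypothesis NL : nonlattice P A N.

Lemma xn_decay (K : R) : 0 < K -> exists2 c : R, 0 < c &
  forall t : R, 0 < t -> t <= K -> forall M (G : V -> R), eqv t M G -> forall n : nat, c^-1 <= n%:R ->
  `|Ex P (fun w => G (xn A X0 n w))| <= M * expR (- (c * n%:R * t ^+ 2)).
Proof.
move=> K0; have [c c0 H] := decay d0 tA mA iX K NL N0.
exists c => // t t0 tK M G eG n cn; have [bG GM _] := eG.
rewrite (Ex_xn tA mA mX0 iX n bG); apply: Ex_bound; last by move=> w; exact: H.
exact: (bm_comp (bm_iter_Pop P tA mA n bG) mX0).
Qed.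

Lemma sigma_gt0 : 0 <= sigma -> 0 < sigma.
Proof.
rewrite le_eqVlt => /predU1P[s0|//]; exfalso.
have [c c0 H] := xn_decay (@ltr01 R).
have cl (x y : R) : `|cos x - cos y| <= 1 * `|x - y| by rewrite mul1r; exact: cos_lip.
have := CLT_vmax d0 CLT cl (@cos_max R) ler01.
rewrite /gauss_exp -s0 eqxx cos0 => cv.
have e1 : expR (- c) < 1 by rewrite expR_lt1 oppr_lt0.
have e0 : 0 < (1 - expR (- c)) / 2 by rewrite divr_gt0// subr_gt0.
have /cvgrPdist_le/(_ _ e0)[n0 _ Hn] := cv.
pose n := maxn (maxn 1 n0) (Num.bound c^-1).
have n1 : (0 < n)%N by rewrite /n !leq_max.
have nn0 : (n0 <= n)%N by rewrite /n !leq_max leqnn orbT.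
have cn : c^-1 <= n%:R.
  apply: (le_trans (ltW (archi_boundP _))); first by rewrite invr_ge0 ltW.
  by rewrite ler_nat /n leq_maxr.
have := Hn n nn0; rewrite /=.
have s1 : 0 < Num.sqrt n%:R :> R by rewrite sqrtr_gt0 ltr0n.
have t0 : 0 < (Num.sqrt n%:R)^-1 :> R by rewrite invr_gt0.
have t1 : (Num.sqrt n%:R)^-1 <= 1 :> R.
  by rewrite invf_le1// -[leLHS]sqrtr1 ler_wsqrtr// ler1n.
have := H _ t0 t1 _ _ (eqv_cos_vmax d0 (Num.sqrt n%:R)^-1 (- (n%:R * gamma))) n cn.
have -> : c * n%:R * (Num.sqrt n%:R)^-1 ^+ 2 = c.
  by rewrite exprVn sqr_sqrtr// mulfK// pnatr_eq0 -lt0n.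
rewrite mul1r.
under eq_fun do rewrite mulrC.
move: (Ex P _) => q; rewrite !ler_norml => /andP[? ?] /andP[? ?]; move: e1; lra.
Qed.

Variables (h : V -> R) (M C : R).
Hypothesis ch : continuous h.
Hypothesis hM : forall x, `|h x| <= M.
Hypothesis hC : forall x, h x != 0 -> `|vmax x| <= C.
Hypothesis C1 : 1 <= C.
Hypothesis hU : forall w : R, 0 < w -> exists2 eta : R, 0 < eta &
  forall x r, `|r| <= eta -> `|h x - h (x - r *: one)| <= w.

(** [eta] is fixed before [n]. Once divided by [eta^2], the five errors are: regularity over the
    window, the fibre error of order [1 / (eta^2 sqrt n)], mixing, the central limit theorem, and
    the variation of the density over the window, of order [eta]. *)
Lemma llt (e : R) : 0 < sigma -> 0 < e -> exists n0 : nat, forall n, (n0 <= n)%N -> forall u,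
  `|Num.sqrt n%:R * Ex P (fun w => h (xn A X0 n w + (- (n%:R * gamma) - u) *: one)) -
    Ex nu0 (fibre_integral h) * normal_pdf 0 sigma (u / Num.sqrt n%:R)| <= e.
Proof.
move=> s0 e0; have M0 : 0 <= M by exact: le_trans (hM 0).
have C0 : 0 <= C by exact: le_trans C1.
pose MH := M * (2 * C); pose Lp := (sigma * Num.sqrt (2 * pi))^-1 / sigma.
have MH0 : 0 <= MH by rewrite !mulr_ge0.
have Lp0 : 0 <= Lp by rewrite divr_ge0 ?(ltW s0)// invr_ge0 mulr_ge0 ?sqrtr_ge0// ltW.
have e5 : 0 < e / 5 by rewrite divr_gt0.
have mY := measurable_xn tA mA mX0.
have [eta1 eta10 [n1 H1]] := local_reg d0 mY xn_decay ch hM hC C1 hU e5.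
have q1 : 0 < 5 * ((MH + 1) * (Lp + 1)) by rewrite !mulr_gt0// ltr_wpDl.
(* The first term is the range of equicontinuity; the second makes the variation of the density, of
   Lipschitz constant [Lp], cost at most [e / 5]. *)
pose eta := Num.min eta1 (e / (5 * ((MH + 1) * (Lp + 1)))).
have eta0 : 0 < eta by rewrite lt_min eta10 divr_gt0.
have etaL : MH * (Lp * eta) <= e / 5.
  apply: (@le_trans _ _ ((MH + 1) * ((Lp + 1) * (e / (5 * ((MH + 1) * (Lp + 1))))))).
    apply: ler_pM => //; [by rewrite mulr_ge0// ltW|by rewrite lerDl|].
    by apply: ler_pM => //; [exact: ltW|rewrite lerDl|rewrite ge_min lexx orbT].
  have u1 : MH + 1 != 0 by rewrite lt0r_neq0// ltr_wpDl.
  have u2 : Lp + 1 != 0 by rewrite lt0r_neq0// ltr_wpDl.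
  by rewrite le_eqVlt; apply/orP; left; apply/eqP; field; rewrite u1 u2.
have eta2 : 0 < eta ^+ 2 by rewrite exprn_gt0.
have bF := bm_fibre_integral d0 ch hM hC C1.
have iF := fibre_integral_inv d0 ch hM hC.
have FM := fibre_integral_le d0 ch hM hC C1.
have em : 0 < eta ^+ 2 * (e / 5) by rewrite mulr_gt0.
have [n2 H2] := mixing d0 tA mA mX0 iX CLT inv PN eta0 bF iF em.
have et : 0 < eta ^+ 2 * (e / 5) / (MH + 1) by rewrite divr_gt0// ltr_wpDl.
have [n3 H3] := tent_uniform d0 tA mA mX0 CLT s0 eta0 et.
(* A threshold for [sqrt n], beyond which the constant error of [tent_average] is at most [e / 5] of
   [eta^2 sqrt n]. *)
pose D := C * M * (2 * C) / (eta ^+ 2 * (e / 5)).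
have D0 : 0 <= D by rewrite divr_ge0 ?(ltW em)// !mulr_ge0.
exists (maxn (maxn 1 n1) (maxn (maxn n2 n3) (Num.bound (D ^+ 2)))) => n.
rewrite !geq_max => /andP[/andP[n0 nn1] /andP[/andP[nn2 nn3] nD]] u.
set s := Num.sqrt n%:R.
have s1 : 0 < s by rewrite sqrtr_gt0 ltr0n.
have Ds : D <= s.
  rewrite -[leLHS](ger0_norm D0) -sqrtr_sqr; apply: ler_wsqrtr.
  apply: (le_trans (ltW (archi_boundP (exprn_ge0 2 D0)))).
  by rewrite ler_nat.
set b := - (n%:R * gamma) - u.
set E := Ex P (fun w => h (xn A X0 n w + b *: one)).
pose Z w := (vmax (xn A X0 n w) - n%:R * gamma) / s.
have T1 : `|(eta * s) ^+ 2 * E - Ex P (fun w => tent (eta * s) (vmax (xn A X0 n w) + b) * fibre_integral h (xn A X0 n w))|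
    <= (eta * s) ^+ 2 * (e / 5 / s) + C * M * (2 * C).
  have es0 : 0 <= eta * s by rewrite mulr_ge0// ltW.
  apply: (@tent_average_Ex R d d0 h M C ch hM hC C1 _ _ P (xn A X0 n) (mY n) (eta * s) b (e / 5 / s) es0) => r rs.
  rewrite ler_pdivlMr// mulrC; apply: H1 => //.
  have -> : b - r - b = - r by ring.
  rewrite normrN (le_trans rs)// ler_wpM2r ?(ltW s1)// ge_min lexx//.
(* By homogeneity of [tent], a window of half-width [eta s] for the height is one of half-width
   [eta] for the rescaled height, centred at [u / s]. *)
have T2 : Ex P (fun w => tent (eta * s) (vmax (xn A X0 n w) + b) * fibre_integral h (xn A X0 n w)) =
    s * Ex P (fun w => fibre_integral h (xn A X0 n w) * tent eta (Z w - u / s)).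
  rewrite -ExZ; last first.
    apply: bmM; first exact: (bm_comp bF (mY n)).
    exact: (bm_tentZ d0 tA mA mX0 gamma n (u / s) (ltW eta0)).
  congr Ex; apply/funext => w; rewrite mulrCA -tentZ ?(ltW s1)// [RHS]mulrC.
  by congr (tent _ _ * _); rewrite /Z /b; field; rewrite lt0r_neq0.
have G2 := H2 n nn2 (u / s); have G3 := H3 n nn3 (u / s).
have G4 := gauss_tent s0 (u / s) (ltW eta0).
rewrite T2 in T1.
move: G2 G3 G4 T1; rewrite -/s -/Lp -/(Z _).
rewrite -[X in `|X - _ * _| <= eta ^+ 2 * (e / 5) -> _]/(Ex P (fun w => fibre_integral h (xn A X0 n w) * tent eta (Z w - u / s))).
set EF := Ex P (fun w => _ * tent eta _).
rewrite -[X in `|EF - _ * X|]/(Ex P (fun w => tent eta (Z w - u / s))).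
set ET := Ex P (fun w => tent eta _).
set gT := gauss_exp _ _; set p := normal_pdf _ _ _; set nu := Ex nu0 _.
have nuM : `|nu| <= MH by apply: Ex_bound.
move=> G2 G3 G4 T1.
have a2 : (eta * s) ^+ 2 = eta ^+ 2 * s * s by rewrite exprMn; ring.
have es : 0 < eta ^+ 2 * s by rewrite mulr_gt0.
have S1 : `|eta ^+ 2 * (s * E) - EF| <= eta ^+ 2 * (2 * (e / 5)).
  rewrite -(ler_pM2l s1) -[X in X * `|_|](gtr0_norm s1) -normrM.
  have -> : s * (eta ^+ 2 * (s * E) - EF) = (eta * s) ^+ 2 * E - s * EF by rewrite a2; ring.
  apply: (le_trans T1); rewrite a2.
  have -> : eta ^+ 2 * s * s * (e / 5 / s) = s * (eta ^+ 2 * (e / 5)) by field; rewrite lt0r_neq0.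
  have : C * M * (2 * C) <= s * (eta ^+ 2 * (e / 5)).
    by move: Ds; rewrite /D ler_pdivrMr.
  have -> : s * (eta ^+ 2 * (2 * (e / 5))) = s * (eta ^+ 2 * (e / 5)) + s * (eta ^+ 2 * (e / 5)) by ring.
  by move: (s * (eta ^+ 2 * (e / 5))) (C * M * (2 * C)) => x y; lra.
have S3 : `|nu * ET - nu * gT| <= eta ^+ 2 * (e / 5).
  rewrite -mulrBr normrM; apply: (@le_trans _ _ (MH * (eta ^+ 2 * (e / 5) / (MH + 1)))).
    exact: ler_pM.
  rewrite mulrA ler_pdivrMr ?ltr_wpDl// mulrC ler_wpM2l ?(ltW em)//.
  by rewrite lerDl.
have S4 : `|nu * gT - nu * (eta ^+ 2 * p)| <= eta ^+ 2 * (e / 5).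
  rewrite -mulrBr normrM; apply: (@le_trans _ _ (MH * (Lp * eta ^+ 3))).
    exact: ler_pM.
  have -> : MH * (Lp * eta ^+ 3) = eta ^+ 2 * (MH * (Lp * eta)) by ring.
  by rewrite ler_pM2l.
rewrite -(ler_pM2l eta2) -[X in X * `|_|](gtr0_norm eta2) -normrM mulrBr.
have -> : eta ^+ 2 * e = eta ^+ 2 * (2 * (e / 5)) + eta ^+ 2 * (e / 5) + eta ^+ 2 * (e / 5) + eta ^+ 2 * (e / 5).
  by field.
have -> : eta ^+ 2 * (s * E) - eta ^+ 2 * (nu * p) =
  (eta ^+ 2 * (s * E) - EF) + (EF - nu * ET) + (nu * ET - nu * gT) + (nu * gT - nu * (eta ^+ 2 * p)) by ring.
apply: (le_trans (ler_normD _ _)); apply: lerD => //.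
apply: (le_trans (ler_normD _ _)); apply: lerD => //.
by apply: (le_trans (ler_normD _ _)); apply: lerD.
Qed.

End LocalLimitTheorem.

(** * The limit measure *)

Section LimitMeasure.
Context {R : realType} {d : nat}.
Local Notation V := 'rV[R]_d.
Local Notation one := (@ones R d).
Local Notation mu := (@lebesgue_measure R).
Hypothesis d0 : (0 < d)%N.
Variable phi : V -> R.
Hypothesis tphi : topical_fun phi.
Variable nu0 : probability (VB R d) R.

(* Inverse of [x |-> (pr x, phi x)]. *)
Definition polar_map (z : VB R d * measurableTypeR R) : VB R d := z.1 - (phi z.1 - z.2) *: one.

Lemma measurable_phi : measurable_fun setT (phi : VB R d -> R).
Proof. exact: VB_cont_real (topical_fun_cont tphi). Qed.

Lemma measurable_polar_map : measurable_fun setT polar_map.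
Proof.
apply: (measurableT_comp measurable_fibre (g := fun z : VB R d * measurableTypeR R => (z.1, phi z.1 - z.2))).
apply: measurable_fun_pair; first exact: measurable_fst.
apply: measurable_funB; last exact: measurable_snd.
exact: (measurableT_comp measurable_phi measurable_fst).
Qed.

Lemma phi_polar_map z : phi (polar_map z) = z.2.
Proof. by rewrite /polar_map -scaleNr tphi.2; ring. Qed.

Lemma pr_polar_map z : pr (polar_map z) = pr z.1.
Proof. by rewrite /polar_map -scaleNr (prD d0). Qed.

(** Kept transparent, so that its values unfold to those of the product measure on preimages. *)
Definition limit_measure : {measure set (VB R d) -> \bar R}.
Proof.
refine (pushforward (nu0 \x mu)%E polar_map : {measure set (VB R d) -> \bar R}).
exact: measurable_polar_map.
Defined.

Lemma limit_measureE D : limit_measure D = (nu0 \x mu)%E (polar_map @^-1` D).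
Proof. by []. Qed.

(** The slab [|phi| <= n] pulls back to the whole space times [[- n, n]], of mass [2 n]. *)
Lemma limit_measure_sigma_finite : sigma_finite setT limit_measure.
Proof.
exists (fun n : nat => (phi : VB R d -> R) @^-1` `[(- n%:R)%R, n%:R]%classic).
  apply/seteqP; split => // x _; exists (Num.bound `|phi x|) => //=.
  by rewrite in_itv/= -ler_norml ltW// archi_boundP.
move=> n; have mB : measurable ((phi : VB R d -> R) @^-1` `[(- n%:R)%R, n%:R]%classic).
  by rewrite -[X in measurable X]setTI; exact: measurable_phi.
split => //; rewrite limit_measureE.
rewrite (_ : _ @^-1` _ = setT `*` `[(- n%:R)%R, n%:R]%classic); last first.
  by apply/seteqP; split => z; rewrite /= phi_polar_map => // -[].
rewrite product_measure1E//= probability_setT mul1e lebesgue_measure_itv/= lte_fin.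
by case: ifP => // _; rewrite ltry.
Qed.

(** After [polar_map], the map [(pr, phi)] sends [(y, r)] to [(pr y, r)], which is [(y, r)] for
    [nu0]-almost every [y]. *)
Lemma limit_measure_polar (D : set (VB R d * R)) : nu0 (~` PRset) = 0%E -> measurable D ->
  pushforward limit_measure (fun x : VB R d => ((pr x : VB R d), phi x)) D = (nu0 \x mu)%E D.
Proof.
move=> nPR mD; rewrite {1}/pushforward limit_measureE.
have mpr : measurable_fun setT (fun x : VB R d => pr x : VB R d) by exact: VB_cont (pr_cont d0).
rewrite (_ : _ @^-1` _ = (fun z : VB R d * measurableTypeR R => (pr z.1 : VB R d, z.2)) @^-1` D); last first.
  by apply/seteqP; split => z; rewrite /= pr_polar_map phi_polar_map.
set D' := _ @^-1` D.
have mD' : measurable D'.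
  rewrite -[X in measurable X]setTI.
  have : measurable_fun setT (fun z : VB R d * measurableTypeR R => (pr z.1 : VB R d, z.2)).
    apply: measurable_fun_pair; last exact: measurable_snd.
    exact: (measurableT_comp mpr measurable_fst).
  by apply.
rewrite /product_measure1; apply: ae_eq_integral => //.
- exact: measurable_fun_xsection.
- exact: measurable_fun_xsection.
exists (~` PRset); split => //.
  apply: measurableC; rewrite (_ : PRset = (@vmax R d : VB R d -> R) @^-1` [set 0]).
    by rewrite -[X in measurable X]setTI; exact: measurable_vmax.
  apply/seteqP; split => x /=; rewrite /PRset /=.
    by move=> <-; rewrite /pr -scaleNr (vmaxD d0) subrr.
  by rewrite /pr => ->; rewrite scale0r subr0.
move=> y /= hy Py; apply: hy => _; congr (mu _).
by apply/seteqP; split => r; rewrite /xsection/= !inE /D'/= Py.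
Qed.

Variables (h : V -> R) (M C : R).
Hypothesis ch : continuous h.
Hypothesis hM : forall x, `|h x| <= M.
Hypothesis hC : forall x, h x != 0 -> `|x| <= C.

Let hCv x : h x != 0 -> `|vmax x| <= C.
Proof.
move=> /hC; apply: le_trans.
by have := vmax_lip d0 x 0; rewrite vmax0// !subr0.
Qed.

Lemma polar_integrable :
  ((nu0 \x mu)%E).-integrable setT (EFin \o (h \o polar_map)) /\
  \int[(nu0 \x mu)%E]_z (h \o polar_map) z = Ex nu0 (fibre_integral h).
Proof.
have M0 : 0 <= M by exact: le_trans (hM 0).
have mf : measurable_fun setT (h \o polar_map).
  exact: (measurableT_comp (VB_cont_real ch) measurable_polar_map).
(* If [h] is nonzero at [polar_map (x, r)], that point has norm at most [C] and [phi] takes the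
   value [r] there; nonexpansiveness gives [|r| <= S]. *)
pose S := `|phi 0| + C.
have i1 : nu0.-integrable setT (EFin \o (cst 1 : VB R d -> R)).
  exact: finite_measure_integrable_cst.
have i2 : mu.-integrable setT (EFin \o (fun r => M * \1_(`[(- S)%R, S]%classic) r)).
  exact: (integrableZl measurableT M (integrable_indic_itv (- S) S true false)).
have g10 x : 0 <= (cst 1 : VB R d -> R) x by [].
have g20 r : 0 <= M * \1_(`[(- S)%R, S]%classic) r by rewrite mulr_ge0// indicE.
have fg x r : `|(h \o polar_map) (x, r)| <= (cst 1 : VB R d -> R) x * (M * \1_(`[(- S)%R, S]%classic) r).
  rewrite mul1r /=; have [->|hn] := eqVneq (h (polar_map (x, r))) 0.
    by rewrite normr0 mulr_ge0// indicE.
  rewrite indicE mem_set ?mulr1//= in_itv/= -ler_norml.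
  have := topical_fun_lip (polar_map (x, r)) 0 tphi; rewrite phi_polar_map/= subr0.
  have := hC hn; have := ler_distD (phi 0) r 0; rewrite !subr0 /S; lra.
split; first exact: dom_integrable_prod mf i1 i2 g10 g20 fg.
rewrite (RFubini_prod mf i1 i2 g10 g20 fg) ExE; apply: eq_Rintegral => y _ /=.
have cst1 (r : R) : `|1 : R| <= 1 by rewrite normr1.
have iT := fibre_conv_integrable d0 ch hM hCv y (measurable_cst (1 : R)) cst1.
(* The substitution [r |-> phi y - r] turns height [r] into displacement along the fibre; the choice
   of [phi] disappears here. *)
rewrite /fibre_integral /fibre_conv -[RHS](Rint_reflect (phi y) iT).
by apply: eq_Rintegral => r _; rewrite mulr1.
Qed.

Lemma limit_measure_integral :
  limit_measure.-integrable setT (fun x => (h x)%:E) /\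
  fine (\int[limit_measure]_x (h x)%:E)%E = Ex nu0 (fibre_integral h).
Proof.
have [ip <-] := polar_integrable.
have mh : measurable_fun setT (EFin \o (h : VB R d -> R)).
  by apply/measurable_EFinP; exact: VB_cont_real.
have ip' : ((nu0 \x mu)%E).-integrable (polar_map @^-1` setT) ((EFin \o h) \o polar_map).
  by rewrite preimage_setT.
split.
  exact: (integrable_pushforward measurable_polar_map mh ip' measurableT).
rewrite /limit_measure (integral_pushforward measurable_polar_map mh ip' measurableT).
by rewrite preimage_setT.
Qed.

End LimitMeasure.

Theorem theorem2p3 (R : realType) (d : nat) (dO : measure_display)
  (Omega : measurableType dO) (P : probability Omega R)
  (A : nat -> Omega -> 'rV[R]_d -> 'rV[R]_d) (X0 : Omega -> 'rV[R]_d)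
  (phi : 'rV[R]_d -> R) (gamma sigma : R) (nu0 : probability (VB R d) R) :
  (* random topical operators A(n), n >= 1 *)
  (forall n w, (0 < n)%N -> topical_op (A n w)) ->
  (forall n, (0 < n)%N -> measurable_fun setT (A n : Omega -> OpB R d)) ->
  (* X0 is a random vector *)
  measurable_fun setT (X0 : Omega -> VB R d) ->
  (* (A(n))_{n>=1} i.i.d. and X0 independent of (A(n)) *)
  (forall (n : nat) (B : set (VB R d)) (E : nat -> set (OpB R d)),
     measurable B -> (forall k, measurable (E k)) ->
     P [set w | B (X0 w) /\ forall k : nat, (k < n)%N -> E k (A k.+1 w)] =
     (P (X0 @^-1` B) * \prod_(k < n) P (A 1%N @^-1` E k))%E) ->
  memory_loss P A ->
  topical_fun phi ->
  (* gamma is the Lyapunov exponent *)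
  {ae P, forall w, forall i, (fun n : nat => (xn A X0 n w) ord0 i / n%:R) @ \oo --> gamma} ->
  (* sigma^2 >= 0 is the variance in the CLT *)
  0 <= sigma ->
  (forall f : 'rV[R]_d -> R, continuous f -> (exists M : R, forall x, `|f x| <= M) ->
     (fun n : nat => Ex P (fun w => f ((Num.sqrt n%:R)^-1 *: (xn A X0 n w - (n%:R * gamma) *: ones))))
       @ \oo --> gauss_exp sigma (fun z => f (z *: ones))) ->
  (* nu0 is the unique invariant probability measure of the chain on PR^d_max *)
  chain_invariant P A nu0 ->
  (forall nu : probability (VB R d) R, chain_invariant P A nu ->
     forall B, measurable B -> nu B = nu0 B) ->
  (* hypothesis (i) or (ii) *)
  ( ( (\int[P]_w (ereal_sup [set (`|phi (A 1%N w x) - phi x|)%R%:E | x in [set: 'rV[R]_d]]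
                  * ereal_sup [set (`|phi (A 1%N w x) - phi x|)%R%:E | x in [set: 'rV[R]_d]]) < +oo)%E
      /\ 0 < sigma /\ system_non_arithmetic P A phi )
  \/
    ( (exists2 eps : R, 0 < eps & (\int[P]_w ((`|A 1%N w 0| `^ (4 + eps))%R%:E) < +oo)%E)
      /\ (exists M : R, {ae P, forall w, `|X0 w| <= M})
      /\ alg_non_arithmetic P A ) ) ->
  0 < sigma /\
  exists alpha : {measure set VB R d -> \bar R},
    sigma_finite setT alpha /\
    (forall h : 'rV[R]_d -> R, continuous h -> compact (closure [set x | h x != 0]) ->
       alpha.-integrable setT (fun x => (h x)%:E) /\
       (forall e : R, 0 < e -> exists N : nat, forall n : nat, (N <= n)%N ->
          forall u : R,
            `| sigma * Num.sqrt (2 * pi * n%:R)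
                 * Ex P (fun w => h (xn A X0 n w - (n%:R * gamma) *: ones - u *: ones))
               - Ex P (fun w => expR (- (u + phi (X0 w)) ^+ 2 / (2 * n%:R * sigma ^+ 2)))
                 * fine (\int[alpha]_x (h x)%:E)%E | <= e)) /\
    (forall D : set (VB R d * R), measurable D ->
       pushforward alpha (fun x : VB R d => ((pr x : VB R d), phi x)) D
       = (nu0 \x (@lebesgue_measure R))%E D).
Proof.
move=> tA mA mX0 iX ml tphi _ sge0 CLT inv _ hyp.
have d0 := topical_fun_dim tphi.
have [N [N0 PN]] := ml.
have NL : nonlattice P A N.
  case: hyp => [[_ [_ sna]]|[_ [_ nar]]].
  - exact: (spectral_nonlattice d0 tA mA iX PN tphi sna).
  - exact: (support_nonlattice d0 tA mA iX PN nar).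
have s0 := sigma_gt0 d0 tA mA mX0 iX CLT N0 NL sge0.
split => //; exists (limit_measure tphi nu0).
split; first exact: limit_measure_sigma_finite.
split; last first.
  by move=> D mD; apply: limit_measure_polar => //; case: inv.
move=> h ch hK.
have [C C1 hC] := support_bounded hK.
have [M hM] := compact_support_le ch hK.
have hU := compact_support_unif ch hK.
have hCv x : h x != 0 -> `|vmax x| <= C.
  by move=> /hC; apply: le_trans; have := vmax_lip d0 x 0; rewrite vmax0// !subr0.
have [ia ->] := limit_measure_integral d0 tphi nu0 ch hM hC.
split; first exact: ia.
move=> e e0; set nu := Ex nu0 _.
(* The inverse of the peak of the normal density, so that [k] times the density is the unnormalized
   [bell]. *)
pose k := sigma * Num.sqrt (2 * pi).
have k0 : 0 < k by rewrite mulr_gt0// sqrtr_gt0 mulr_gt0// pi_gt0.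
have e1 : 0 < e / 2 / k by rewrite !divr_gt0.
have e2 : 0 < e / 2 / (`|nu| + 1) by rewrite !divr_gt0// ltr_wpDl.
have [n1 H1] := llt d0 tA mA mX0 iX CLT inv N0 PN NL ch hM hCv C1 hU s0 e1.
(* The shift by [phi (X0)] is negligible at scale [sqrt n]. *)
have mphi : measurable_fun setT (fun w => phi (X0 w) / sigma).
  apply: measurable_funM; last exact: measurable_cst.
  exact: (measurableT_comp (measurable_phi tphi) mX0).
have [n2 H2] := Ex_min1_cvg P mphi e2.
exists (maxn 1 (maxn n1 n2)) => n; rewrite !geq_max => /andP[n0 /andP[nn1 nn2]] u.
pose s : R := Num.sqrt n%:R.
have sn0 : 0 < s by rewrite sqrtr_gt0 ltr0n.
have G1 := H1 n nn1 u; have G2 := H2 n nn2.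
have -> : (fun w => h (xn A X0 n w - (n%:R * gamma) *: ones - u *: ones)) =
    (fun w => h (xn A X0 n w + (- (n%:R * gamma) - u) *: ones)).
  by apply/funext => w; congr h; rewrite scalerBl scaleNr addrA.
set E := Ex P _.
have sE : sigma * Num.sqrt (2 * pi * n%:R) = k * s.
  by rewrite sqrtrM ?mulr_ge0 ?pi_ge0// mulrA.
rewrite sE.
have bE : k * normal_pdf 0 sigma (u / s) = bell (u / s / sigma).
  by rewrite normal_pdf_bell// mulrA divff ?mul1r// lt0r_neq0.
(* In units of [sigma sqrt n] the initial height is a shift of the argument of the 1-Lipschitz
   function [bell], uniformly in [u]. *)
have -> : (fun w => expR (- (u + phi (X0 w)) ^+ 2 / (2 * n%:R * sigma ^+ 2))) =
    (fun w => bell (u / s / sigma + phi (X0 w) / sigma / s)).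
  apply/funext => w; rewrite /bell; congr expR.
  have -> : n%:R = s ^+ 2 by rewrite sqr_sqrtr.
  by field; rewrite !lt0r_neq0.
set B := Ex P _.
have mps : measurable_fun setT (fun w => phi (X0 w) / sigma / s).
  by apply: measurable_funM => //; exact: measurable_cst.
have bB : bm (fun w => bell (u / s / sigma + phi (X0 w) / sigma / s)).
  split; last by exists 1 => w; rewrite ger0_norm ?bell_ge0 ?bell_le1.
  apply: measurableT_comp; first exact: continuous_measurable_fun (@bell_cont R).
  by apply: measurable_funD => //; exact: measurable_cst.
have B1 : `|bell (u / s / sigma) - B| <= e / 2 / (`|nu| + 1).
  apply: le_trans G2; rewrite -[X in X - _](Ex_cst P) -ExB//; last exact: bm_cst.
  apply: Ex_norm_le; first by apply: bmB => //; exact: bm_cst.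
    exact: bm_min1_div mphi (sqrtr_ge0 _).
  move=> w; rewrite le_min; apply/andP; split.
    have := bell_le1 (u / s / sigma); have := bell_ge0 (u / s / sigma).
    have := bell_le1 (u / s / sigma + phi (X0 w) / sigma / s).
    have := bell_ge0 (u / s / sigma + phi (X0 w) / sigma / s).
    by move: (bell _) (bell _) => a b ? ? ? ?; rewrite ler_norml; apply/andP; split; lra.
  apply: (le_trans (bell_lip _ _)).
  by rewrite opprD addrA subrr add0r normrN normrM [`|s^-1|]ger0_norm// invr_ge0 ltW.
have S1 : `|k * s * E - nu * bell (u / s / sigma)| <= e / 2.
  rewrite -bE.
  have -> : k * s * E - nu * (k * normal_pdf 0 sigma (u / s)) =
    k * (s * E - nu * normal_pdf 0 sigma (u / s)) by ring.
  by rewrite normrM (gtr0_norm k0) mulrC -ler_pdivlMr.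
have S2 : `|nu * bell (u / s / sigma) - B * nu| <= e / 2.
  rewrite [B * nu]mulrC -mulrBr normrM.
  apply: (@le_trans _ _ (`|nu| * (e / 2 / (`|nu| + 1)))); first by rewrite ler_wpM2l.
  rewrite mulrA ler_pdivrMr ?ltr_wpDl// mulrC ler_wpM2l ?divr_ge0 ?(ltW e0)//.
  by rewrite lerDl.
have -> : k * s * E - B * nu = (k * s * E - nu * bell (u / s / sigma)) + (nu * bell (u / s / sigma) - B * nu) by ring.
by apply: (le_trans (ler_normD _ _)); rewrite [leRHS]splitr lerD.
Qed.
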